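(* Let $\beta\in(1/2,1)$, $r>0$, $\theta=\sqrt{2r}$, let $X$ be skew Brownian motion with parameter $\beta$, and let $g:\mathbb{R}\to[0,\infty)$ satisfy: (g1) $g$ is continuous, non-decreasing, non-negative, and has finite left and right derivatives; (g2) $\lim_{x\to\infty}g(x)/\psi_r(x)=0$ and $\lim_{x\to-\infty}g(x)/\psi_r(x)=0$. Let $V(x)=\sup_{\tau\in\mathcal{T}}\mathbb{E}_x[e^{-r\tau}g(X_\tau)]$ and $\mathcal{M}=\operatorname{argmax}_{x\in\mathbb{R}}\{g(x)/\psi_r(x)\}$. Assume that $\mathcal{M}=\{x^\ast\}$ with $x^\ast<0$, and that (i) $g\in C^2([x^\ast,\infty))$; (ii) $(1-\beta)\theta e^{-\theta x^\ast}g(x^\ast)>\beta g'(0)>0$; (iii) $g''(x)-2rg(x)<-\varepsilon$ for all $x\ge x^\ast$ and some $\varepsilon>0$. Then the system of equations $$(L_\psi g)(x)=(L_\psi g)(y),\qquad (L_\varphi g)(x)=(L_\varphi g)(y)$$ has a unique solution $\mathbf{y}^\ast=(y_1^\ast,y_2^\ast)$ (with $x=y_1^\ast$, $y=y_2^\ast$) such that $\mathbf{y}^\ast\in(x^\ast,0)\times(0,\infty)$. Moreover, $\tau^\ast=\inf\{t\ge0:X_t\in A\}$ with $A=[x^\ast,y_1^\ast]\cup[y_2^\ast,\infty)$ is the optimal stopping time, and $$V(x)=\begin{cases}g(x),&x\in[x^\ast,y_1^\ast]\cup[y_2^\ast,\infty),\\ g(x^\ast)\dfrac{\psi_r(x)}{\psi_r(x^\ast)},&x\in(-\infty,x^\ast),\\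 g(y_1^\ast)\,\mathbb{E}_x\left[e^{-r\hat\tau_{y_1^\ast}};\hat\tau_{y_1^\ast}<\hat\tau_{y_2^\ast}\right]+g(y_2^\ast)\,\mathbb{E}_x\left[e^{-r\hat\tau_{y_2^\ast}};\hat\tau_{y_2^\ast}<\hat\tau_{y_1^\ast}\right],&x\in(y_1^\ast,y_2^\ast),\end{cases}$$ where $\hat\tau_y=\inf\{t\ge0:X_t=y\}$ and, for $x\in(y_1^\ast,y_2^\ast)$, $$\mathbb{E}_x\left[e^{-r\hat\tau_{y_1^\ast}};\hat\tau_{y_1^\ast}<\hat\tau_{y_2^\ast}\right]=\frac{\varphi_r(x)\psi_r(y_2^\ast)-\psi_r(x)\varphi_r(y_2^\ast)}{\psi_r(y_2^\ast)\varphi_r(y_1^\ast)-\varphi_r(y_2^\ast)\psi_r(y_1^\ast)},$$ $$\mathbb{E}_x\left[e^{-r\hat\tau_{y_2^\ast}};\hat\tau_{y_2^\ast}<\hat\tau_{y_1^\ast}\right]=\frac{\psi_r(x)\varphi_r(y_1^\ast)-\varphi_r(x)\psi_r(y_1^\ast)}{\psi_r(y_2^\ast)\varphi_r(y_1^\ast)-\varphi_r(y_2^\ast)\psi_r(y_1^\ast)}.$$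
   Context: Skew Brownian motion (SBM) with parameter $\beta\in[0,1]$ started at $x\in\mathbb{R}$ is the unique strong solution of $X_t=x+W_t+(2\beta-1)\,l_t^X$, where $W$ is a standard Brownian motion and $l^X$ is the (symmetric) local time of $X$ at zero, normalized with respect to Lebesgue measure. Its transition law is, for $t>0$, $$\mathbb{P}_x[X_t\in dy]=\frac{1}{\sqrt{2\pi t}}\left(e^{-\frac{(x-y)^2}{2t}}+(2\beta-1)\,\mathrm{sgn}(y)\,e^{-\frac{(|x|+|y|)^2}{2t}}\right)dy .$$ $\mathbb{P}_x,\mathbb{E}_x$ denote probability and expectation when $X_0=x$; $\mathbb{E}_x[Z;B]=\mathbb{E}_x[Z\mathbf{1}_B]$. With $\theta=\sqrt{2r}$ put $$\psi_r(x)=\begin{cases}\frac{1}{2\beta}e^{\theta x}+\left(1-\frac{1}{2\beta}\right)e^{-\theta x},&x\ge0,\\ e^{\theta x},&x\le0,\end{cases}\qquad \varphi_r(x)=\begin{cases}e^{-\theta x},&x\ge0,\\ \frac{1}{2(1-\beta)}\left((1-2\beta)e^{\theta x}+e^{-\theta x}\right),&x\le0.\end{cases}$$ The scale function is $S(x)=x/\beta$ for $x\ge0$ and $S(x)=x/(1-\beta)$ for $x\le0$. For a differentiable function $F$, $$(L_\psi F)(x)=\frac{\psi_r^2(x)}{S'(x)}\frac{d}{dx}\left[\frac{F(x)}{\psi_r(x)}\right]=\begin{cases}\frac12\left(e^{\theta x}(F'(x)-\theta F(x))+(2\beta-1)e^{-\theta x}(F'(x)+\theta F(x))\right),&x>0,\\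 (1-\beta)e^{\theta x}(F'(x)-\theta F(x)),&x<0,\end{cases}$$ $$(L_\varphi F)(x)=\frac{\varphi_r^2(x)}{S'(x)}\frac{d}{dx}\left[\frac{F(x)}{\varphi_r(x)}\right]=\begin{cases}\beta e^{-\theta x}(F'(x)+\theta F(x)),&x>0,\\ \frac12\left(e^{-\theta x}(F'(x)+\theta F(x))-(2\beta-1)e^{\theta x}(F'(x)-\theta F(x))\right),&x<0.\end{cases}$$ $\mathcal{T}$ is the set of all stopping times with respect to the natural filtration generated by $X$ (the value $\infty$ is allowed); on $\{\tau=\infty\}$ the convention is $e^{-r\tau}g(X_\tau):=\limsup_{t\to\infty}e^{-rt}g(X_t)$. A stopping time $\tau^\ast$ is optimal if $V(x)=\mathbb{E}_x[e^{-r\tau^\ast}g(X_{\tau^\ast})]$ for all $x\in\mathbb{R}$. $\operatorname{argmax}$ denotes the set of global maximum points.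
   Formalization: Condition (i) is read as including ordinary (two-sided) differentiability of g at x*, with g'' one-sided there; if g may have a kink at x*, the system can have no solution in (x*,0)×(0,∞). *)

(* Defs.v *)
From HB Require Import structures.
From mathcomp Require Import all_boot all_order all_algebra.
From mathcomp Require Import all_classical all_reals all_analysis.

Set Implicit Arguments.
Unset Strict Implicit.
Unset Printing Implicit Defensive.

Import Order.TTheory GRing.Theory Num.Theory.
Import numFieldNormedType.Exports.

Local Open Scope classical_set_scope.
Local Open Scope ring_scope.

(* Processes are functions R -> T -> R; only the times t >= 0 are relevant. *)

Section processes.
Context {R : realType} {d : measure_display} {T : measurableType d}.
Implicit Types (P : probability T R) (X W l : R -> T -> R).

Definition past_events X (t : R) : set_system T :=
  \bigcup_(s in `[0, t]) preimage_set_system setT (X s) measurable.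

Definition natural_filtration X (t : R) : set_system T :=
  <<s past_events X t >>.

Definition augmented_filtration P X (t : R) : set_system T :=
  <<s past_events X t `|` P.-negligible >>.

Definition continuous_paths X :=
  forall w, {within `[0, +oo[, continuous (fun t => X t w)}.

(* The second argument of normal_prob is the standard deviation. *)
Definition standard_brownian_motion P W :=
  [/\ forall t, 0 <= t -> measurable_fun setT (W t),
      continuous_paths W,
      {ae P, forall w, W 0 w = 0},
      (forall s t (B : set R), 0 <= s -> s < t -> measurable B ->
         P ((fun w => W t w - W s w) @^-1` B) =
         normal_prob 0 (Num.sqrt (t - s)) B) &
      (forall s t (A : set T) (B : set R), 0 <= s -> s < t ->
         natural_filtration W s A -> measurable B ->
         let dW := fun w => W t w - W s w in
         P (A `&` dW @^-1` B) = (P A * P (dW @^-1` B))%E)].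

Definition symmetric_local_time_at_0 P X l :=
  {ae P, forall w, forall t, 0 <= t ->
     (2 * e)^-1 *
       fine (lebesgue_measure [set s | 0 <= s <= t /\ `|X s w| < e])
     @[e --> 0^'+] --> l t w}.

(* X is a strong solution, started at x, of
     X_t = x + W_t + (2 beta - 1) l^X_t.
   All paths of X are continuous, so that hitting times of closed sets are
   stopping times of the (unaugmented) natural filtration. *)
Definition skew_brownian_motion (beta x : R) P X :=
  [/\ forall t, 0 <= t -> measurable_fun setT (X t),
      continuous_paths X &
      exists W l,
      [/\ standard_brownian_motion P W,
          symmetric_local_time_at_0 P X l,
          (forall t (B : set R), 0 <= t -> measurable B ->
             augmented_filtration P W t (X t @^-1` B)) &
          {ae P, forall w, forall t, 0 <= t ->
             X t w = x + W t w + (2 * beta - 1) * l t w}]].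

Definition stopping_time X (tau : T -> \bar R) :=
  (forall w, 0 <= tau w)%E /\
  (forall t, 0 <= t -> natural_filtration X t [set w | (tau w <= t%:E)%E]).

Definition hitting_time X (A : set R) (w : T) : \bar R :=
  ereal_inf [set t%:E | t in [set t | 0 <= t /\ A (X t w)]].

(* e^{-r tau} g(X_tau), read as limsup_{t -> oo} e^{-rt} g(X_t) where tau = oo;
   the value -oo is excluded for stopping times. *)
Definition discounted_payoff (r : R) (g : R -> R) X (tau : T -> \bar R)
    (w : T) : \bar R :=
  if tau w is t%:E then (expR (- r * t) * g (X t w))%:E
  else limf_esup (fun t => (expR (- r * t) * g (X t w))%:E) (pinfty_nbhs R).

Variable P : R -> probability T R.

Definition value (r : R) (g : R -> R) X (x : R) : \bar R :=
  ereal_sup [set (\int[P x]_w discounted_payoff r g X tau w)%E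
            | tau in stopping_time X].

Definition optimal_stopping_time (r : R) (g : R -> R) X (tau : T -> \bar R) :=
  stopping_time X tau /\
  forall x, value r g X x = (\int[P x]_w discounted_payoff r g X tau w)%E.

(* E_x[e^{-r tau_a}; tau_a < tau_b] for the hitting times of points a, b *)
Definition discounted_hit_before (r : R) X (a b x : R) : \bar R :=
  (\int[P x]_(w in [set w | hitting_time X [set a] w
                             < hitting_time X [set b] w])
     expeR (- (r%:E * hitting_time X [set a] w)))%E.

End processes.

Section analytic.
Context {R : realType}.
Implicit Types (beta r : R) (f g F : R -> R).

Definition psi beta r (x : R) : R :=
  let theta := Num.sqrt (2 * r) in
  if 0 <= x then
    (2 * beta)^-1 * expR (theta * x)
      + (1 - (2 * beta)^-1) * expR (- theta * x)
  else expR (theta * x).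

Definition phi beta r (x : R) : R :=
  let theta := Num.sqrt (2 * r) in
  if 0 <= x then expR (- theta * x)
  else (2 * (1 - beta))^-1 *
    ((1 - 2 * beta) * expR (theta * x) + expR (- theta * x)).

Definition scale beta (x : R) : R :=
  if 0 <= x then x / beta else x / (1 - beta).

Definition L_psi beta r F (x : R) : R :=
  psi beta r x ^+ 2 / derive1 (scale beta) x *
  derive1 (fun z => F z / psi beta r z) x.

Definition L_phi beta r F (x : R) : R :=
  phi beta r x ^+ 2 / derive1 (scale beta) x *
  derive1 (fun z => F z / phi beta r z) x.

Definition argmax f : set R := [set x | forall y, f y <= f x].

Definition has_one_sided_derivatives f := forall x,
  cvg (h^-1 * (f (x + h) - f x) @[h --> 0^'+]) /\
  cvg (h^-1 * (f (x + h) - f x) @[h --> 0^'-]).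

Definition derive_within (A : set R) f (x : R) : R :=
  lim ((f y - f x) / (y - x) @[y --> within A x^']).

(* g'' on [a, oo), taken from the right at the endpoint a *)
Definition second_derivative_from (a : R) g : R -> R :=
  derive_within `[a, +oo[ (derive1 g).

(* g in C^2([a, oo)) for a function g defined on the whole line: g' is the
   ordinary derivative at every point of [a, oo), including a (a kink of g at a
   is excluded), while g'' at a only involves g' on [a, oo). *)
Definition C2_from (a : R) g :=
  [/\ forall x, a <= x -> derivable g x 1,
      (forall x, a <= x ->
         cvg ((derive1 g y - derive1 g x) / (y - x) @[y --> within `[a, +oo[ x^'])) &
      {within `[a, +oo[, continuous (second_derivative_from a g)}].

End analytic.

(* Main.v *)
(* Write [p = exp(th x) (g' - th g)] and [q = exp(- th x) (g' + th g)].  Both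
   decrease strictly on [xs, +oo[ by (iii), [p xs = 0] because [xs] maximizes
   [g / psi], and [L_psi g], [L_phi g] are combinations of [p] and [q].  The
   difference [L_phi g - L_psi g = (q - p) / 2] decreases on [xs, 0] and increases
   on [0, +oo[; this pairs each [x] with a unique [y], and (ii) gives a change of
   sign along the pairs.  A solution means that the combination of [psi] and [phi]
   equal to [g] at [y1], [y2] is tangent to [g] there, so the candidate value
   function [v >= g] satisfies [v'' <= 2 r v] off 0 and the transmission condition
   of the skew point.  To get [E[exp(- r tau) v(X_tau)] <= v x] without stochastic integrals, [v] is
   mollified by second differences and expanded along grids with the Gaussian
   increments of [W], and its kink is matched with the occupation-time definition
   of the local time.
   Applied to [v], to [psi] (growth of the paths) and to both [h] and [- h] for [h]
   in the span of [psi] and [phi] (exit problems), it yields all the claims. *)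
Require Import Defs.
From HB Require Import structures.
From mathcomp Require Import all_boot all_order all_algebra.
From mathcomp Require Import all_classical all_reals all_analysis measurable_realfun.
From mathcomp Require Import ring lra.

Set Implicit Arguments.
Unset Strict Implicit.
Unset Printing Implicit Defensive.

Import Order.TTheory GRing.Theory Num.Theory.
Import numFieldNormedType.Exports.

Local Open Scope classical_set_scope.
Local Open Scope ring_scope.

(** * Second differences and mollification *)

Section calculus.
Context {R : realType}.
Implicit Types f df u : R -> R.

(** The obstacle is the kink at 0. Along a path, a mollified function collects [gam * F1 0] per unit
    of local time from the skew push and [Del / 2] per unit of occupation from its own curvature at
    0. The limit rates cancel: [gam * m + Del / 2 = 0] is the transmission condition, [m] being the
    mean of the two slopes. At a positive scale there remain [|F1 0 - m|] times the local time and
    [|Del| / 2] times the gap between occupation and local time, and neither is controlled uniformly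
    in the path, since the local time is only an almost sure limit. The sums are therefore cut off
    by events that look at the past alone, so that each Gaussian step keeps its conditional mean,
    and the limits come in a fixed order: mesh to 0 first, then, for a chosen bound [J] on the local
    time, a scale fine enough for that [J]. Only one-sided bounds on second differences enter, so
    the candidate need not be [C^2] where its pieces meet. On the event of never stopping, a maximal
    inequality bounds [exp(- r t) psi(X_t)], and [g = o(psi)] at [+oo] then makes the limsup payoff
    vanish. *)

Lemma MVT_le f df (a b : R) : (forall x, is_derive x (1 : R) f (df x)) -> a <= b ->
  exists2 c, a <= c <= b & f b - f a = df c * (b - a).
Proof.
move=> fd; rewrite le_eqVlt => /predU1P[<-|ab].
  by exists a; rewrite ?lexx// !subrr mulr0.
have [c cab ->] := @MVT R f df a b ab (fun x _ => fd x)
  (@derivable_within_continuous _ _ _ _ (fun x _ => @ex_derive _ _ _ _ _ _ _ (fd x))).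
by exists c => //; move: cab; rewrite in_itv/= => /andP[/ltW-> /ltW->].
Qed.

Lemma MVT_any f df (a b : R) : (forall x, is_derive x (1 : R) f (df x)) ->
  exists2 c, `|c - a| <= `|b - a| & f b - f a = df c * (b - a).
Proof.
move=> fd; have [ab|/ltW ba] := leP a b.
  have [c /andP[c1 c2] e] := MVT_le fd ab; exists c => //.
  by rewrite !ger0_norm ?subr_ge0// lerB.
have [c /andP[c1 c2] e] := MVT_le fd ba; exists c.
  by rewrite !ler0_norm ?subr_le0// !opprB lerB.
by rewrite -opprB e -mulrN opprB.
Qed.

(** An integral from a base point is differentiated only to the right of it, so the base point
    [- (|x| + 1)] moves with [x] and lies left of both [x] and 0. Subtracting the integral up to 0
    makes the value independent of the base point. *)
Lemma antiderivative u : continuous u ->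
  exists U, forall x, is_derive x (1 : R) U (u x).
Proof.
move=> uc.
have ui (a b : R) : lebesgue_measure.-integrable `[a, b] (EFin \o u).
  apply: continuous_compact_integrable; first exact: segment_compact.
  exact: continuous_subspaceT.
pose I a x := (\int[lebesgue_measure]_(t in `[a, x]) u t).
have Id (a x : R) : a < x -> is_derive x (1 : R) (I a) (u x).
  move=> ax; have xx1 : x < x + 1 by rewrite ltrDl.
  have [|d1 d2] := @continuous_FTC1_closed R u a x (x + 1) xx1 (ui _ _) ax.
    exact: uc.
  by apply: DeriveDef => //; rewrite -derive1E.
have Isplit (a b x : R) : a <= b -> b <= x -> I a x = I a b + I b x.
  move=> ab bx; apply/eqP; rewrite addrC -subr_eq; apply/eqP.
  rewrite /I Rintegral_itvB ?bnd_simp//.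
  rewrite Rintegral_itv_obnd_cbnd//.
  by apply: integrableS (ui b x) => //; apply: subset_itvr; rewrite bnd_simp.
pose U x := I (- (`|x| + 1)) x - I (- (`|x| + 1)) 0.
exists U => x.
have UE (n y : R) : `|y| + 1 <= n -> U y = I (- n) y - I (- n) 0.
  move=> yn; rewrite /U (@Isplit (- n) (- (`|y| + 1)) y); last 2 first.
  - by rewrite lerN2.
  - by rewrite lerNl (le_trans (ler_norm _))// normrN lerDl.
  rewrite (@Isplit (- n) (- (`|y| + 1)) 0); last 2 first.
  - by rewrite lerN2.
  - by rewrite oppr_le0 addr_ge0.
  by ring.
(* One unit of room beyond [|x| + 1], so that [- n] serves every [y] with [|y - x| <= 1]. *)
pose n := `|x| + 2.
have H : is_derive x (1 : R) (fun y => I (- n) y - I (- n) 0) (u x).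
  rewrite -[u x]subr0; apply: is_deriveB; apply: Id.
  by rewrite /n ltrNl (le_lt_trans (ler_norm _))// normrN ltrDl.
apply: near_eq_is_derive H; near=> y; apply/esym/UE.
rewrite /n -(subrK x y) (le_trans (lerD (ler_normD _ _) (lexx 1)))//.
suff : `|y - x| <= 1 by move: `|y - x| `|x| => ? ?; lra.
near: y; exists 1 => //= y; rewrite /= distrC => /ltW.
Unshelve. all: by end_near. Qed.


Lemma is_derive_sqr (S z : R) :
  is_derive z (1 : R) (fun z : R => S * z ^+ 2) (2 * S * z).
Proof.
apply: is_derive_eq; rewrite /GRing.scale/= mulr1; ring.
Qed.

Definition sdiff u (a x : R) : R := u (x + a) - 2 * u x + u (x - a).

Lemma is_derive_shift f df (a x : R) : (forall x, is_derive x (1 : R) f (df x)) ->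
  is_derive x (1 : R) (fun z => f (z + a)) (df (x + a)).
Proof.
move=> fd; have fxa := fd (x + a).
have sh : is_derive x (1 : R) (fun z => z + a) 1.
  by rewrite -[X in is_derive _ _ _ X](addr0 (1 : R)); exact: is_deriveD.
by have := @is_derive1_comp R f (fun z => z + a) x _ _ fxa sh; rewrite mulr1.
Qed.

Lemma is_derive_reflect f df (a x : R) :
  (forall x, is_derive x (1 : R) f (df x)) ->
  is_derive x (1 : R) (fun z => f (a - z)) (- df (a - x)).
Proof.
move=> fd; have fxa := fd (a - x).
have sh : is_derive x (1 : R) (fun z => a - z) (- 1).
  by rewrite -[X in is_derive _ _ _ X](sub0r (1 : R)); exact: is_deriveB.
by have := @is_derive1_comp R f (fun z => a - z) x _ _ fxa sh; rewrite mulrN1.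
Qed.

Lemma is_derive_sdiff f df (a x : R) :
  (forall x, is_derive x (1 : R) f (df x)) ->
  is_derive x (1 : R) (sdiff f a) (sdiff df a x).
Proof.
move=> fd; rewrite /sdiff; apply: is_deriveD.
  apply: is_deriveB; first exact: is_derive_shift.
exact: is_derive_shift.
Qed.

Lemma derive_le_le f df (a b : R) : (forall x, is_derive x (1 : R) f (df x)) ->
  a <= b -> (forall x, a <= x <= b -> df x <= 0) -> f b <= f a.
Proof.
move=> fd ab d0; have [c cab e] := MVT_le fd ab.
by rewrite -subr_le0 e mulr_le0_ge0 ?subr_ge0// d0.
Qed.

(** [f (x + z) + f (x - z) - S * z ^+ 2] is non-increasing on [[0, a]]. Only increments of [df] are
    bounded, and only from above: a supersolution offers no more. *)
Lemma sdiff_le f df (S a x : R) : (forall x, is_derive x (1 : R) f (df x)) ->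
  0 <= a ->
  (forall z, 0 <= z <= a -> df (x + z) - df (x - z) <= 2 * z * S) ->
  sdiff f a x <= a ^+ 2 * S.
Proof.
move=> fd a0 H.
have D z : is_derive z (1 : R) (fun z => f (z + x) + f (x - z) - S * z ^+ 2)
    (df (z + x) + - df (x - z) - 2 * S * z).
  apply: is_deriveB.
    by apply: is_deriveD; [exact: is_derive_shift|exact: is_derive_reflect].
  exact: is_derive_sqr.
have := derive_le_le D a0 _.
rewrite expr0n/= mulr0 subr0 add0r subr0 /sdiff [x + a]addrC => K.
suff : f (a + x) + f (x - a) - S * a ^+ 2 <= f x + f x.
  by move=> ?; lra.
by apply: K => z /H; rewrite [x + z]addrC; lra.
Qed.

Lemma derive_lipschitz f df (C : R) : (forall x, is_derive x (1 : R) f (df x)) ->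
  (forall x, `|df x| <= C) -> forall x y, `|f x - f y| <= C * `|x - y|.
Proof.
by move=> fd dC x y; have [c _ ->] := MVT_any y x fd; rewrite normrM ler_wpM2r.
Qed.

Lemma lipschitz_continuous f (C : R) :
  (forall x y, `|f x - f y| <= C * `|x - y|) -> continuous f.
Proof.
move=> fC x; apply/cvgrPdist_le => /= e e0.
have C0 : 0 <= C by have := le_trans (normr_ge0 _) (fC 1 0); rewrite subr0 normr1 mulr1.
near=> y.
rewrite (le_trans (fC _ _))//.
have : `|x - y| <= e / (C + 1).
  near: y; exists (e / (C + 1)); rewrite /= ?divr_gt0 ?ltr_wpDl// => z /ltW.
  by [].
rewrite ler_pdivlMr ?ltr_wpDl// => /(le_trans _); apply.
by rewrite mulrC ler_wpM2l// lerDl.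
Unshelve. all: by end_near. Qed.

(** Two mean value steps give the constant [C] instead of [C / 6]; only the order [|z|^3] matters
    later. *)
Lemma taylor2 (F F1 F2 : R -> R) (C : R) :
  (forall x, is_derive x (1 : R) F (F1 x)) ->
  (forall x, is_derive x (1 : R) F1 (F2 x)) ->
  (forall x y, `|F2 x - F2 y| <= C * `|x - y|) ->
  forall y z : R, `|F (y + z) - F y - F1 y * z - F2 y / 2 * z ^+ 2| <= C * `|z| ^+ 3.
Proof.
move=> d1 d2 FC y z.
have C0 : 0 <= C by have := le_trans (normr_ge0 _) (FC 1 0); rewrite subr0 normr1 mulr1.
pose G (z : R) := F (z + y) - F1 y * z - F2 y / 2 * z ^+ 2.
have DG z0 : is_derive z0 (1 : R) G (F1 (z0 + y) - F1 y - 2 * (F2 y / 2) * z0).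
  rewrite /G; apply: is_deriveB; first apply: is_deriveB.
  - exact: is_derive_shift.
  - by apply: is_derive_eq; rewrite /GRing.scale/= mulr1.
  - exact: is_derive_sqr.
have [c] := MVT_any 0 z DG; rewrite !subr0 => cz.
have -> : G z - G 0 = F (y + z) - F y - F1 y * z - F2 y / 2 * z ^+ 2.
  by rewrite /G add0r [z + y]addrC; ring.
move=> ->; have -> : 2 * (F2 y / 2) = F2 y by field.
rewrite normrM exprSr [leRHS]mulrA ler_wpM2r// expr2 [leRHS]mulrA.
have [c' ] := MVT_any y (c + y) d2; rewrite addrK => c'c ->.
rewrite -mulrBl normrM ler_pM//.
by rewrite (le_trans (FC _ _))// ler_wpM2l// (le_trans c'c).
Qed.

End calculus.

Section mollify.
Context {R : realType}.
Variables (u U1 U : R -> R) (B K : R).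
Hypothesis U1d : forall x, is_derive x (1 : R) U1 (u x).
Hypothesis Ud : forall x, is_derive x (1 : R) U (U1 x).
Hypothesis uB : forall x, `|u x| <= B.
Hypothesis uK : forall x y, `|u x - u y| <= K * `|x - y|.

Let K0 : 0 <= K.
Proof. by have := le_trans (normr_ge0 _) (uK 1 0); rewrite subr0 normr1 mulr1. Qed.

Lemma sdiff_le2 (a x S : R) : 0 <= a ->
  (forall z, `|z - x| <= a -> u z <= S) -> sdiff U a x <= a ^+ 2 * S.
Proof.
move=> a0 uS; apply: (sdiff_le Ud) => // z /andP[z0 za].
have [|c /andP[c1 c2] ->] := @MVT_le _ U1 u (x - z) (x + z) U1d.
  by rewrite lerBlDr -addrA lerDl addr_ge0.
have -> : x + z - (x - z) = 2 * z by ring.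
rewrite mulrC ler_wpM2l ?mulr_ge0// uS// ler_norml.
by apply/andP; split; lra.
Qed.

(* For [U'' = u], [moll U a] approximates [u] and its second derivative
   [moll2 u a] is a second difference quotient of [u] itself, so a one-sided
   bound on the second differences of [u] bounds it. *)
Definition moll (a x : R) : R := sdiff U a x / a ^+ 2.
Definition moll1 (a x : R) : R := sdiff U1 a x / a ^+ 2.
Definition moll2 (a x : R) : R := sdiff u a x / a ^+ 2.

Lemma moll_le (a x S : R) : 0 < a -> (forall z, `|z - x| <= a -> u z <= S) ->
  moll a x <= S.
Proof.
move=> a0 uS; rewrite /moll ler_pdivrMr ?exprn_gt0// mulrC.
by apply: sdiff_le2 => //; exact: ltW.
Qed.

End mollify.

Lemma sdiffN (R : realType) (U : R -> R) (a x : R) :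
  sdiff (fun x => - U x) a x = - sdiff U a x.
Proof. by rewrite /sdiff; ring. Qed.

Section mollify2.
Context {R : realType}.
Variables (u U1 U : R -> R) (B K : R).
Hypothesis U1d : forall x, is_derive x (1 : R) U1 (u x).
Hypothesis Ud : forall x, is_derive x (1 : R) U (U1 x).
Hypothesis uB : forall x, `|u x| <= B.
Hypothesis uK : forall x y, `|u x - u y| <= K * `|x - y|.

Let K0 : 0 <= K.
Proof. by have := le_trans (normr_ge0 _) (uK 1 0); rewrite subr0 normr1 mulr1. Qed.

Lemma moll_ge (a x S : R) : 0 < a -> (forall z, `|z - x| <= a -> S <= u z) ->
  S <= moll U a x.
Proof.
move=> a0 uS; rewrite -lerN2 /moll -mulNr -sdiffN.
apply: (@moll_le _ (fun x => - u x) (fun x => - U1 x)) => //.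
by move=> z /uS; rewrite lerN2.
Qed.

Lemma moll_close (a x : R) : 0 < a -> `|moll U a x - u x| <= K * a.
Proof.
move=> a0; rewrite ler_norml; apply/andP; split.
  rewrite lerBrDr; apply: moll_ge => // z zx.
  have := uK x z; rewrite ler_norml => /andP[_].
  have := ler_wpM2l K0 zx; rewrite distrC; lra.
rewrite lerBlDr; apply: (moll_le U1d) => // z zx.
have := uK z x; rewrite ler_norml => /andP[_].
have := ler_wpM2l K0 zx; lra.
Qed.

Lemma moll_bound (a x : R) : 0 < a -> `|moll U a x| <= B.
Proof.
move=> a0; rewrite ler_norml; apply/andP; split.
  by apply: moll_ge => // z _; have := uB z; rewrite ler_norml => /andP[].
by apply: (moll_le U1d) => // z _; have := uB z; rewrite ler_norml => /andP[].
Qed.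

Lemma is_derive_moll (a x : R) : is_derive x (1 : R) (moll U a) (moll1 U1 a x).
Proof.
rewrite /moll /moll1 [_ / _]mulrC; under eq_fun do rewrite mulrC.
by apply: is_deriveZ; exact: is_derive_sdiff.
Qed.

Lemma is_derive_moll1 (a x : R) : is_derive x (1 : R) (moll1 U1 a) (moll2 u a x).
Proof.
rewrite /moll2 /moll1 [_ / _]mulrC; under eq_fun do rewrite mulrC.
by apply: is_deriveZ; exact: is_derive_sdiff.
Qed.

Lemma moll2_bound (a x : R) : 0 < a -> `|moll2 u a x| <= 4 * B / a ^+ 2.
Proof.
move=> a0; rewrite normrM normfV (ger0_norm (exprn_ge0 _ (ltW a0))).
rewrite ler_wpM2r ?invr_ge0 ?exprn_ge0 ?(ltW a0)// ler_norml.
have := uB (x + a); have := uB x; have := uB (x - a).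
by rewrite /sdiff !ler_norml => /andP[? ?] /andP[? ?] /andP[? ?]; apply/andP; split; lra.
Qed.

Lemma moll2_lipschitz (a x y : R) : 0 < a ->
  `|moll2 u a x - moll2 u a y| <= 4 * K / a ^+ 2 * `|x - y|.
Proof.
move=> a0; rewrite -mulrBl normrM normfV (ger0_norm (exprn_ge0 _ (ltW a0))).
rewrite mulrAC ler_wpM2r ?invr_ge0 ?exprn_ge0 ?(ltW a0)// ler_norml.
have := uK (x + a) (y + a); have := uK x y; have := uK (x - a) (y - a).
have -> : x - a - (y - a) = x - y by ring.
have -> : x + a - (y + a) = x - y by ring.
by rewrite /sdiff !ler_norml => /andP[? ?] /andP[? ?] /andP[? ?]; apply/andP; split; lra.
Qed.

Lemma moll1_bound (a x : R) : 0 < a -> `|moll1 U1 a x| <= 2 * B / a.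
Proof.
move=> a0.
have U1L := derive_lipschitz U1d uB.
have -> : 2 * B / a = 2 * B * a / a ^+ 2 by field; rewrite gt_eqF.
rewrite normrM normfV (ger0_norm (exprn_ge0 _ (ltW a0))).
rewrite ler_wpM2r ?invr_ge0 ?exprn_ge0 ?(ltW a0)//.
have := U1L (x + a) x; have := U1L (x - a) x.
rewrite [x + a - x]addrAC [x - a - x]addrAC subrr !add0r normrN (gtr0_norm a0).
by rewrite /sdiff !ler_norml => /andP[? ?] /andP[? ?]; apply/andP; split; lra.
Qed.

(** [moll1 U1 a 0] is a weighted average of the symmetric slopes [(u z - u (- z)) / (2 z)] over
    [0 < z < a]. At a kink of [u] the limit is thus the mean of the two one-sided slopes. *)
Lemma moll1_cvg0 (m : R) :
  (forall e, 0 < e -> exists2 d, 0 < d & forall z, 0 < z < d ->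
     `|u z - u (- z) - 2 * m * z| <= e * z) ->
  forall e, 0 < e -> exists2 d, 0 < d & forall a, 0 < a < d ->
     `|moll1 U1 a 0 - m| <= e.
Proof.
move=> um e e0; have [d d0 H] := um e e0.
exists d => // a /andP[a0 ad].
(* The sign [s] treats the upper and the lower bound at once; [e / 2] is the coefficient that
   integrates the slack [e * z]. *)
have key (s : R) : `|s| = 1 -> s * (sdiff U1 a 0 - m * a ^+ 2) <= e * a ^+ 2.
  move=> s1.
  have := @derive_le_le R
    (fun z => s * (U1 (z + 0) + U1 (0 - z)) - (s * m + e / 2) * z ^+ 2)
    (fun z => s * (u (z + 0) - u (0 - z)) - 2 * (s * m + e / 2) * z) 0 a.
  rewrite expr0n/= mulr0 !addr0 !subr0 => /(_ _ (ltW a0)) K1.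
  have {K1}: s * (U1 a + U1 (0 - a)) - (s * m + e / 2) * a ^+ 2 <= s * (U1 0 + U1 0).
    apply: K1.
      move=> z; apply: is_deriveB.
        apply: is_deriveZ; apply: is_deriveD; first exact: is_derive_shift.
        exact: is_derive_reflect.
      exact: is_derive_sqr.
    move=> z /andP[z0 za].
    move: z0; rewrite le_eqVlt => /predU1P[<-|z0].
      by rewrite addr0 subr0 subrr !mulr0 subr0.
    have /H : 0 < z < d by rewrite z0 (le_lt_trans za).
    rewrite addr0 sub0r => H1.
    have : s * (u z - u (- z) - 2 * m * z) <= e * z.
      by rewrite (le_trans (ler_norm _))// normrM s1 mul1r.
    by move: (u z) (u (- z)) => ? ? ?; lra.
  have : 0 < e * a ^+ 2 by rewrite mulr_gt0// exprn_gt0.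
  rewrite /sdiff !add0r.
  by move: (U1 a) (U1 (- a)) (U1 0) (a ^+ 2) => ? ? ? ?; nra.
have -> : moll1 U1 a 0 - m = (sdiff U1 a 0 - m * a ^+ 2) / a ^+ 2.
  by rewrite /moll1; field; rewrite gt_eqF.
rewrite normrM normfV (ger0_norm (exprn_ge0 _ (ltW a0))).
rewrite ler_pdivrMr ?exprn_gt0// ler_norml.
have := key 1; have := key (-1); rewrite normrN normr1 => /(_ erefl) ? /(_ erefl) ?.
by apply/andP; split; lra.
Qed.

End mollify2.

(** * Occupation times *)

Section paths.
Context {R : realType}.
Implicit Types f : R -> R.
Notation mu := (@lebesgue_measure R).

(** Only [u] is confined to [[a, b]], so callers need not locate the second point. *)
Lemma heine f (a b : R) : continuous f -> forall e : R, 0 < e ->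
  exists2 d, 0 < d & forall u v, a <= u <= b -> `|u - v| <= d ->
    `|f u - f v| <= e.
Proof.
move=> fc e e0.
have /compact_near_coveringP := @segment_compact R a b.
move=> /(_ R (0^'+ : set_system R)
  (fun d u => forall v, `|u - v| <= d -> `|f u - f v| <= e) _) [].
  move=> x _; have /cvgrPdist_le/(_ (e / 2)) := fc x.
  rewrite divr_gt0// => /(_ isT)[d /= d0 H].
  exists (ball x (d / 2), [set z | z < d / 2]) => /=.
    split; first by apply: nbhsx_ballx; rewrite divr_gt0.
    by exists (d / 2); rewrite /= ?divr_gt0// => z /=; rewrite sub0r normrN => /(le_lt_trans (ler_norm _)).
  move=> [u z]/= [xu zd] v uv.
  rewrite -(subrKA (f x)) (splitr e) (le_trans (ler_normD _ _))// lerD//.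
    rewrite distrC; apply: H => /=; rewrite (lt_le_trans xu)//; lra.
  apply: H => /=; rewrite -(subrKA u) (le_lt_trans (ler_normD _ _))//.
  rewrite (splitr d) ltrD// (le_lt_trans uv)//.
move=> d /= d0 H; exists (d / 2); first by rewrite divr_gt0.
move=> u v uab uv; apply: (H (d / 2)) => //=.
- by rewrite sub0r normrN gtr0_norm ?divr_gt0//; lra.
- by rewrite divr_gt0.
Qed.

(** Cutting [[0, A]] into [n + 1] equal pieces bounds the total increase by [C A^2 / (n + 1)]. This
    replaces a derivative test for the integrated occupation time, whose difference quotients are
    merely squeezed by a monotone function. *)
Lemma quad_incr (h : R -> R) (A C : R) : 0 <= A ->
  (forall x y, 0 <= x -> x <= y -> y <= A -> h y - h x <= C * (y - x) ^+ 2) ->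
  h A <= h 0.
Proof.
move=> A0 H; rewrite leNgt; apply/negP; rewrite -subr_gt0 => h0.
have step (n : nat) : h A - h 0 <= C * A ^+ 2 / n.+1%:R.
  have n0 : (0 : R) < n.+1%:R by rewrite ltr0n.
  pose s (i : nat) : R := A * i%:R / n.+1%:R.
  have s0 i : 0 <= s i by rewrite /s divr_ge0 ?mulr_ge0 ?ler0n.
  have sA : s n.+1 = A by rewrite /s mulfK// gt_eqF.
  have sS i : s i.+1 - s i = A / n.+1%:R by rewrite /s -natr1; field; rewrite gt_eqF.
  have ind i : (i <= n.+1)%N -> h (s i) - h 0 <= i%:R * (C * (A / n.+1%:R) ^+ 2).
    elim: i => [_|i IH iN]; first by rewrite /s mulr0 mul0r subrr mul0r.
    have siA : s i.+1 <= A by rewrite /s ler_pdivrMr// ler_wpM2l// ler_nat.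
    have ss : s i <= s i.+1 by rewrite -subr_ge0 sS divr_ge0// ltW.
    have := H _ _ (s0 i) ss siA; rewrite sS -[i.+1%:R]natr1 mulrDl mul1r => H1.
    have := IH (ltnW iN) => H2.
    by rewrite -(subrKA (h (s i))) addrC lerD.
  have := ind n.+1 (leqnn _); rewrite sA.
  suff -> : n.+1%:R * (C * (A / n.+1%:R) ^+ 2) = C * A ^+ 2 / n.+1%:R by [].
  by field; rewrite gt_eqF.
have := step (Num.truncn (C * A ^+ 2 / (h A - h 0))).
rewrite leNgt => /negP; apply.
by rewrite ltr_pdivrMr ?ltr0n// [ltRHS]mulrC -ltr_pdivrMr// truncnS_gt.
Qed.

(* The second difference quotient of [|x| / 2]: the kink of a mollified
   function is seen by the path through the occupation functional [occ]. *)
Definition tri (a x : R) : R := Num.max 0 (a - `|x|) / a ^+ 2.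

Lemma tri_ge0 (a x : R) : 0 <= tri a x.
Proof. by rewrite divr_ge0 ?exprn_even_ge0// le_max lexx. Qed.

Lemma tri_le (a x : R) : 0 < a -> tri a x <= a^-1.
Proof.
move=> a0; rewrite /tri ler_pdivrMr ?exprn_gt0// expr2 mulKf ?gt_eqF//.
by rewrite ge_max (ltW a0)/= lerBlDr lerDl.
Qed.

Lemma max0_lip (p q : R) : `|Num.max 0 p - Num.max 0 q| <= `|p - q|.
Proof.
rewrite /Num.max; case: ltP => p0; case: ltP => q0;
  rewrite ?subrr ?normr0 ?subr0 ?sub0r ?normrN//.
  by rewrite gtr0_norm// (le_trans _ (ler_norm _))//; lra.
by rewrite gtr0_norm// distrC (le_trans _ (ler_norm _))//; lra.
Qed.

Lemma tri_lip (a x y : R) : 0 < a -> `|tri a x - tri a y| <= `|x - y| / a ^+ 2.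
Proof.
move=> a0; rewrite -mulrBl normrM normfV (ger0_norm (exprn_ge0 _ (ltW a0))).
rewrite ler_wpM2r ?invr_ge0 ?exprn_ge0 ?(ltW a0)//.
rewrite (le_trans (max0_lip _ _))//.
have -> : a - `|x| - (a - `|y|) = `|y| - `|x| by ring.
by rewrite distrC ler_dist_dist.
Qed.

Lemma continuous_tri (a : R) : 0 < a -> continuous (tri a).
Proof.
by move=> a0; apply: lipschitz_continuous => x y; rewrite mulrC; exact: tri_lip.
Qed.


Section occupation.
Variables (f : R -> R) (t : R).
Hypotheses (fc : continuous f) (t0 : 0 <= t).

Let capS (e : R) : set R := [set s | 0 <= s <= t /\ `|f s| < e].
(** By the layer-cake formula, the integral of [mu (capS z)] over [z] in [[0, e]]; and
    [occ a = Phi a / a ^+ 2]. *)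
Let Phi (e : R) : R := \int[mu]_(s in `[0, t]) Num.max 0 (e - `|f s|).

Let fin_mu : (mu `[0%R, t] < +oo)%E.
Proof. by rewrite /= lebesgue_measure_itv/=; case: ifP => _; rewrite ?ltry. Qed.

Let m_abs : measurable_fun setT (fun s => `|f s|).
Proof. by apply: measurableT_comp => //; exact: continuous_measurable_fun. Qed.

Lemma measurable_occupation e : measurable (capS e).
Proof.
rewrite (_ : capS e = `[0, t]%classic `&` ((fun s => `|f s|) @^-1` `]-oo, e[)).
  by apply: measurableI => //; rewrite -[X in measurable X]setTI; exact: m_abs.
by apply/seteqP; split => s /=; rewrite !in_itv.
Qed.

Let int_Phi (e : R) : mu.-integrable `[0, t] (EFin \o (fun s => Num.max 0 (e - `|f s|))).
Proof.
apply: measurable_bounded_integrable => //.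
  apply: measurable_funS (@subsetT _ _) _ => //.
  by apply: measurable_maxr => //; exact: measurable_funB.
exists `|e|; split => // M eM s /= _; rewrite ger0_norm ?le_max ?lexx//.
rewrite ge_max (le_trans _ (ltW eM))//= (le_trans _ (ltW eM))//.
by rewrite (le_trans _ (ler_norm _))// lerBlDr lerDl.
Qed.

Let int_indic (c e : R) :
  mu.-integrable `[0, t] (EFin \o (fun s => c * \1_(capS e) s)).
Proof.
apply: measurable_bounded_integrable => //.
  by apply: measurable_funM => //; apply: measurable_indic; exact: measurable_occupation.
exists `|c|; split => // M eM s /= _; rewrite normrM (le_trans _ (ltW eM))//.
by rewrite ler_piMr// indicE; case: (_ \in _); rewrite ?normr0 ?normr1.
Qed.

Let Rint_indic (c e : R) :
  \int[mu]_(s in `[0, t]) (c * \1_(capS e) s) = c * fine (mu (capS e)).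
Proof.
rewrite RintegralZl//; last first.
  rewrite (_ : EFin \o _ = EFin \o (fun s => 1 * \1_(capS e) s)).
    exact: int_indic.
  by apply/funext => s /=; rewrite mul1r.
congr (_ * _); rewrite /Rintegral integral_indic//; last exact: measurable_occupation.
by rewrite setIidl// => s [st _] /=; rewrite in_itv.
Qed.

Lemma occupation_bounds (x y : R) : 0 <= x -> x <= y ->
  (y - x) * fine (mu (capS x)) <= Phi y - Phi x <= (y - x) * fine (mu (capS y)).
Proof.
move=> x0 xy; rewrite /Phi -RintegralB// -!Rint_indic.
have iB : mu.-integrable `[0, t] (EFin \o
    (fun s => Num.max 0 (y - `|f s|) - Num.max 0 (x - `|f s|))).
  exact: (integrableB _ (int_Phi y) (int_Phi x)).
apply/andP; split; apply: le_Rintegral => // s /= st; rewrite indicE.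
  case: (boolP (s \in _)) => [/set_mem[_ fx]|_]; rewrite ?mulr0 ?mulr1.
    rewrite /Num.max; case: ltP => ?; case: ltP => ?; lra.
  rewrite /Num.max; case: ltP => ?; case: ltP => ?; lra.
case: (boolP (s \in _)) => [/set_mem[_ fx]|]; rewrite ?mulr0 ?mulr1.
  rewrite /Num.max; case: ltP => ?; case: ltP => ?; lra.
rewrite notin_setE /capS/= => fx.
have : y <= `|f s|.
  by rewrite leNgt; apply/negP => fy; apply: fx; split.
rewrite /Num.max; case: ltP => ?; case: ltP => ?; lra.
Qed.

Definition occ (a : R) : R := \int[mu]_(s in `[0, t]) tri a (f s).

(** [mu (capS e)] is about [2 e l] for small [e], and integrating it up to [a] makes [Phi a] about
    [l a^2]. *)
Lemma occ_cvg (l : R) : (2 * e)^-1 * fine (mu (capS e)) @[e --> 0^'+] --> l ->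
  forall eta : R, 0 < eta -> exists2 d, 0 < d & forall a, 0 < a < d ->
    `|occ a - l| <= eta.
Proof.
move=> /cvgrPdist_le fl eta eta0.
have [d /= d0 H] := fl _ eta0; exists d => // a /andP[a0 ad].
have K (e : R) : 0 < e -> e <= a -> `|l - (2 * e)^-1 * fine (mu (capS e))| <= eta.
  move=> e0 ea; apply: H => //=.
  by rewrite sub0r normrN gtr0_norm// (le_lt_trans ea).
have m0 e : 0 <= fine (mu (capS e)) by rewrite fine_ge0.
have K1 (e : R) : 0 < e -> e <= a -> fine (mu (capS e)) <= 2 * e * (l + eta).
  move=> e0 ea; have := K e e0 ea; rewrite ler_norml => /andP[].
  rewrite lerBrDr -lerBrDl opprK => + _.
  by rewrite mulrC ler_pdivrMr ?mulr_gt0// [_ * (2 * e)]mulrC addrC.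
have K2 (e : R) : 0 < e -> e <= a -> 2 * e * (l - eta) <= fine (mu (capS e)).
  move=> e0 ea; have := K e e0 ea; rewrite ler_norml => /andP[_].
  rewrite lerBlDr addrC -lerBlDr.
  by rewrite mulrC ler_pdivlMr ?mulr_gt0// [_ * (2 * e)]mulrC.
have Phi0 : Phi 0 = 0.
  rewrite /Phi /Rintegral integral0_eq// => s _; congr EFin.
  by rewrite sub0r; apply/max_idPl; rewrite oppr_le0.
have occE : occ a = Phi a / a ^+ 2.
  by rewrite /occ /Phi -RintegralZr//; exact: int_Phi.
(* Since [2 y (y - x) - (y^2 - x^2) = (y - x)^2], the increments of [Phi e - (l + eta) e^2] are
   quadratically small. *)
have up : Phi a <= (l + eta) * a ^+ 2.
  have := @quad_incr (fun e => Phi e - (l + eta) * e ^+ 2) a (l + eta) (ltW a0).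
  rewrite Phi0 expr0n/= mulr0 subrr subr_le0; apply.
  move=> x y x0 xy ya; have /andP[_] := occupation_bounds x0 xy.
  have := le_trans x0 xy; rewrite le_eqVlt => /predU1P[y0|y0].
    have -> : x = y by apply/eqP; rewrite eq_le xy -y0 x0.
    by rewrite !subrr expr0n mulr0.
  have : (y - x) * fine (mu (capS y)) <= (y - x) * (2 * y * (l + eta)).
    by rewrite ler_wpM2l ?subr_ge0// K1.
  by move: (Phi x) (Phi y) (fine _) => *; lra.
have lo : (l - eta) * a ^+ 2 <= Phi a.
  have := @quad_incr (fun e => (l - eta) * e ^+ 2 - Phi e) a (l - eta) (ltW a0).
  rewrite Phi0 expr0n/= mulr0 subrr subr_le0; apply.
  move=> x y x0 xy ya; have /andP[+ _] := occupation_bounds x0 xy.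
  have : (y - x) * (2 * x * (l - eta)) <= (y - x) * fine (mu (capS x)).
    rewrite ler_wpM2l ?subr_ge0//.
    move: x0; rewrite le_eqVlt => /predU1P[<-|x0]; first by rewrite mulr0 mul0r.
    by rewrite K2// (le_trans xy).
  by move: (Phi x) (Phi y) (fine _) => *; lra.
rewrite occE ler_norml; apply/andP; split.
  by rewrite lerBrDr ler_pdivlMr ?exprn_gt0// addrC.
by rewrite lerBlDr ler_pdivrMr ?exprn_gt0// addrC.
Qed.

End occupation.

Lemma occE f (a : R) : continuous f -> 0 < a ->
  exists2 Q : R -> R, (forall x, is_derive x (1 : R) Q (tri a (f x))) &
    forall t, 0 <= t -> occ f t a = Q t - Q 0.
Proof.
move=> fc a0.
have tc : continuous (fun x => tri a (f x)).
  by move=> x; apply: continuous_comp; [exact: fc|exact: continuous_tri].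
have [Q Qd] := antiderivative tc; exists Q => // t.
rewrite le_eqVlt => /predU1P[<-|t0].
  by rewrite /occ set_itv1 Rintegral_set1 subrr.
have Oc x : Q z @[z --> x] --> Q x.
  apply: differentiable_continuous; apply/derivable1_diffP.
  exact: (@ex_derive _ _ _ _ _ _ _ (Qd x)).
rewrite /occ /Rintegral (@continuous_FTC2 _ _ Q)//.
- exact: continuous_subspaceT.
- split; first by move=> x _; exact: (@ex_derive _ _ _ _ _ _ _ (Qd x)).
    exact/cvg_at_right_filter/Oc.
  exact/cvg_at_left_filter/Oc.
- by move=> x _; rewrite derive1E; exact: (@derive_val _ _ _ _ _ _ _ (Qd x)).
Qed.

Lemma occ0 f (a : R) : occ f 0 a = 0.
Proof. by rewrite /occ set_itv1 Rintegral_set1. Qed.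

Lemma occ_incr f (a s t w : R) : continuous f -> 0 < a -> 0 <= s -> s <= t ->
  (forall u, s <= u <= t -> `|f u - f s| <= w) ->
  `|occ f t a - occ f s a - (t - s) * tri a (f s)| <= (t - s) * w / a ^+ 2.
Proof.
move=> fc a0 s0 st H; have [Q Qd QE] := occE fc a0.
rewrite !QE ?(le_trans s0)//.
have [c cst e] := MVT_le Qd st.
have -> : Q t - Q 0 - (Q s - Q 0) - (t - s) * tri a (f s) =
    (t - s) * (tri a (f c) - tri a (f s)) by lra.
rewrite normrM ger0_norm ?subr_ge0// -mulrA ler_wpM2l ?subr_ge0//.
rewrite (le_trans (tri_lip _ _ a0))// ler_wpM2r ?invr_ge0 ?exprn_ge0 ?(ltW a0)//.
exact: H.
Qed.

Lemma occ_le f (a s t : R) : continuous f -> 0 < a -> 0 <= s -> s <= t ->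
  occ f s a <= occ f t a <= occ f s a + (t - s) / a.
Proof.
move=> fc a0 s0 st; have [Q Qd QE] := occE fc a0.
rewrite !QE ?(le_trans s0)//; have [c cst e] := MVT_le Qd st.
have -> : Q t - Q 0 = Q s - Q 0 + (Q t - Q s) by ring.
rewrite e lerDl lerD2l mulr_ge0 ?tri_ge0 ?subr_ge0//=.
by rewrite mulrC ler_wpM2l ?subr_ge0// tri_le.
Qed.

Definition grid (t : R) (n k : nat) : R := t * k%:R / n.+1%:R.

Lemma grid_ge0 (t : R) n k : 0 <= t -> 0 <= grid t n k.
Proof. by move=> t0; rewrite /grid !mulr_ge0. Qed.

Lemma gridS (t : R) n k : grid t n k.+1 = grid t n k + t / n.+1%:R.
Proof. by rewrite /grid -natr1 mulrDr mulr1 mulrDl. Qed.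

Lemma grid0 (t : R) n : grid t n 0 = 0.
Proof. by rewrite /grid mulr0 mul0r. Qed.

Lemma gridn (t : R) n : grid t n n.+1 = t.
Proof. by rewrite /grid mulfK// gt_eqF ?ltr0n. Qed.

Lemma grid_le (t : R) n k l : 0 <= t -> (k <= l)%N -> grid t n k <= grid t n l.
Proof.
by move=> t0 kl; rewrite /grid ler_wpM2r ?invr_ge0// ler_wpM2l// ler_nat.
Qed.

Lemma grid_step_cvg (t : R) : t / n.+1%:R @[n --> \oo] --> (0 : R).
Proof.
rewrite -(mulr0 t); apply: cvgM; first exact: cvg_cst.
exact: cvg_harmonic.
Qed.

Lemma grid_small (t e : R) : 0 < e -> \forall n \near \oo, `|t / n.+1%:R| <= e.
Proof. by move=> e0; have /cvgr0_norm_le := grid_step_cvg t; apply. Qed.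

(** The sums look at [f] at finitely many times only; this is how [occ] is later seen to be
    adapted. *)
Lemma occ_riemann f (a t : R) : continuous f -> 0 < a -> 0 <= t ->
  \sum_(k < n.+1) t / n.+1%:R * tri a (f (grid t n k)) @[n --> \oo] --> occ f t a.
Proof.
move=> fc a0 t0; apply/cvgrPdist_le => /= e e0.
have e1 : 0 < e * a ^+ 2 / (t + 1).
  by rewrite divr_gt0 ?mulr_gt0 ?exprn_gt0// ltr_wpDl.
have [d d0 H] := @heine f 0 t fc _ e1.
have dn := @grid_small t d d0.
near=> n.
have tn : t / n.+1%:R <= d by rewrite (le_trans (ler_norm _))//; near: n.
have t1 : 0 <= t / n.+1%:R by rewrite divr_ge0.
have key (m : nat) : (m <= n.+1)%N ->
  `|occ f (grid t n m) a - \sum_(k < m) t / n.+1%:R * tri a (f (grid t n k))|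
   <= m%:R * (t / n.+1%:R * (e * a ^+ 2 / (t + 1)) / a ^+ 2).
  elim: m => [_|m IH mn]; first by rewrite big_ord0 grid0 occ0 subrr normr0 mul0r.
  have g0 := @grid_ge0 t n m t0.
  have gS : grid t n m <= grid t n m.+1 by exact: grid_le.
  have sE : grid t n m.+1 - grid t n m = t / n.+1%:R by rewrite gridS addrC addKr.
  have osc u : grid t n m <= u <= grid t n m.+1 ->
      `|f u - f (grid t n m)| <= e * a ^+ 2 / (t + 1).
    move=> /andP[u1 u2]; rewrite distrC; apply: H.
      by rewrite g0/= -[leRHS](gridn t n); exact/grid_le/ltnW.
    by rewrite distrC ger0_norm ?subr_ge0// lerBlDl (le_trans u2)// gridS lerD2l.
  have := occ_incr fc a0 g0 gS osc; rewrite sE => H1.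
  rewrite big_ord_recr/= -[m.+1%:R]natr1 mulrDl mul1r.
  have -> : occ f (grid t n m.+1) a -
     (\sum_(i < m) t / n.+1%:R * tri a (f (grid t n i))
     + t / n.+1%:R * tri a (f (grid t n m))) =
    (occ f (grid t n m) a - \sum_(i < m) t / n.+1%:R * tri a (f (grid t n i))) +
    (occ f (grid t n m.+1) a - occ f (grid t n m) a -
      t / n.+1%:R * tri a (f (grid t n m))) by ring.
  by rewrite (le_trans (ler_normD _ _))// lerD// IH// ltnW.
have := key n.+1 (leqnn _); rewrite gridn => /le_trans; apply.
have -> : n.+1%:R * (t / n.+1%:R * (e * a ^+ 2 / (t + 1)) / a ^+ 2) = e * (t / (t + 1)).
  field; rewrite gt_eqF ?ltr_wpDl//= gt_eqF// gt_eqF//.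
by rewrite ler_piMr ?(ltW e0)// ler_pdivrMr ?ltr_wpDl// mul1r lerDl.
Unshelve. all: by end_near. Qed.

(** Monotonicity is in time, not in [j]. On a grid along which [L] varies by at most [eta / 2] per
    cell, closeness at the finitely many nodes extends to all points by squeezing. *)
Lemma dini (L : R -> R) (K : nat -> R -> R) (t : R) : 0 <= t ->
  continuous L ->
  (forall u v, 0 <= u -> u <= v -> v <= t -> L u <= L v) ->
  (forall j u v, 0 <= u -> u <= v -> v <= t -> K j u <= K j v) ->
  (forall u, 0 <= u <= t -> K j u @[j --> \oo] --> L u) ->
  forall eta : R, 0 < eta -> \forall j \near \oo, forall u, 0 <= u <= t ->
    `|K j u - L u| <= eta.
Proof.
move=> t0 Lc Lm Km KL eta eta0.
have e2 : 0 < eta / 2 by rewrite divr_gt0.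
have [d d0 H] := @heine L 0 t Lc _ e2.
have [n _ dn] := @grid_small t d d0.
have tn : t / n.+1%:R <= d by rewrite (le_trans (ler_norm _))//; exact: (dn n (leqnn n)).
have t1 : 0 <= t / n.+1%:R by rewrite divr_ge0.
have g01 k : (k <= n.+1)%N -> 0 <= grid t n k <= t.
  by move=> kn; rewrite grid_ge0//= -[leRHS](gridn t n) grid_le.
have A : \forall j \near \oo, forall k : 'I_n.+2,
    `|K j (grid t n k) - L (grid t n k)| <= eta / 2.
  apply: filter_forall => k.
  have /cvgrPdist_le/(_ _ e2) := KL (grid t n k) (g01 k (ltn_ord k)).
  by apply: filterS => j; rewrite distrC.
apply: filterS A => j A u /andP[u0 ut].
have [k [kn ku uk]] : exists k, [/\ (k <= n)%N, grid t n k <= u & u <= grid t n k.+1].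
  pose P k := u <= grid t n k.+1.
  have Pn : exists k, P k by exists n; rewrite /P gridn.
  case: (ex_minnP Pn) => k Pk kmin; exists k; split=> //.
    by apply: kmin; rewrite /P gridn.
  case: k Pk kmin => [|k] Pk kmin; first by rewrite grid0.
  by rewrite leNgt; apply/negP => /ltW /kmin; rewrite ltnn.
have /andP[k0 kt] := g01 k (leqW kn).
have /andP[k10 k1t] := g01 k.+1 kn.
have Ak := A (Ordinal (leqW kn : (k < n.+2)%N)).
have Ak1 := A (Ordinal (kn : (k.+1 < n.+2)%N)).
have : `|L (grid t n k) - L (grid t n k.+1)| <= eta / 2.
  apply: H; first by rewrite k0.
  by rewrite distrC gridS [grid _ _ _ + _]addrC addrK ger0_norm.
move: Ak Ak1 => /=; rewrite !ler_norml.
have := Lm _ _ k0 ku ut; have := Lm _ _ u0 uk k1t.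
have := Km j _ _ k0 ku ut; have := Km j _ _ u0 uk k1t.
by move=> ? ? ? ? /andP[? ?] /andP[? ?] /andP[? ?]; apply/andP; split; lra.
Qed.

End paths.

(** * Gaussian increments *)

Section normal_integral.
Context {R : realType} (m s : R).
Notation mu := (@lebesgue_measure R).
Local Open Scope ereal_scope.
Import HBNNSimple.

Let integral_normal_nnsfun (f : {nnsfun _ >-> R}) :
  \int[normal_prob m s]_x (f x)%:E = \int[mu]_x ((f x)%:E * (normal_pdf m s x)%:E).
Proof.
have mpdf : measurable_fun setT (fun x => (normal_pdf m s x)%:E).
  by apply/measurable_EFinP; exact: measurable_normal_pdf.
have pdf0 x : 0 <= (normal_pdf m s x)%:E by rewrite lee_fin normal_pdf_ge0.
rewrite integralT_nnsfun sintegralE.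
under [RHS]eq_integral.
  move=> x xD; rewrite fimfunE -fsumEFin// ge0_mule_fsuml; last first.
    by move=> r; rewrite EFinM nnfun_muleindic_ge0.
  over.
rewrite [RHS]ge0_integral_fsum//; last 2 first.
  - move=> r; apply: emeasurable_funM => //.
    by apply/measurable_EFinP; do 2 apply/measurableT_comp => //.
  - by move=> n x _; rewrite EFinM mule_ge0// nnfun_muleindic_ge0.
apply: eq_fsbigr => r /[!inE] -[x _ <-].
have fr0 : 0 <= (f x)%:E by rewrite lee_fin.
have mf : measurable (f @^-1` [set f x]) by exact: measurable_sfunP.
under eq_integral do rewrite EFinM -muleA.
rewrite ge0_integralZl//; last 2 first.
- apply: emeasurable_funM => //; apply/measurable_EFinP; exact: measurable_indic.
- by move=> y _; rewrite mule_ge0// lee_fin.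
congr (_ * _); rewrite /normal_prob [LHS]integral_mkcond.
apply: eq_integral => y _; rewrite epatch_indic; rewrite muleC//.
Qed.

(** Monotone approximation by simple functions reduces this to indicators, where it is the
    definition of [normal_prob]. *)
Lemma ge0_integral_normal (f : _ -> \bar R) :
  measurable_fun setT f -> (forall x, 0 <= f x) ->
  \int[normal_prob m s]_x f x = \int[mu]_x (f x * (normal_pdf m s x)%:E).
Proof.
move=> mf f0.
have mpdf : measurable_fun setT (fun x => (normal_pdf m s x)%:E).
  by apply/measurable_EFinP; exact: measurable_normal_pdf.
have pdf0 x : 0 <= (normal_pdf m s x)%:E by rewrite lee_fin normal_pdf_ge0.
pose f_ := nnsfun_approx measurableT mf.
have fE x : EFin \o f_ ^~ x @ \oo --> f x.
  by apply: cvg_nnsfun_approx.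
transitivity (lim (\int[normal_prob m s]_x (f_ n x)%:E @[n --> \oo])).
  rewrite -monotone_convergence//=.
  - by apply: eq_integral => x _; apply/esym/cvg_lim => //; exact: fE.
  - by move=> n; exact/measurable_EFinP/measurable_funTS.
  - by move=> n ? _; rewrite lee_fin.
  - by move=> ? _ ? ? mn; rewrite lee_fin; exact/lefP/nd_nnsfun_approx.
transitivity (lim (\int[mu]_x ((f_ n x)%:E * (normal_pdf m s x)%:E) @[n --> \oo])).
  by apply: congr_lim; apply/funext => n; exact: integral_normal_nnsfun.
rewrite -monotone_convergence//=.
- apply: eq_integral => x _; apply: cvg_lim => //.
  under eq_fun do rewrite muleC; rewrite muleC.
  by apply: cvgeZl => //; exact: fE.
- by move=> n; apply: emeasurable_funM => //; exact/measurable_EFinP/measurable_funTS.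
- by move=> n ? _; rewrite mule_ge0// lee_fin.
- move=> ? _ ? ? mn; rewrite lee_wpmul2r// lee_fin; exact/lefP/nd_nnsfun_approx.
Qed.

End normal_integral.

Section expR_bounds.
Context {R : realType}.

Let d0 (z : R) : is_derive z (1 : R) (fun z : R => expR z - 1) (expR z).
Proof.
by rewrite -[X in is_derive _ _ _ X]subr0; exact: (is_deriveB (is_derive_expR z)).
Qed.

Let d1 (z : R) : is_derive z (1 : R) (fun z : R => expR z - 1 - z) (expR z - 1).
Proof. exact: (is_deriveB (d0 z)). Qed.

Let d2 (z : R) :
  is_derive z (1 : R) (fun z : R => expR z - 1 - z - 2^-1 * z ^+ 2) (expR z - 1 - z).
Proof.
have := is_derive_sqr (2^-1) z; rewrite divff// mul1r.
exact: (is_deriveB (d1 z)).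
Qed.

Lemma expR_taylor2 (x : R) : `|expR x - 1 - x| <= `|x| ^+ 2 * expR `|x|.
Proof.
have [c2] := MVT_any 0 x d1.
rewrite expR0 !subr0 subrr subr0 => c2x ->.
have [c3] := MVT_any 0 c2 (@is_derive_expR R).
rewrite expR0 !subr0 => c3x ->.
rewrite !normrM -mulrA [leRHS]mulrC ler_pM ?mulr_ge0//.
  by rewrite ger0_norm ?expR_ge0// ler_expR (le_trans (ler_norm _))// (le_trans c3x).
by rewrite expr2 ler_wpM2r.
Qed.

Lemma expR_taylor3 (x : R) : `|expR x - 1 - x - x ^+ 2 / 2| <= `|x| ^+ 3 * expR `|x|.
Proof.
have [c1] := MVT_any 0 x d2.
rewrite expR0 expr0n/= !subr0 mulr0 subr0 subrr subr0 => c1x.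
rewrite [_^-1 * _]mulrC => ->.
rewrite normrM exprSr mulrAC ler_wpM2r// (le_trans (expR_taylor2 _))//.
by rewrite ler_pM ?exprn_ge0 ?expR_ge0// ?ler_expR// lerXn2r ?nnegrE.
Qed.

Lemma expR_abs_le (x : R) : expR `|x| <= expR x + expR (- x).
Proof.
have [x0|x0] := leP 0 x.
  by rewrite ger0_norm// lerDl expR_ge0.
by rewrite ltr0_norm// lerDr expR_ge0.
Qed.

Lemma abs_cube_le (x : R) : `|x| ^+ 3 <= 6 * (expR x + expR (- x)).
Proof.
have := expR_ge1Dxn 2 (normr_ge0 x); have := expR_abs_le x.
rewrite (_ : 3`! = 6%N)// -ler_pdivrMl//; move: (`|x| ^+ 3) => *; lra.
Qed.

Lemma abs_sqr_le (x : R) : x ^+ 2 <= 2 * (expR x + expR (- x)).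
Proof.
have := expR_ge1Dxn 1 (normr_ge0 x); have := expR_abs_le x.
rewrite real_normK ?num_real// (_ : 2`! = 2%N)//; move: (x ^+ 2) => *; lra.
Qed.

Lemma abs_le_exp (x : R) : `|x| <= expR x + expR (- x).
Proof. by have := expR_ge1Dx `|x|; have := expR_abs_le x => *; lra. Qed.

(** Extracts a coefficient from an expansion whose remainder is one order higher in [a]. *)
Lemma eq0_small (x C : R) : (forall a, 0 < a -> a <= 1 -> `|x| <= a * C) -> x = 0.
Proof.
move=> H; apply/eqP; rewrite -normr_eq0 eq_le normr_ge0 andbT leNgt.
apply/negP => x0.
have C0 : 0 < C by have := H 1 ltr01 (lexx _); rewrite mul1r; apply: lt_le_trans.
pose a := Num.min 1 (`|x| / (2 * C)).
have a0 : 0 < a by rewrite lt_min ltr01/= divr_gt0// mulr_gt0.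
have a1 : a <= 1 by rewrite ge_min lexx.
have := H a a0 a1; apply/negP; rewrite -ltNge.
have : a <= `|x| / (2 * C) by rewrite ge_min lexx orbT.
rewrite ler_pdivlMr ?mulr_gt0//; move: x0; move: (`|x|) => *; nra.
Qed.

End expR_bounds.

(** * Moments of the centred normal law *)

Section moments.
Context {R : realType} (s : R).
Hypothesis s0 : 0 < s.
Notation N := (normal_prob 0 s).

(** Completing the square: the tilt by [exp(a z)] moves the mean to [a s^2]. *)
Lemma normal_mgf (a : R) :
  (\int[N]_z (expR (a * z))%:E = (expR (a ^+ 2 * s ^+ 2 / 2))%:E)%E.
Proof.
have s1 : s != 0 by rewrite gt_eqF.
have mexp : measurable_fun [set: R] (fun z => expR (a * z)).
  by apply: measurableT_comp => //; exact: measurable_funM.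
rewrite ge0_integral_normal//; last exact/measurable_EFinP.
transitivity (\int[lebesgue_measure]_x ((expR (a ^+ 2 * s ^+ 2 / 2))%:E *
    (normal_pdf (a * s ^+ 2) s x)%:E))%E.
  apply: eq_integral => z _; rewrite -!EFinM !normal_pdfE//; congr EFin.
  rewrite mulrCA [RHS]mulrCA; congr (_ * _).
  rewrite /normal_fun -!expRD; congr expR.
  rewrite -[_ *+ 2]mulr_natr; field; exact: s1.
rewrite ge0_integralZl//; first by rewrite integral_normal_pdf mule1.
- by apply/measurable_EFinP; exact: measurable_normal_pdf.
- by move=> x _; rewrite lee_fin normal_pdf_ge0.
Qed.


Let mexp (a : R) : measurable_fun [set: R] (fun z => expR (a * z)).
Proof. by apply: measurableT_comp => //; exact: measurable_funM. Qed.

Lemma normal_expR_integrable (a : R) : N.-integrable setT (EFin \o (fun z => expR (a * z))).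
Proof.
apply/integrableP; split; first by apply/measurable_EFinP; exact: mexp.
under eq_integral do rewrite /= ger0_norm ?expR_ge0//.
by rewrite normal_mgf ltry.
Qed.

Lemma normal_dominated_integrable (f : R -> R) (C b : R) : measurable_fun setT f ->
  (forall z, `|f z| <= C * (expR (b * z) + expR (- (b * z)))) ->
  N.-integrable setT (EFin \o f).
Proof.
move=> mf fC; have I : N.-integrable setT
    (EFin \o (fun z => C * (expR (b * z) + expR (- b * z)))).
  have := integrableZl measurableT C (integrableD measurableT
    (normal_expR_integrable b) (normal_expR_integrable (- b))).
  by [].
apply: le_integrable I => //; first by apply/measurable_EFinP; exact: mf.
move=> z _; rewrite /= lee_fin (le_trans (fC z))// mulNr ler_norm//.
Qed.

Lemma normal_Rexp (a : R) : \int[N]_z expR (a * z) = expR (a ^+ 2 * s ^+ 2 / 2).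
Proof. by rewrite /Rintegral normal_mgf. Qed.

Let iX1 : N.-integrable setT (EFin \o (fun z : R => z)).
Proof.
apply: (@normal_dominated_integrable _ 1 1) => // z; rewrite !mul1r.
exact: abs_le_exp.
Qed.

Let iX2 : N.-integrable setT (EFin \o (fun z : R => z ^+ 2)).
Proof.
apply: (@normal_dominated_integrable _ 2 1) => [|z].
  exact: measurable_funX.
by rewrite !mul1r ger0_norm ?sqr_ge0// abs_sqr_le.
Qed.

Lemma normal_cube_integrable : N.-integrable setT (EFin \o (fun z : R => `|z| ^+ 3)).
Proof.
apply: (@normal_dominated_integrable _ 6 1) => [|z].
  by apply: measurable_funX; exact: normr_measurable.
by rewrite !mul1r ger0_norm ?exprn_ge0// abs_cube_le.
Qed.

Let icube : N.-integrable setT (EFin \o (fun z : R => `|z| ^+ 3 * expR `|z|)).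
Proof.
apply: (@normal_dominated_integrable _ 12 2) => [|z].
  apply: measurable_funM.
    by apply: measurable_funX; exact: normr_measurable.
  by apply: measurableT_comp => //; exact: normr_measurable.
rewrite ger0_norm ?mulr_ge0 ?exprn_ge0 ?expR_ge0//.
have := abs_cube_le z; have := expR_abs_le z.
have : 0 <= `|z| ^+ 3 by rewrite exprn_ge0.
have -> : 2 * z = z + z by ring.
rewrite opprD !expRD expRN; move: (`|z| ^+ 3) (expR `|z|) (expR_gt0 `|z|) => p q q0 p0 q1 p1.
have e0 := expR_gt0 z.
have : p * q <= 6 * (expR z + (expR z)^-1) * (expR z + (expR z)^-1).
  by apply: ler_pM => //; exact: ltW.
move=> /le_trans; apply.
by have := sqr_ge0 (expR z - (expR z)^-1); move: (expR z) (expR z)^-1 => u v; lra.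
Qed.

Let C := \int[N]_z (`|z| ^+ 3 * expR `|z|).

Let C0 : 0 <= C.
Proof.
by apply: Rintegral_ge0 => z _; rewrite mulr_ge0 ?exprn_ge0 ?expR_ge0.
Qed.

(** The exact moment generating function is compared with the integrated expansion of [exp(a z)];
    the first two moments are then read off as coefficients in [a]. *)
Let taylor_exp (a : R) : `|a| <= 1 ->
  `|expR (a ^+ 2 * s ^+ 2 / 2) - 1 - a * (\int[N]_z z) - a ^+ 2 / 2 * (\int[N]_z (z ^+ 2))|
  <= `|a| ^+ 3 * C.
Proof.
move=> a1; rewrite -normal_Rexp.
have i1 : N.-integrable setT (EFin \o (fun=> 1 : R)).
  by apply: (@normal_dominated_integrable _ 1 0) => // z; rewrite mul1r mul0r oppr0 expR0 normr1 lerDl.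
have ia : N.-integrable setT (EFin \o (fun z : R => a * z)).
  exact: (integrableZl measurableT a iX1).
have ia2 : N.-integrable setT (EFin \o (fun z : R => a ^+ 2 / 2 * z ^+ 2)).
  exact: (integrableZl measurableT (a ^+ 2 / 2) iX2).
have ie := normal_expR_integrable a.
have ie1 : N.-integrable setT (EFin \o (fun z : R => expR (a * z) - 1)).
  exact: (integrableB measurableT ie i1).
have ie2 : N.-integrable setT (EFin \o (fun z : R => expR (a * z) - 1 - a * z)).
  exact: (integrableB measurableT ie1 ia).
have ie3 : N.-integrable setT (EFin \o (fun z : R => expR (a * z) - 1 - a * z - a ^+ 2 / 2 * z ^+ 2)).
  exact: (integrableB measurableT ie2 ia2).
have -> : \int[N]_z expR (a * z) - 1 - a * \int[N]_z z - a ^+ 2 / 2 * \int[N]_z (z ^+ 2)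
    = \int[N]_z (expR (a * z) - 1 - a * z - a ^+ 2 / 2 * z ^+ 2).
  rewrite !RintegralB// (RintegralZl _ _ iX1)// (RintegralZl _ _ iX2)//.
  by rewrite Rintegral_cst//= probability_setT mulr1.
rewrite (le_trans (le_normr_Rintegral _ _))//.
rewrite /C -RintegralZl//; apply: le_Rintegral => //.
- exact: integrable_norm.
- exact: (integrableZl measurableT (`|a| ^+ 3) icube).
move=> z _; have := expR_taylor3 (a * z).
rewrite exprMn [a ^+ 2 * z ^+ 2 / 2]mulrAC => /le_trans; apply.
rewrite normrM exprMn -mulrA !ler_wpM2l ?exprn_ge0// ler_expR.
by rewrite ler_piMl.
Qed.

Lemma normal_mean : \int[N]_z z = 0.
Proof.
apply: (@eq0_small _ _ C) => a a0 a1.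
have na : `|a| <= 1 by rewrite gtr0_norm.
have nNa : `|- a| <= 1 by rewrite normrN.
have HA := taylor_exp na; have HB := taylor_exp nNa.
rewrite normrN sqrrN in HB; rewrite (gtr0_norm a0) ler_norml in HA.
rewrite (gtr0_norm a0) ler_norml in HB.
set M := \int[N]_z z in HA HB *.
(* The part of the expansion odd in [a] isolates the mean. *)
have aM : `|a * M| <= a ^+ 3 * C.
  by rewrite ler_norml; move: HA HB => /andP[? ?] /andP[? ?]; apply/andP; split; lra.
have {aM} : `|M| <= a ^+ 2 * C.
  by move: aM; rewrite normrM gtr0_norm// exprS -mulrA ler_pM2l.
move=> /le_trans; apply; rewrite ler_wpM2r// ?C0// expr2 ler_piMr// ltW//.
Qed.

Lemma normal_variance : \int[N]_z (z ^+ 2) = s ^+ 2.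
Proof.
apply/eqP; rewrite eq_sym -subr_eq0; apply/eqP.
apply: (@eq0_small _ _ (2 * (C + s ^+ 4 * expR (s ^+ 2)))) => a a0 a1.
have na : `|a| <= 1 by rewrite gtr0_norm.
have := taylor_exp na; rewrite normal_mean mulr0 subr0 (gtr0_norm a0).
have := expR_taylor2 (a ^+ 2 * s ^+ 2 / 2).
set y := a ^+ 2 * s ^+ 2 / 2; set V := \int[N]_z z ^+ 2 => H1 H2.
have y0 : 0 <= y by rewrite /y divr_ge0// mulr_ge0 ?sqr_ge0.
have ys : y <= s ^+ 2.
  rewrite /y ler_pdivrMr// mulrC ler_wpM2l ?sqr_ge0//.
  by rewrite (@le_trans _ _ 1)// ?exprn_ile1// ?ler1n// ltW.
have H3 : `|y| ^+ 2 * expR `|y| <= a ^+ 3 * (s ^+ 4 * expR (s ^+ 2)).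
  rewrite ger0_norm// mulrA ler_pM ?sqr_ge0 ?expR_ge0 ?ler_expR//.
  have -> : y ^+ 2 = (a ^+ 3 * s ^+ 4) * (a / 4) by rewrite /y; field.
  rewrite ler_piMr ?mulr_ge0 ?exprn_ge0 ?ltW//; lra.
have : `|y - a ^+ 2 / 2 * V| <= a ^+ 3 * (C + s ^+ 4 * expR (s ^+ 2)).
  have -> : y - a ^+ 2 / 2 * V =
    (expR y - 1 - a ^+ 2 / 2 * V) - (expR y - 1 - y) by ring.
  rewrite (le_trans (ler_normB _ _))// mulrDr lerD// (le_trans H1)//.
have -> : y - a ^+ 2 / 2 * V = a ^+ 2 * ((s ^+ 2 - V) / 2) by rewrite /y; field.
set D := C + _; have -> : a ^+ 3 * D = a ^+ 2 * (a * D) by ring.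
rewrite normrM ger0_norm ?sqr_ge0// ler_pM2l ?exprn_gt0//.
rewrite normrM [`|2^-1|]gtr0_norm ?invr_gt0// ler_pdivrMr// => /le_trans; apply.
by rewrite mulrC mulrCA.
Qed.

(** [|x|^3 <= 6 (exp x + exp(- x))] at [x = z / s]; each exponential has mean [exp(1 / 2)], whence
    the constant 12. *)
Lemma normal_cube : \int[N]_z (`|z| ^+ 3) <= 12 * expR (2^-1) * s ^+ 3.
Proof.
have i1 := normal_expR_integrable (s^-1).
have i2 := normal_expR_integrable (- s^-1).
have i12 : N.-integrable setT
    (EFin \o (fun z : R => expR (s^-1 * z) + expR (- s^-1 * z))).
  exact: (integrableD measurableT i1 i2).
apply: (@le_trans _ _ (\int[N]_z (6 * s ^+ 3 * (expR (s^-1 * z) + expR (- s^-1 * z))))).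
  apply: le_Rintegral => //.
  - exact: normal_cube_integrable.
  - exact: (integrableZl measurableT (6 * s ^+ 3) i12).
  move=> z _; have := abs_cube_le (s^-1 * z).
  rewrite normrM gtr0_norm ?invr_gt0// exprMn exprVn mulNr.
  by rewrite ler_pdivrMl ?exprn_gt0// mulrA [6 * _]mulrC.
rewrite RintegralZl// RintegralD// !normal_Rexp.
have -> : s^-1 ^+ 2 * s ^+ 2 / 2 = 2^-1 by field; rewrite gt_eqF.
have -> : (- s^-1) ^+ 2 * s ^+ 2 / 2 = 2^-1 by field; rewrite gt_eqF.
by move: (expR _) (s ^+ 3) => *; lra.
Qed.

End moments.

(** * Independence and the conditional mean of one Gaussian step *)

Section joint_law.
Context d d' {T : measurableType d} {T' : measurableType d'} {R : realType}.
Variables (P : probability T R) (N : probability (measurableTypeR R) R).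
Variables (V : T -> T') (Z : T -> measurableTypeR R).
Hypotheses (mV : measurable_fun setT V) (mZ : measurable_fun setT Z).
Hypothesis indep : forall A B, measurable A -> measurable B ->
  P (V @^-1` A `&` Z @^-1` B) = (P (V @^-1` A) * N B)%E.
Variable Phi : T' * measurableTypeR R -> \bar R.
Hypotheses (mPhi : measurable_fun setT Phi).
Hypothesis bPhi : exists M : R, forall x, (`|Phi x| <= M%:E)%E.

Let VZ w := (V w, Z w).
Let mVZ : measurable_fun setT VZ.
Proof. exact: measurable_fun_pair. Qed.
Let VZm : {mfun T >-> (T' * measurableTypeR R)%type} :=
  HB.pack VZ (isMeasurableFun.Build _ _ _ _ VZ mVZ).
Let Vm : {mfun T >-> T'} := HB.pack V (isMeasurableFun.Build _ _ _ _ V mV).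

Lemma bounded_integrable_prob d0 (T0 : measurableType d0) (Q : probability T0 R)
  (f : T0 -> \bar R) : measurable_fun setT f ->
  (exists M : R, forall x, (`|f x| <= M%:E)%E) -> Q.-integrable setT f.
Proof.
move=> mf [M fM]; apply/integrableP; split => //.
apply: (@le_lt_trans _ _ (\int[Q]_x (cst M%:E x))%E).
  by apply: ge0_le_integral => //; exact: measurableT_comp.
by rewrite integral_cst//= probability_setT mule1 ltry.
Qed.

Let integrable_prod : (distribution P Vm \x N)%E.-integrable setT Phi.
Proof.
case: bPhi => M PhiM; apply/integrableP; split => //.
  apply: (@le_lt_trans _ _ (\int[(distribution P Vm \x N)%E]_x (cst M%:E x))%E).
    by apply: ge0_le_integral => //; exact: measurableT_comp.
  rewrite integral_cst//.
  have -> : [set: T' * measurableTypeR R] = setT `*` setT by rewrite setXTT.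
  rewrite /= product_measure1E//= [X in (_ * (X * _))%E](@probability_setT _ _ _ (distribution P Vm)).
  by rewrite probability_setT !mule1 ltry.
Qed.

Lemma measurable_integral_independent :
  measurable_fun setT (fun w => \int[N]_z Phi (V w, z))%E.
Proof. exact: (measurableT_comp (measurable_fubini_F integrable_prod) mV). Qed.

(** The law of [(V, Z)] agrees with the product measure on rectangles, hence everywhere; the rest is
    Fubini. *)
Lemma integral_independent :
  (\int[P]_w Phi (V w, Z w) = \int[P]_w \int[N]_z Phi (V w, z))%E.
Proof.
transitivity (\int[distribution P VZm]_x Phi x)%E.
  rewrite integral_pushforward//.
  apply: bounded_integrable_prob => /=; first exact: measurableT_comp.
  by case: bPhi => M PhiM; exists M => x /=.
transitivity (\int[(distribution P Vm \x N)%E]_x Phi x)%E.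
  apply: eq_measure_integral => A mA _ /=.
  by apply/esym; apply: product_measure_unique => //.
rewrite -integral12_prod_meas1//.
have mF := measurable_fubini_F integrable_prod.
rewrite integral_pushforward//.
apply: bounded_integrable_prob => /=; first exact: measurableT_comp.
case: bPhi => M PhiM; exists M => w.
have mw : measurable_fun setT (fun z => Phi (V w, z)).
  apply: (measurableT_comp mPhi).
  by apply: measurable_fun_pair; [exact: measurable_cst|exact: measurable_id].
rewrite /= /fubini_F (le_trans (le_abse_integral _ _ _))//.
apply: (@le_trans _ _ (\int[N]_x (cst M%:E x))%E).
  by apply: ge0_le_integral => //; exact: measurableT_comp.
by rewrite integral_cst//= probability_setT mule1.
Qed.

End joint_law.

Section one_step.
Context {R : realType}.
Variables (s : R) (F F1 F2 : R -> R) (B B2 C : R).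
Hypotheses (s0 : 0 < s).
Hypotheses (d1 : forall x, is_derive x (1 : R) F (F1 x)).
Hypotheses (d2 : forall x, is_derive x (1 : R) F1 (F2 x)).
Hypothesis FB : forall x, `|F x| <= B.
Hypothesis F2B : forall x, `|F2 x| <= B2.
Hypothesis F2C : forall x y, `|F2 x - F2 y| <= C * `|x - y|.
Notation N := (normal_prob 0 s).

Let C0 : 0 <= C.
Proof. by have := le_trans (normr_ge0 _) (F2C 1 0); rewrite subr0 normr1 mulr1. Qed.

Lemma is_derive_continuous (f df : R -> R) :
  (forall x, is_derive x (1 : R) f (df x)) -> continuous f.
Proof.
move=> fd x; apply: differentiable_continuous; apply/derivable1_diffP.
exact: (@ex_derive _ _ _ _ _ _ _ (fd x)).
Qed.

Let mF : measurable_fun [set: R] F.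
Proof. by apply: continuous_measurable_fun; exact: is_derive_continuous d1. Qed.

Let mF2 : measurable_fun [set: R] F2.
Proof. by apply: continuous_measurable_fun; exact: lipschitz_continuous F2C. Qed.

Lemma normal_step_integrable (y : R) : N.-integrable setT
  (EFin \o (fun z : R => F (y + z) - F y - s ^+ 2 / 2 * F2 y)).
Proof.
apply: (@normal_dominated_integrable R s s0 _ (B + B + s ^+ 2 / 2 * B2) 0).
  apply: measurable_funB => //; apply: measurable_funB => //.
  by apply: measurableT_comp => //; exact: measurable_funD.
move=> z; rewrite mul0r oppr0 expR0.
have H : `|F (y + z) - F y - s ^+ 2 / 2 * F2 y| <= B + B + s ^+ 2 / 2 * B2.
  rewrite (le_trans (ler_normB _ _))// lerD//.
    by rewrite (le_trans (ler_normB _ _))// lerD.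
  by rewrite normrM ger0_norm ?ler_wpM2l ?divr_ge0 ?sqr_ge0.
by rewrite (le_trans H)//; have := le_trans (normr_ge0 _) H; lra.
Qed.

(** Subtracting [F1 y * z] and [F2 y / 2 * (z ^+ 2 - s ^+ 2)], both of mean zero, leaves the Taylor
    remainder, whose mean is of order [s^3]. *)
Lemma normal_step (y : R) :
  `|\int[N]_z (F (y + z) - F y - s ^+ 2 / 2 * F2 y)| <=
    C * (12 * expR (2^-1) * s ^+ 3).
Proof.
have i1 : N.-integrable setT (EFin \o (fun z : R => z)).
  apply: (@normal_dominated_integrable R s s0 _ 1 1) => // z; rewrite !mul1r.
  exact: abs_le_exp.
have i2 : N.-integrable setT (EFin \o (fun z : R => z ^+ 2)).
  apply: (@normal_dominated_integrable R s s0 _ 2 1) => [|z].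
    exact: measurable_funX.
  by rewrite !mul1r ger0_norm ?sqr_ge0// abs_sqr_le.
have ib (f : R -> R) (M : R) : measurable_fun setT f -> (forall z, `|f z| <= M) ->
    N.-integrable setT (EFin \o f).
  move=> mf fM; apply: (@normal_dominated_integrable R s s0 _ M 0) => // z.
  rewrite mul0r oppr0 expR0; apply: (le_trans (fM z)).
  by have := le_trans (normr_ge0 _) (fM z); lra.
have i3 := normal_step_integrable y.
have i4 : N.-integrable setT (EFin \o (fun z : R => F1 y * z)).
  exact: (integrableZl measurableT (F1 y) i1).
have i8 : N.-integrable setT (EFin \o (fun=> s ^+ 2 : R)).
  by apply: (@ib (fun=> s ^+ 2) (s ^+ 2)) => // z; rewrite ger0_norm ?sqr_ge0.
have i5 : N.-integrable setT (EFin \o (fun z : R => z ^+ 2 - s ^+ 2)).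
  exact: (integrableB measurableT i2 i8).
have i6 : N.-integrable setT (EFin \o (fun z : R => F2 y / 2 * (z ^+ 2 - s ^+ 2))).
  exact: (integrableZl measurableT (F2 y / 2) i5).
have i34 : N.-integrable setT (EFin \o (fun z : R =>
    F (y + z) - F y - s ^+ 2 / 2 * F2 y - F1 y * z)).
  exact: (integrableB measurableT i3 i4).
have i346 : N.-integrable setT (EFin \o (fun z : R =>
    F (y + z) - F y - s ^+ 2 / 2 * F2 y - F1 y * z - F2 y / 2 * (z ^+ 2 - s ^+ 2))).
  exact: (integrableB measurableT i34 i6).
have -> : \int[N]_z (F (y + z) - F y - s ^+ 2 / 2 * F2 y) =
  \int[N]_z (F (y + z) - F y - s ^+ 2 / 2 * F2 y - F1 y * z - F2 y / 2 * (z ^+ 2 - s ^+ 2)).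
  rewrite (RintegralB _ i34)// (RintegralB _ i3)// (RintegralZl _ _ i1)//.
  rewrite (RintegralZl _ _ i5)// normal_mean// mulr0 subr0 (RintegralB _ i2 i8)//.
  rewrite normal_variance// Rintegral_cst//= probability_setT mulr1 subrr mulr0.
  by rewrite subr0.
have i7 := normal_cube_integrable s0.
rewrite (le_trans (le_normr_Rintegral _ _))//.
apply: (@le_trans _ _ (\int[N]_z (C * `|z| ^+ 3))).
  apply: le_Rintegral => //.
  - exact: integrable_norm.
  - exact: (integrableZl measurableT C i7).
  move=> z _; have := taylor2 d1 d2 F2C y z.
  suff -> : F (y + z) - F y - s ^+ 2 / 2 * F2 y - F1 y * z - F2 y / 2 * (z ^+ 2 - s ^+ 2) =
    F (y + z) - F y - F1 y * z - F2 y / 2 * z ^+ 2 by [].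
  by ring.
by rewrite RintegralZl// ler_wpM2l// normal_cube.
Qed.

Section conditional.
Context d {T : measurableType d}.
Variables (P : probability T R) (G : set_system T).
Hypotheses (sG : sigma_algebra setT G) (GT : G `<=` measurable).
Notation TG := (g_sigma_algebraType G).

Lemma sub_measurableE : @measurable _ TG = G.
Proof. exact: sigma_algebra_id. Qed.

Lemma sub_measurable_fun d' (T' : measurableType d') (f : T -> T') :
  measurable_fun (setT : set TG) f -> measurable_fun setT f.
Proof.
move=> mf _ D mD; apply: GT; rewrite -sub_measurableE.
exact: mf.
Qed.

Variables (Z : T -> R) (Y : TG -> R) (A : set T).
Hypotheses (mZ : measurable_fun setT Z) (mY : measurable_fun setT Y) (GA : G A).
Hypothesis indep : forall A B, G A -> measurable B ->
  P (A `&` Z @^-1` B) = (P A * N B)%E.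

(** No conditional expectation is formed: the past is encoded as the identity map from [T] to [T]
    with the sub-sigma-algebra [G]. The increment [Z] is independent of this map, so it can be
    integrated first with the past frozen. *)
Lemma conditional_step :
  `|\int[P]_w (\1_A w * (F (Y w + Z w) - F (Y w) - s ^+ 2 / 2 * F2 (Y w)))| <=
    C * (12 * expR (2^-1) * s ^+ 3).
Proof.
pose f (x : TG * measurableTypeR R) : R :=
  \1_A x.1 * (F (Y x.1 + x.2) - F (Y x.1) - s ^+ 2 / 2 * F2 (Y x.1)).
have mA : measurable (A : set TG) by rewrite sub_measurableE.
have mf : measurable_fun setT f.
  have mY1 : measurable_fun setT (fun x : TG * measurableTypeR R => Y x.1).
    by apply: measurableT_comp => //; exact: measurable_fst.
  have mF2Y : measurable_fun setT (fun x : TG * measurableTypeR R => F2 (Y x.1)).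
    exact: (measurableT_comp mF2 mY1).
  have mFY : measurable_fun setT (fun x : TG * measurableTypeR R => F (Y x.1)).
    exact: (measurableT_comp mF mY1).
  have mFYZ : measurable_fun setT (fun x : TG * measurableTypeR R => F (Y x.1 + x.2)).
    have mYZ : measurable_fun setT (fun x : TG * measurableTypeR R => Y x.1 + x.2).
      by apply: measurable_funD => //; exact: measurable_snd.
    exact: (measurableT_comp mF mYZ).
  apply: measurable_funM.
    apply: measurableT_comp; [exact: measurable_indic|exact: measurable_fst].
  apply: measurable_funB; first exact: measurable_funB.
  exact: measurable_funM.
have fM x : `|f x| <= B + B + s ^+ 2 / 2 * B2.
  rewrite /f normrM -[leRHS]mul1r ler_pM//.
    by rewrite indicE; case: (_ \in _); rewrite ?normr0 ?normr1.
  rewrite (le_trans (ler_normB _ _))// lerD//.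
    by rewrite (le_trans (ler_normB _ _))// lerD.
  by rewrite normrM ger0_norm ?ler_wpM2l ?divr_ge0 ?sqr_ge0.
have bf : exists M : R, forall x, (`|(EFin \o f) x| <= M%:E)%E.
  by exists (B + B + s ^+ 2 / 2 * B2) => x; rewrite lee_fin.
have mid : measurable_fun setT (idfun : T -> TG).
  by move=> _ D; rewrite sub_measurableE => /GT GD; rewrite setTI.
have ind (D : set TG) (E : set (measurableTypeR R)) : measurable D -> measurable E ->
    P ((idfun : T -> TG) @^-1` D `&` (Z : T -> measurableTypeR R) @^-1` E) =
    (P ((idfun : T -> TG) @^-1` D) * N E)%E.
  by rewrite sub_measurableE; exact: indep.
have mEf : measurable_fun setT (EFin \o f) by exact/measurable_EFinP.
have E := @integral_independent _ _ T TG R P N idfun Z mid mZ ind (EFin \o f) mEf bf.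
have mI := @measurable_integral_independent _ _ T TG R P N idfun mid (EFin \o f) mEf bf.
set K := C * _; have K0 : 0 <= K.
  by rewrite /K !mulr_ge0 ?exprn_ge0 ?expR_ge0// ltW.
have inner w : (`|\int[N]_z (EFin \o f) (w, z)| <= K%:E)%E.
  rewrite /f /=.
  have [wA|wA] := boolP (w \in A); rewrite indicE.
    rewrite wA; under eq_integral do rewrite mul1r.
    rewrite -EFin_normr_Rintegral//; last exact: normal_step_integrable.
    by rewrite lee_fin normal_step.
  rewrite (negbTE wA); under eq_integral do rewrite mul0r.
  by rewrite integral0 abse0 lee_fin.
have iI : P.-integrable setT (fun w => \int[N]_z (EFin \o f) (w, z))%E.
  by apply: bounded_integrable_prob => //; exists K.
rewrite /Rintegral -lee_fin.
have -> : (\int[P]_w (\1_A w * (F (Y w + Z w) - F (Y w) - s ^+ 2 / 2 * F2 (Y w)))%:E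
   = \int[P]_w \int[N]_z (EFin \o f) (w, z))%E by exact: E.
have fI : (\int[P]_w (\int[N]_z (EFin \o f) (w, z)) \is a fin_num)%E.
  exact: integrable_fin_num.
rewrite -fine_abse// fineK ?abse_fin_num//.
rewrite (le_trans (le_abse_integral _ _ _))//.
apply: (@le_trans _ _ (\int[P]_x (cst K%:E x))%E).
  by apply: ge0_le_integral => //; exact: measurableT_comp.
by rewrite integral_cst//= probability_setT mule1.
Qed.

End conditional.
End one_step.

(** * The discounted process along a grid *)

Section sums.
Context {R : realType}.

(** Summation by parts with decreasing weights. The bound on [kap k.+1] is required while [w k], not
    [w k.+1], is positive, because the last active step may already leave the truncated region. *)
Lemma abel_le (w kap : nat -> R) (M : R) n :
  (forall k, 0 <= w k) -> (forall k, w k.+1 <= w k) -> w 0 <= 1 -> 0 <= M ->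
  kap 0 = 0 -> (forall k, (k < n)%N -> 0 < w k -> kap k.+1 <= M) ->
  \sum_(k < n) w k * (kap k.+1 - kap k) <= M.
Proof.
move=> w0 wS w1 M0 k0 H; case: n H => [|n] H; first by rewrite big_ord0.
have wk k : (k < n.+1)%N -> w k * kap k.+1 <= w k * M.
  move=> kn; have := w0 k; rewrite le_eqVlt => /predU1P[<-|wk]; first by rewrite !mul0r.
  by rewrite ler_wpM2l// H.
have ind m : (m <= n)%N ->
    \sum_(k < m.+1) w k * (kap k.+1 - kap k) <= (w 0 - w m) * M + w m * kap m.+1.
  elim: m => [_|m IH mn].
    by rewrite big_ord_recr big_ord0/= k0 subr0 subrr mul0r !add0r.
  rewrite big_ord_recr/= (le_trans (lerD (IH (ltnW mn)) (lexx _)))//.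
  have wm := wk m (leqW mn); have wm' := wS m.
  have : (w m - w m.+1) * kap m.+1 <= (w m - w m.+1) * M.
    have : 0 <= w m - w m.+1 by rewrite subr_ge0.
    rewrite le_eqVlt => /predU1P[<-|wlt]; first by rewrite !mul0r.
    rewrite ler_pM2l// H//; first exact: leqW.
    by rewrite (le_lt_trans (w0 m.+1))// -subr_gt0.
  by move=> *; lra.
rewrite (le_trans (ind n _))//; have := wk n (leqnn _) => wn.
have := ler_wpM2r M0 w1; rewrite mul1r => *; lra.
Qed.

(** [j] is the first index where [A] fails, or [n]: a sum cut off by a decreasing family is the
    increment up to a stopped index. *)
Lemma telescope_dec (A : nat -> bool) (g : nat -> R) n :
  (forall k, A k.+1 -> A k) ->
  exists2 j, (j <= n)%N /\ (forall k, (k < n)%N -> A k = (k < j)%N) &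
    \sum_(k < n) (A k)%:R * (g k.+1 - g k) = g j - g 0.
Proof.
move=> AS; elim: n => [|n [j [jn Aj] E]].
  by exists 0%N => //; rewrite big_ord0 subrr.
rewrite big_ord_recr/= E.
have A_le k l : (k <= l)%N -> A l -> A k.
  by move=> kl; elim: l kl => [|l IH]; [rewrite leqn0 => /eqP->|
    rewrite leq_eqVlt => /predU1P[->//|kl /AS]; exact: IH].
have [An|An] := boolP (A n).
  have jE : j = n.
    apply/eqP; rewrite eqn_leq jn/= leqNgt; apply/negP => jn'.
    have := Aj j jn'; rewrite ltnn => /negP; apply.
    exact: A_le An.
  exists n.+1; last by rewrite jE mul1r; ring.
  by split=> // k; rewrite ltnS => kn; rewrite kn (A_le _ _ kn An).
exists j; last by rewrite mul0r addr0.
split; first exact: leqW.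
move=> k; rewrite ltnS leq_eqVlt => /predU1P[->|/Aj//].
by rewrite (negbTE An); apply/esym/negbTE; rewrite -leqNgt.
Qed.

End sums.

(** * Pathwise bounds on discounted increments along a grid *)

Section path.
Context {R : realType}.
Variables (F F1 F2 : R -> R) (B B1 B2 : R).
Hypotheses (d1 : forall x, is_derive x (1 : R) F (F1 x)).
Hypotheses (d2 : forall x, is_derive x (1 : R) F1 (F2 x)).
Hypothesis FB : forall x, `|F x| <= B.
Hypothesis F1B : forall x, `|F1 x| <= B1.
Hypothesis F2B : forall x, `|F2 x| <= B2.
Variables (gam r : R).
Hypotheses (gam0 : 0 < gam) (r0 : 0 < r).

Let B0 : 0 <= B. Proof. exact: le_trans (normr_ge0 _) (FB 0). Qed.
Let B10 : 0 <= B1. Proof. exact: le_trans (normr_ge0 _) (F1B 0). Qed.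
Let B20 : 0 <= B2. Proof. exact: le_trans (normr_ge0 _) (F2B 0). Qed.

(** Local time grows only near 0, so the slope met during the push exceeds [F1 0] by at most
    [B2 * (2 + gam) * om]. *)
Lemma local_time_step (p p' dw dl om : R) : 0 <= dl -> 0 <= om ->
  p' = p + dw + gam * dl -> dl <= om -> (dl = 0 \/ `|p'| <= 2 * om) ->
  F p' - F (p + dw) <= gam * F1 0 * dl + gam * B2 * (2 + gam) * om * dl.
Proof.
move=> dl0 om0 -> dlom [->|pom]; first by rewrite !mulr0 !addr0 subrr.
have gd : 0 <= gam * dl by rewrite mulr_ge0// ltW.
have [|xi] := @MVT_le _ _ _ (p + dw) (p + dw + gam * dl) d1; first by rewrite lerDl.
rewrite [p + dw + gam * dl - (p + dw)]addrC addKr => xiE ->.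
have xi0 : `|xi| <= (2 + gam) * om.
  have gdo : gam * dl <= gam * om by rewrite ler_wpM2l// ltW.
  move: pom xiE; rewrite !ler_norml => /andP[? ?] /andP[? ?].
  by apply/andP; split; lra.
have [c _] := MVT_any 0 xi d2; rewrite subr0 => E.
have : F1 xi <= F1 0 + B2 * ((2 + gam) * om).
  by rewrite -lerBlDl E (le_trans (ler_norm _))// normrM ler_pM.
by move=> /(ler_wpM2r (mulr_ge0 (ltW gam0) dl0)) => *; lra.
Qed.

(** In the drift term [F p'] is traded for [F p], so that it meets [h / 2 * F2 p] at the same
    point. *)
Lemma discount_step (p p' om h : R) : 0 <= h -> `|p' - p| <= om ->
  expR (- r * h) * F p' <=
  F p' - r * h * F p + (r * h) ^+ 2 * expR (r * h) * B + r * h * (B1 * om).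
Proof.
move=> h0 pp.
have rh0 : 0 <= r * h by rewrite mulr_ge0// ltW.
have E := expR_taylor2 (- r * h).
rewrite mulNr normrN (ger0_norm rh0) in E.
have H1 : (expR (- (r * h)) - 1 - - (r * h)) * F p' <= (r * h) ^+ 2 * expR (r * h) * B.
  by rewrite (le_trans (ler_norm _))// normrM ler_pM.
have H2 : `|F p' - F p| <= B1 * om.
  by rewrite (le_trans (derive_lipschitz d1 F1B _ _))// ler_wpM2l.
have H3 : r * h * (F p - F p') <= r * h * (B1 * om).
  rewrite ler_wpM2l// (le_trans _ H2)// distrC ler_norm//.
rewrite mulNr; move: H1 H3; move: (expR _) => e; lra.
Qed.

Section path_sum.
Variables (x w l : R -> R) (A : nat -> bool) (N J a eta sig Del m t om : R) (n : nat).
Hypothesis FS : forall k, A k.+1 -> A k.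
Hypothesis xE : forall u v : R, x v - x u = w v - w u + gam * (l v - l u).
Hypothesis l0 : l 0 = 0.
Hypothesis lm : forall u v : R, 0 <= u -> u <= v -> l u <= l v.
Hypothesis lflat : forall u v : R, 0 <= u -> u <= v ->
  (forall s : R, u <= s <= v -> x s <> 0) -> l v = l u.
Hypotheses (a0 : 0 < a) (t0 : 0 <= t) (J0 : 0 <= J) (eta0 : 0 <= eta) (sig0 : 0 <= sig).
Let h := t / n.+1%:R.
Let g := grid t n.

Let h0 : 0 <= h. Proof. exact: divr_ge0. Qed.
Let gS k : g k.+1 - g k = h. Proof. by rewrite /g gridS addrC addKr. Qed.
Let g0 k : 0 <= g k. Proof. exact: grid_ge0. Qed.
Let gle k : g k <= g k.+1. Proof. by rewrite -subr_ge0 gS. Qed.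

(* Of the step [dx = dw + gam dl], only [F (x + dw)] has a conditional mean that
   can be computed from the past, namely [F x + h / 2 * F2 x] up to o(h). *)
Definition path_summand (k : nat) : R :=
  expR (- r * h) * F (x (g k.+1)) - F (x (g k) + (w (g k.+1) - w (g k))) +
  h / 2 * F2 (x (g k)).

Definition path_sum : R :=
  \sum_(k < n.+1) (A k)%:R * expR (- r * g k) * path_summand k.

Let wt (k : nat) : R := (A k)%:R * expR (- r * g k).

Let wt_ge0 k : 0 <= wt k.
Proof. by rewrite mulr_ge0 ?expR_ge0. Qed.

Let wtS k : wt k.+1 <= wt k.
Proof.
rewrite /wt ler_pM ?expR_ge0//; first by case: (A k.+1) (@FS k) => //= ->.
by rewrite ler_expR !mulNr lerN2 ler_wpM2l// ltW.
Qed.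

Let wt0 : wt 0%N <= 1.
Proof. by rewrite /wt /g grid0 mulr0 expR0 mulr1; case: (A 0%N). Qed.

Let wt1 k : wt k <= 1.
Proof. by elim: k => // k /(le_trans _); apply. Qed.

Let wtA k : 0 < wt k -> A k.
Proof. by rewrite /wt; case: (A k) => //; rewrite mul0r ltxx. Qed.

Let sum_h : \sum_(k < n.+1) h = t.
Proof. by rewrite sumr_const card_ord -mulr_natr /h divfK// pnatr_eq0. Qed.

(** A bound independent of the mesh and of any modulus of continuity, for passing to the limit under
    the expectation. *)
Lemma path_sum_bound : (forall k, (k < n.+1)%N -> A k -> l (g k) <= J) ->
  path_sum <= gam * B1 * J + 2 * B + t * (r * B + B2 / 2).
Proof.
move=> AJ.
(* While the local time stays below [J] the push is controlled by the Lipschitz constant; the single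
   step that crosses [J] is paid for by [2 * B]. *)
pose kap k := gam * B1 * Num.min (l (g k)) J + (2 * B) * (J < l (g k))%R%:R.
have step k : (k < n.+1)%N -> wt k * path_summand k <=
    wt k * (kap k.+1 - kap k) + h * (r * B + B2 / 2).
  move=> kn; have := wt_ge0 k; rewrite le_eqVlt => /predU1P[<-|wk].
    by rewrite !mul0r add0r mulr_ge0// addr_ge0 ?divr_ge0// mulr_ge0// ltW.
  have lk := AJ k kn (wtA wk).
  have e1 : (expR (- r * h) - 1) * F (x (g k.+1)) <= h * (r * B).
    have -> : h * (r * B) = (r * h) * B by ring.
    rewrite (le_trans (ler_norm _))// normrM ler_pM//.
    rewrite mulNr ler0_norm ?subr_le0; last first.
      by rewrite -[leRHS]expR0 ler_expR oppr_le0 mulr_ge0// ltW.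
    by have := expR_ge1Dx (- (r * h)); lra.
  have e2 : h / 2 * F2 (x (g k)) <= h * (B2 / 2).
    have : F2 (x (g k)) <= B2 by rewrite (le_trans (ler_norm _)).
    by move=> /(ler_wpM2l h0); lra.
  have e3 : F (x (g k.+1)) - F (x (g k) + (w (g k.+1) - w (g k))) <= kap k.+1 - kap k.
    have lS := lm (g0 k) (gle k).
    have nJ : (J < l (g k)) = false by rewrite ltNge lk.
    rewrite /kap (min_l lk) nJ mulr0 addr0.
    have [lJ|lJ] := leP (l (g k.+1)) J.
      rewrite mulr0 addr0 -mulrBr (le_trans (ler_norm _))//.
      rewrite (le_trans (derive_lipschitz d1 F1B _ _))//.
      have E := xE (g k) (g k.+1).
      have -> : x (g k.+1) - (x (g k) + (w (g k.+1) - w (g k))) =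
        gam * (l (g k.+1) - l (g k)) by lra.
      rewrite ger0_norm; last by rewrite mulr_ge0 ?subr_ge0// ltW.
      by rewrite mulrA [B1 * _]mulrC.
    rewrite mulr1.
    have := FB (x (g k.+1)); have := FB (x (g k) + (w (g k.+1) - w (g k))).
    have : 0 <= gam * B1 * (J - l (g k)) by rewrite mulr_ge0 ?subr_ge0// mulr_ge0// ltW.
    by rewrite !ler_norml => ? /andP[? ?] /andP[? ?]; lra.
  have sle : path_summand k <= kap k.+1 - kap k + h * (r * B + B2 / 2).
    by rewrite /path_summand; lra.
  rewrite (le_trans (ler_wpM2l (wt_ge0 k) sle))// mulrDr lerD2l.
  by rewrite ler_piMl// mulr_ge0// addr_ge0 ?divr_ge0// mulr_ge0// ltW.
apply: (@le_trans _ _ (\sum_(k < n.+1)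
    (wt k * (kap k.+1 - kap k) + h * (r * B + B2 / 2)))).
  by apply: ler_sum => k _; exact: step.
rewrite big_split/= -mulr_suml sum_h lerD//.
apply: abel_le => //.
- by rewrite addr_ge0 ?mulr_ge0// ltW.
- by rewrite /kap /g grid0 l0 min_l// ltNge J0 !mulr0 addr0.
- move=> k kn wk; rewrite /kap lerD//.
    by rewrite ler_wpM2l ?ge_min ?lexx ?orbT// mulr_ge0// ltW.
  by rewrite ler_piMr ?mulr_ge0//; case: (_ < _).
Qed.


Hypothesis xc : continuous x.
Hypothesis om0 : 0 <= om.
Hypothesis xom : forall u v, 0 <= u <= t -> `|u - v| <= h ->
  `|x u - x v| <= om /\ `|l u - l v| <= om.
Hypothesis AJ : forall k, (k < n.+1)%N -> A k ->
  [/\ l (g k) <= J, `|occ x (g k) a - l (g k)| <= eta & `|x (g k)| <= N].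
Hypothesis F2ub : forall p, `|p| <= N ->
  F2 p <= 2 * r * F p + Del * tri a p + 2 * sig.
Hypothesis Delm : gam * m + Del / 2 = 0.

(** The two first-order effects of the kink, push and curvature. By [Delm] they cancel as far as
    [F1 0] is close to [m] and [occ] to [l]. *)
Let kap (k : nat) : R := gam * F1 0 * l (g k) + Del / 2 * occ x (g k) a.
Let c2 : R := gam * B2 * (2 + gam) * om.
Let E1 : R := sig + r ^+ 2 * h * expR (r * h) * B + r * B1 * om
  + `|Del| / 2 * om / a ^+ 2.

Let c20 : 0 <= c2.
Proof. by rewrite /c2 mulr_ge0// mulr_ge0 ?addr_ge0 ?mulr_ge0// ltW. Qed.

Let E10 : 0 <= E1.
Proof.
by rewrite /E1 !addr_ge0 ?divr_ge0 ?mulr_ge0 ?expR_ge0 ?exprn_ge0// ltW.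
Qed.

Let kap0 : kap 0 = 0.
Proof. by rewrite /kap /g grid0 l0 occ0 !mulr0 addr0. Qed.

Let gt (k : nat) : (k <= n.+1)%N -> 0 <= g k <= t.
Proof. by move=> kn; rewrite g0/= -[leRHS](gridn t n) grid_le. Qed.

Let step k : (k < n.+1)%N -> A k -> path_summand k <=
  kap k.+1 - kap k + c2 * (l (g k.+1) - l (g k)) + h * E1.
Proof.
move=> kn Ak; have [lJ oJ xN] := AJ kn Ak.
have gk := gt (ltnW kn); have gk1 := gt kn.
have dist : `|g k - g k.+1| <= h by rewrite distrC gS ger0_norm.
have [xom1 lom1] := xom gk dist.
have dl0 : 0 <= l (g k.+1) - l (g k) by rewrite subr_ge0 lm.
have dlom : l (g k.+1) - l (g k) <= om.
  by rewrite (le_trans (ler_norm _))// distrC.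
have pE : x (g k.+1) = x (g k) + (w (g k.+1) - w (g k)) +
    gam * (l (g k.+1) - l (g k)) by have := xE (g k) (g k.+1); lra.
(* Either the path vanishes during the step and so ends it near 0, or the local time is flat on
   it. *)
have pz : l (g k.+1) - l (g k) = 0 \/ `|x (g k.+1)| <= 2 * om.
  have [Z|Z] := pselect (exists2 s, g k <= s <= g k.+1 & x s = 0).
    right; have [s /andP[s1 s2] xs] := Z.
    have sh : `|g k.+1 - s| <= h by rewrite ger0_norm ?subr_ge0// -(gS k) lerD2l lerN2.
    have [] := xom gk1 sh; rewrite xs subr0 => + _; lra.
  left; apply/eqP; rewrite subr_eq0; apply/eqP/lflat => // s gs xs.
  by apply: Z; exists s.
have S1 := local_time_step dl0 om0 pE dlom pz.
have S2 := @discount_step (x (g k)) (x (g k.+1)) om h h0 _.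
rewrite distrC in S2; have {}S2 := S2 xom1.
have osc u : g k <= u <= g k.+1 -> `|x u - x (g k)| <= om.
  move=> /andP[u1 u2]; rewrite distrC; apply: (proj1 (xom gk _)).
  by rewrite distrC ger0_norm ?subr_ge0// -(gS k) lerD2r.
have S3 := occ_incr xc a0 (g0 k) (gle k) osc.
rewrite gS in S3.
have S4 : Del * (h * tri a (x (g k))) <=
   Del * (occ x (g k.+1) a - occ x (g k) a) + `|Del| * (h * om / a ^+ 2).
  rewrite -lerBlDl -mulrBr (le_trans (ler_norm _))// normrM ler_wpM2l//.
  by rewrite distrC.
have S5 := ler_wpM2l h0 (F2ub xN).
rewrite /path_summand /kap /c2 /E1.
move: S1 S2 S4 S5; move: (`|Del|) (a ^- 2) (tri _ _) (F _) => *; lra.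
Qed.

(** The first three terms survive the mesh limit; each term of the bracketed group carries a factor
    [om] or [h]. *)
Lemma path_sum_le : path_sum <=
  gam * `|F1 0 - m| * J + `|Del| / 2 * eta + t * sig
  + (gam * B1 * om + `|Del| / 2 * (h / a)
     + t * (r ^+ 2 * h * expR (r * h) * B + r * B1 * om + `|Del| / 2 * om / a ^+ 2)
     + c2 * (J + om)).
Proof.
apply: (@le_trans _ _ (\sum_(k < n.+1)
    (wt k * (kap k.+1 - kap k) + c2 * (wt k * (l (g k.+1) - l (g k))) + h * E1))).
  apply: ler_sum => k _; rewrite -/(wt k).
  have := wt_ge0 k; rewrite le_eqVlt => /predU1P[<-|wk].
    by rewrite !mul0r mulr0 !add0r mulr_ge0.
  have S := ler_wpM2l (wt_ge0 k) (step (ltn_ord k) (wtA wk)).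
  have hE : wt k * (h * E1) <= h * E1 by rewrite ler_piMl ?mulr_ge0.
  apply: (le_trans S).
  by rewrite 2!mulrDr [wt k * (c2 * _)]mulrCA lerD2l.
rewrite !big_split/= -mulr_suml -mulr_sumr sum_h.
have om1 k : (k < n.+1)%N -> 0 <= l (g k.+1) - l (g k) <= om.
  move=> kn; rewrite subr_ge0 lm//= (le_trans (ler_norm _))// distrC.
  by apply: (proj2 (xom (gt (ltnW kn)) _)); rewrite distrC gS ger0_norm.
have SL : \sum_(k < n.+1) wt k * (l (g k.+1) - l (g k)) <= J + om.
  apply: (@abel_le _ wt (fun k => l (g k))) => //.
  - exact: addr_ge0.
  - by rewrite /g grid0.
  move=> k kn /wtA /(AJ kn)[lJ _ _].
  by have /andP[_] := om1 k kn; lra.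
have SK : \sum_(k < n.+1) wt k * (kap k.+1 - kap k) <=
    gam * `|F1 0 - m| * J + `|Del| / 2 * eta + gam * B1 * om + `|Del| / 2 * (h / a).
  apply: abel_le => //.
    by rewrite !addr_ge0 ?mulr_ge0 ?invr_ge0 ?(ltW a0)// ltW.
  move=> k kn /wtA /(AJ kn)[lJ oJ _].
  have /andP[lo1 lo2] := om1 k kn.
  have lk0 : 0 <= l (g k) by rewrite -l0 lm.
  (* [Delm] lets [gam * m * l] be added and [Del / 2 * l] subtracted at no cost, so that every
     summand left is an error. *)
  have -> : kap k.+1 = gam * (F1 0 - m) * l (g k) + Del / 2 * (occ x (g k) a - l (g k))
    + gam * F1 0 * (l (g k.+1) - l (g k)) + Del / 2 * (occ x (g k.+1) a - occ x (g k) a).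
    have DE : Del / 2 = - (gam * m).
      by apply/eqP; rewrite -addr_eq0 addrC Delm.
    rewrite /kap DE; ring.
  rewrite !lerD//.
  - rewrite (le_trans (ler_norm _))// !normrM (gtr0_norm gam0).
    by rewrite ler_wpM2l ?mulr_ge0 ?(ltW gam0)// ger0_norm.
  - rewrite (le_trans (ler_norm _))// !normrM (@gtr0_norm _ 2^-1) ?invr_gt0//.
    by rewrite ler_wpM2l// mulr_ge0.
  - rewrite (le_trans (ler_norm _))// !normrM (gtr0_norm gam0).
    by rewrite ler_pM ?mulr_ge0 ?(ltW gam0)// ?ler_wpM2l ?(ltW gam0)// ger0_norm.
  - rewrite (le_trans (ler_norm _))// !normrM (@gtr0_norm _ 2^-1) ?invr_gt0//.
    rewrite ler_wpM2l ?mulr_ge0//.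
    have /andP[q1 q2] := occ_le xc a0 (g0 k) (gle k).
    by rewrite ger0_norm ?subr_ge0// lerBlDl -(gS k).
have := ler_wpM2l c20 SL; rewrite /E1 => *; lra.
Qed.

End path_sum.
End path.

Section expectation.
Context {R : realType} {d} {T : measurableType d} (P : probability T R).
Implicit Types f g : T -> R.

Lemma bounded_integrable f (M : R) : measurable_fun setT f ->
  (forall w, `|f w| <= M) -> P.-integrable setT (EFin \o f).
Proof.
move=> mf fM; apply: bounded_integrable_prob; first exact/measurable_EFinP.
by exists M => w; rewrite lee_fin.
Qed.

Lemma E_cst (c : R) : \int[P]_w c = c.
Proof. by rewrite Rintegral_cst//= probability_setT mulr1. Qed.

Lemma E_le f g (M : R) : measurable_fun setT f -> measurable_fun setT g ->
  (forall w, `|f w| <= M) -> (forall w, `|g w| <= M) ->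
  {ae P, forall w, f w <= g w} -> \int[P]_w f w <= \int[P]_w g w.
Proof.
move=> mf mg fM gM fg.
have iF := bounded_integrable mf fM; have iG := bounded_integrable mg gM.
rewrite -subr_ge0 -RintegralB//.
have -> : \int[P]_w (g w - f w) = \int[P]_w `|g w - f w|.
  congr fine; apply: ae_eq_integral => //.
  - exact/measurable_EFinP/measurable_funB.
  - by apply/measurable_EFinP/measurableT_comp => //; exact: measurable_funB.
  - by apply: filterS fg => w fgw _ /=; rewrite ger0_norm// subr_ge0.
exact: Rintegral_ge0.
Qed.

(** The bound is only almost sure, so integrability of the limit is part of the conclusion. *)
Lemma E_cvg_ae (f_ : nat -> T -> R) f (M : R) :
  (forall n, measurable_fun setT (f_ n)) -> measurable_fun setT f ->
  {ae P, forall w, forall n, `|f_ n w| <= M} ->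
  {ae P, forall w, f_ n w @[n --> \oo] --> f w} ->
  P.-integrable setT (EFin \o f) /\ \int[P]_w f_ n w @[n --> \oo] --> \int[P]_w f w.
Proof.
move=> mf_ mf fM ff.
have [//|||||] := @dominated_convergence _ _ _ P setT measurableT
  (fun n => EFin \o f_ n) (EFin \o f) (cst M%:E).
- by move=> n; exact/measurable_EFinP.
- exact/measurable_EFinP.
- by apply: filterS ff => w fw _ /=; apply: cvg_EFin => //; exact: nearW.
- exact: finite_measure_integrable_cst.
- by apply: filterS fM => w fM n _; rewrite /= lee_fin.
move=> iF _ H; split => //; move: H.
rewrite -[X in _ --> X -> _]fineK; last exact: integrable_fin_num.
by move=> /fine_cvgP[_].
Qed.

Lemma E_cvg (f_ : nat -> T -> R) f (M : R) :
  (forall n, measurable_fun setT (f_ n)) -> measurable_fun setT f ->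
  (forall n w, `|f_ n w| <= M) -> {ae P, forall w, f_ n w @[n --> \oo] --> f w} ->
  \int[P]_w f_ n w @[n --> \oo] --> \int[P]_w f w.
Proof.
by move=> mf_ mf fM ff; apply: (E_cvg_ae mf_ mf _ ff).2; exact: aeW.
Qed.

End expectation.

(** * The mesh limit in expectation under an adapted truncation *)

Section localized.
Context {R : realType} {d} {T : measurableType d} (P : probability T R).
Variables (X W L : R -> T -> R) (G : R -> set_system T) (x0 gam r : R).
Hypotheses (gam0 : 0 < gam) (r0 : 0 < r).
Hypothesis sG : forall s : R, 0 <= s -> sigma_algebra setT (G s).
Hypothesis GT : forall s : R, 0 <= s -> G s `<=` measurable.
Hypothesis Gle : forall s t : R, 0 <= s -> s <= t -> G s `<=` G t.
Notation TG s := (g_sigma_algebraType (G s)).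
Hypothesis Xc : forall w, continuous (X^~ w).
Hypothesis Lc : forall w, continuous (L^~ w).
Hypothesis XG : forall s : R, 0 <= s -> measurable_fun [set: TG s] (X s : TG s -> R).
Hypothesis WG : forall s : R, 0 <= s -> measurable_fun [set: TG s] (W s : TG s -> R).
Hypothesis LG : forall s : R, 0 <= s -> measurable_fun [set: TG s] (L s : TG s -> R).
Hypothesis XE : forall w (u v : R),
  X v w - X u w = W v w - W u w + gam * (L v w - L u w).
Hypothesis indep : forall (s t : R) (A : set T) (B : set R), 0 <= s -> s < t -> G s A -> measurable B ->
  P (A `&` (fun w => W t w - W s w) @^-1` B) =
  (P A * normal_prob 0 (Num.sqrt (t - s)) B)%E.

(** Gathers what holds only almost surely; continuity and the equation [XE] are required of every
    [w]. *)
Definition regular_path (w : T) : Prop :=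
  [/\ X 0 w = x0, L 0 w = 0,
    (forall u v : R, 0 <= u -> u <= v -> L u w <= L v w),
    (forall u v : R, 0 <= u -> u <= v ->
      (forall s : R, u <= s <= v -> X s w <> 0) -> L v w = L u w) &
    (forall t : R, 0 <= t -> forall eta : R, 0 < eta -> exists2 dl, 0 < dl &
      forall a : R, 0 < a < dl -> `|occ (X^~ w) t a - L t w| <= eta)].
Hypothesis regular : {ae P, forall w, regular_path w}.

Lemma adapt_le s t (f : T -> R) : 0 <= s -> s <= t ->
  measurable_fun [set: TG s] (f : TG s -> R) ->
  measurable_fun [set: TG t] (f : TG t -> R).
Proof.
move=> s0 st mf _ B mB; rewrite (sub_measurableE (sG (le_trans s0 st))).
apply: Gle st _ _ => //; rewrite -(sub_measurableE (sG s0)).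
exact: mf.
Qed.

Lemma adapted_measurable s (f : T -> R) : 0 <= s ->
  measurable_fun [set: TG s] (f : TG s -> R) -> measurable_fun setT f.
Proof. by move=> s0 mf; exact: (sub_measurable_fun (sG s0) (GT s0) mf). Qed.

Lemma occ_adapted s a : 0 <= s -> 0 < a ->
  measurable_fun [set: TG s] ((fun w => occ (X^~ w) s a) : TG s -> R).
Proof.
move=> s0 a0.
apply: (@measurable_realfun.measurable_fun_cvg _ (TG s) R setT
  (fun n w => \sum_(k < n.+1) s / n.+1%:R * tri a (X (grid s n k) w))).
  move=> n; apply: measurable_sum => k; apply: measurable_funM => //.
  apply: measurableT_comp.
    by apply: continuous_measurable_fun; exact: continuous_tri.
  apply: adapt_le (XG (grid_ge0 _ _ s0)); first exact: grid_ge0.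
  by rewrite -[leRHS](gridn s n) grid_le// ltnW.
by move=> w _; exact: occ_riemann.
Qed.

Variables (F F1 F2 : R -> R) (B B1 B2 C : R).
Hypotheses (d1 : forall x, is_derive x (1 : R) F (F1 x)).
Hypotheses (d2 : forall x, is_derive x (1 : R) F1 (F2 x)).
Hypothesis FB : forall x, `|F x| <= B.
Hypothesis F1B : forall x, `|F1 x| <= B1.
Hypothesis F2B : forall x, `|F2 x| <= B2.
Hypothesis F2C : forall x y, `|F2 x - F2 y| <= C * `|x - y|.

Variables (tau : T -> \bar R) (N t J eta a sig Del m : R).
Hypothesis tauG : forall s : R, 0 <= s -> G s [set w | (s%:E <= tau w)%E].
Hypotheses (t0 : 0 < t) (J0 : 0 <= J) (eta0 : 0 <= eta) (a0 : 0 < a) (sig0 : 0 <= sig).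
Hypothesis tauN : {ae P, forall w, forall s : R, 0 <= s -> (s%:E <= tau w)%E -> `|X s w| <= N}.
Hypothesis F2ub : forall p, `|p| <= N ->
  F2 p <= 2 * r * F p + Del * tri a p + 2 * sig.
Hypothesis Delm : gam * m + Del / 2 = 0.

(* Truncation that only uses the past: the local time is at most [J] and within
   [eta] of the occupation functional. *)
Definition ok_at (s : R) : set T :=
  [set w | L s w <= J /\ `|occ (X^~ w) s a - L s w| <= eta].

(** Intersecting over all earlier nodes makes these events decreasing in [k], so that the sums they
    cut off telescope. *)
Definition active (n k : nat) : set T :=
  [set w | ((grid t n k)%:E <= tau w)%E] `&`
  \bigcap_(i in [set i | (i <= k)%N]) ok_at (grid t n i).

Let g0 n k : 0 <= grid t n k. Proof. exact/grid_ge0/ltW. Qed.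

Lemma active_adapted n k : G (grid t n k) (active n k).
Proof.
rewrite -(sub_measurableE (sG (g0 n k))); apply: measurableI.
  by rewrite (sub_measurableE (sG (g0 n k))); exact: tauG.
apply: bigcap_measurableType => i /= ik.
have gi : grid t n i <= grid t n k by rewrite grid_le// ltW.
have mL := adapt_le (g0 n i) gi (LG (g0 n i)).
have mO := adapt_le (g0 n i) gi (occ_adapted (g0 n i) a0).
rewrite (_ : ok_at _ = [set w | L (grid t n i) w <= J] `&`
  [set w | `|occ (X^~ w) (grid t n i) a - L (grid t n i) w| <= eta])//.
apply: measurableI.
  by rewrite -[X in measurable X]setTI; apply: measurable_fun_le.
rewrite -[X in measurable X]setTI; apply: measurable_fun_le => //.
by apply: measurableT_comp => //; exact: measurable_funB.
Qed.

Lemma activeS n k w : active n k.+1 w -> active n k w.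
Proof.
move=> [/= tk ok]; split => /=.
  by apply: le_trans tk; rewrite lee_fin grid_le// ltW.
by move=> i /= ik; apply: ok; rewrite /= leqW.
Qed.

Let A n k w := w \in active n k.

Let FS n w k : A n k.+1 w -> A n k w.
Proof. by rewrite /A !inE; exact: activeS. Qed.

Definition disc (F : R -> R) (s : R) (w : T) : R := expR (- r * s) * F (X s w).

Let S n w := \sum_(k < n.+1) \1_(active n k) w *
  (disc F (grid t n k.+1) w - disc F (grid t n k) w).

Let h n := t / n.+1%:R.
Let h0 n : 0 < h n. Proof. by rewrite divr_gt0// ltr0n. Qed.

(** Its mean is [O(h^(3/2))] by the Gaussian step, so [n + 1] such terms contribute [O(sqrt h)]. *)
Let Mart n k w := \1_(active n k) w *
  (F (X (grid t n k) w + (W (grid t n k.+1) w - W (grid t n k) w))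
   - F (X (grid t n k) w) - Num.sqrt (h n) ^+ 2 / 2 * F2 (X (grid t n k) w)).

Let Q n w := path_sum F F2 r (X^~ w) (W^~ w) (A n ^~ w) t n.

Let SE n w : S n w = Q n w + \sum_(k < n.+1) expR (- r * grid t n k) * Mart n k w.
Proof.
rewrite /Q /path_sum -big_split/=; apply: eq_bigr => k _.
rewrite /Mart /disc /path_summand indicE -/(A n k w).
have -> : expR (- r * grid t n k.+1) = expR (- r * grid t n k) * expR (- r * h n).
  by rewrite gridS mulrDr expRD.
rewrite sqr_sqrtr ?(ltW (h0 n))// -/(h n).
by ring.
Qed.

Let FcR : continuous F. Proof. exact: is_derive_continuous d1. Qed.
Let mF : measurable_fun setT F. Proof. exact: continuous_measurable_fun. Qed.
Let mF2 : measurable_fun setT F2.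
Proof. by apply: continuous_measurable_fun; exact: lipschitz_continuous F2C. Qed.

Let mX s : 0 <= s -> measurable_fun setT (X s).
Proof. by move=> s0; exact: adapted_measurable (XG s0). Qed.

Let mW s : 0 <= s -> measurable_fun setT (W s).
Proof. by move=> s0; exact: adapted_measurable (WG s0). Qed.

Let m_active n k : measurable (active n k).
Proof. by apply: (GT (g0 n k)); exact: active_adapted. Qed.

Let mMart n k : measurable_fun setT (Mart n k).
Proof.
apply: measurable_funM; first exact: measurable_indic.
apply: measurable_funB; first apply: measurable_funB.
- apply: measurableT_comp => //; apply: measurable_funD; first exact: mX.
  by apply: measurable_funB; exact: mW.
- by apply: measurableT_comp => //; exact: mX.
- by apply: measurable_funM => //; apply: measurableT_comp => //; exact: mX.
Qed.

Let B0 : 0 <= B. Proof. exact: le_trans (normr_ge0 _) (FB 0). Qed.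
Let B10 : 0 <= B1. Proof. exact: le_trans (normr_ge0 _) (F1B 0). Qed.
Let B20 : 0 <= B2. Proof. exact: le_trans (normr_ge0 _) (F2B 0). Qed.

Lemma indic_bound (D : set T) w : `|\1_D w : R| <= 1.
Proof. by rewrite indicE; case: (_ \in _); rewrite ?normr0 ?normr1. Qed.

Let Mart_bound n k w : `|Mart n k w| <= B + B + h n / 2 * B2.
Proof.
rewrite /Mart sqr_sqrtr ?(ltW (h0 n))// normrM -[leRHS]mul1r ler_pM ?indic_bound//.
rewrite (le_trans (ler_normB _ _))// lerD//.
  by rewrite (le_trans (ler_normB _ _))// lerD.
by rewrite normrM ger0_norm ?ler_wpM2l ?divr_ge0// ltW.
Qed.

Let E_Mart n k : (k < n.+1)%N ->
  \int[P]_w (expR (- r * grid t n k) * Mart n k w) <=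
  C * (12 * expR (2^-1) * Num.sqrt (h n) ^+ 3).
Proof.
move=> kn.
have gg : grid t n k < grid t n k.+1 by rewrite gridS ltrDl h0.
have gh : grid t n k.+1 - grid t n k = h n by rewrite gridS addrC addKr.
have mZ : measurable_fun setT (fun w => W (grid t n k.+1) w - W (grid t n k) w).
  by apply: measurable_funB; exact: mW.
have ind (D : set T) (E : set R) : G (grid t n k) D -> measurable E ->
   P (D `&` (fun w => W (grid t n k.+1) w - W (grid t n k) w) @^-1` E) =
   (P D * normal_prob 0 (Num.sqrt (h n)) E)%E.
  by move=> GD mE; have := indep (g0 n k) gg GD mE; rewrite gh.
have sh0 : 0 < Num.sqrt (h n) by rewrite sqrtr_gt0.
have := conditional_step sh0 d1 d2 FB F2B F2C (sG (g0 n k)) (GT (g0 n k)) mZ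
  (XG (g0 n k)) (active_adapted n k) ind.
rewrite -/(Mart n k) => H.
rewrite RintegralZl//; last exact: bounded_integrable (mMart n k) (Mart_bound n k).
rewrite (le_trans (ler_norm _))// normrM -[leRHS]mul1r ler_pM//.
by rewrite ger0_norm ?expR_ge0// -[leRHS]expR0 ler_expR mulNr oppr_le0 mulr_ge0// ltW.
Qed.

Let mQ n : measurable_fun setT (Q n).
Proof.
apply: measurable_sum => k; apply: measurable_funM.
  apply: measurable_funM => //.
  exact: (measurable_indic (m_active n k)).
apply: measurable_funD; first apply: measurable_funB.
- by apply: measurable_funM => //; apply: measurableT_comp => //; exact: mX.
- apply: measurableT_comp => //; apply: measurable_funD; first exact: mX.
  by apply: measurable_funB; exact: mW.
- by apply: measurable_funM => //; apply: measurableT_comp => //; exact: mX.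
Qed.

Let Q_bounded n : exists M, forall w, `|Q n w| <= M.
Proof.
exists (\sum_(k < n.+1) (B + B + h n / 2 * B2)) => w.
rewrite (le_trans (ler_norm_sum _ _ _))//; apply: ler_sum => k _.
have e1 s : 0 <= s -> `|expR (- r * s)| <= 1.
  move=> s0; rewrite ger0_norm ?expR_ge0// -[leRHS]expR0 ler_expR mulNr oppr_le0.
  by rewrite mulr_ge0// ltW.
rewrite normrM -[leRHS]mul1r ler_pM//.
  rewrite normrM -[leRHS]mul1r ler_pM ?e1//.
  by case: (A n k w); rewrite ?normr0 ?normr1.
rewrite /path_summand (le_trans (ler_normD _ _))// lerD//; last first.
  by rewrite normrM ger0_norm ?ler_wpM2l ?divr_ge0// ltW.
rewrite (le_trans (ler_normB _ _))// lerD//.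
by rewrite normrM -[leRHS]mul1r ler_pM// e1// divr_ge0// ltW.
Qed.

Let b := gam * `|F1 0 - m| * J + `|Del| / 2 * eta + t * sig.

(** On a single path uniform continuity on [[0, t]] yields the modulus [om], and all vanishing
    errors together are at most [K * om]. *)
Let Q_le w : regular_path w ->
  (forall s : R, 0 <= s -> (s%:E <= tau w)%E -> `|X s w| <= N) ->
  forall e, 0 < e -> \forall n \near \oo, Q n w <= b + e.
Proof.
move=> [Xw0 Lw0 Lm Lf Lo] tN e e0.
pose K := gam * B1 + `|Del| / 2 / a + t * (r ^+ 2 * expR r * B + r * B1 + `|Del| / 2 / a ^+ 2)
  + gam * B2 * (2 + gam) * (J + 1).
have K0 : 0 <= K.
  have gg := ltW gam0; have rr := ltW r0; have tt := ltW t0; have aa := ltW a0.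
  rewrite /K; repeat first [done | exact: expR_ge0 | apply: addr_ge0
    | apply: mulr_ge0 | rewrite invr_ge0 | apply: exprn_ge0].
pose om := Num.min 1 (e / (K + 1)).
have om0 : 0 < om by rewrite lt_min ltr01/= divr_gt0// ltr_wpDl.
have [dX dX0 HX] := @heine R (X^~ w) 0 t (@Xc w) om om0.
have [dL dL0 HL] := @heine R (L^~ w) 0 t (@Lc w) om om0.
have dd0 : 0 < Num.min om (Num.min dX dL) by rewrite lt_min om0 lt_min dX0.
have small := @grid_small R t _ dd0.
near=> n.
have hn : h n <= Num.min om (Num.min dX dL).
  by rewrite (le_trans (ler_norm _))//; near: n.
have ho : h n <= om by rewrite (le_trans hn)// ge_min lexx.
have hX : h n <= dX by rewrite (le_trans hn)// !ge_min lexx orbT.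
have hL : h n <= dL by rewrite (le_trans hn)// !ge_min lexx !orbT.
have h1 : h n <= 1 by rewrite (le_trans ho)// ge_min lexx.
have om1 : om <= 1 by rewrite ge_min lexx.
have osc u v : 0 <= u <= t -> `|u - v| <= h n ->
    `|X u w - X v w| <= om /\ `|L u w - L v w| <= om.
  by move=> ut uv; split; [apply: HX|apply: HL] => //; exact: le_trans uv _.
have AJ k : (k < n.+1)%N -> A n k w ->
  [/\ L (grid t n k) w <= J, `|occ (X^~ w) (grid t n k) a - L (grid t n k) w| <= eta
    & `|X (grid t n k) w| <= N].
  move=> kn; rewrite /A inE => -[/= tk ok].
  by have [] := ok k (leqnn k); split=> //; exact: tN.
have := path_sum_le d1 d2 FB F1B F2B gam0 r0 (FS (n:=n) (w:=w)) (XE w) Lw0 Lm Lf a0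
  (ltW t0) J0 eta0 sig0 (@Xc w) (ltW om0) osc AJ F2ub Delm.
move=> /le_trans; apply; rewrite -/(h n) lerD2l.
have hn0 := ltW (h0 n).
have : K * om <= e.
  rewrite (@le_trans _ _ ((K + 1) * om))//; first by rewrite ler_wpM2r ?lerDl// ltW.
  by rewrite mulrC -ler_pdivlMr ?ltr_wpDl// ge_min lexx orbT.
apply: le_trans.
have e1 : h n * expR (r * h n) <= om * expR r.
  by rewrite ler_pM ?expR_ge0// ler_expR ler_piMr// ltW.
have E1 := ler_wpM2r B0 (ler_wpM2l (mulr_ge0 (ltW t0) (sqr_ge0 r)) e1).
have E2 : `|Del| / 2 * (h n / a) <= `|Del| / 2 * (om / a).
  by rewrite ler_wpM2l ?mulr_ge0// ler_wpM2r// invr_ge0 ltW.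
have E3 : gam * B2 * (2 + gam) * om * (J + om) <= gam * B2 * (2 + gam) * om * (J + 1).
  rewrite ler_wpM2l ?lerD2l// mulr_ge0 ?(ltW om0)//.
  by rewrite mulr_ge0 ?addr_ge0 ?mulr_ge0 ?(ltW gam0).
rewrite /K; move: (a ^- 2) (a^-1) `|Del| E1 E2 E3 => *; lra.
Unshelve. all: by end_near. Qed.

Let Qmax := gam * B1 * J + 2 * B + t * (r * B + B2 / 2).

Let Q_max w n : regular_path w -> Q n w <= Qmax.
Proof.
move=> [Xw0 Lw0 Lm Lf Lo].
apply: (path_sum_bound d1 FB F1B F2B gam0 r0 (FS (n:=n) (w:=w)) (XE w) Lw0 Lm
  (ltW t0) J0).
move=> k kn; rewrite /A inE => -[/= tk ok].
by have [] := ok k (leqnn k).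
Qed.

Let b0 : 0 <= b.
Proof. by rewrite /b !addr_ge0 ?mulr_ge0 ?(ltW gam0) ?(ltW t0). Qed.

(** A reverse Fatou argument: the bound on [Q n] from above is uniform in [n], the one from below is
    not. So the excess over [b], truncated to [[0, Qmax]], is sent to 0 by bounded convergence. *)
Let E_Q e : 0 < e -> \forall n \near \oo, \int[P]_w Q n w <= b + e.
Proof.
move=> e0.
have Qm0 : 0 <= Qmax.
  by rewrite /Qmax !addr_ge0 ?mulr_ge0 ?addr_ge0 ?mulr_ge0 ?(ltW gam0) ?(ltW t0) ?(ltW r0).
pose V n w := Num.min Qmax (Num.max 0 (Q n w - b)).
have mV n : measurable_fun setT (V n).
  apply: measurable_minr => //; apply: measurable_maxr => //.
  exact: measurable_funB.
have Vb n w : `|V n w| <= Qmax.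
  by rewrite ger0_norm ?ge_min ?lexx// le_min Qm0 le_max lexx.
have V0 : \int[P]_w V n w @[n --> \oo] --> \int[P]_w (0 : R).
  apply: (@E_cvg _ _ _ P V (fun=> 0) Qmax) => //.
  apply: filterS2 regular tauN => w rw tw.
  apply/cvgrPdist_le => /= e1 e10.
  apply: filterS (Q_le rw tw e10) => n Qn.
  rewrite sub0r normrN ger0_norm; last by rewrite le_min Qm0 le_max lexx.
  by rewrite /V ge_min ge_max (ltW e10)/= lerBlDl Qn orbT.
rewrite E_cst in V0.
have /cvgrPdist_le/(_ e e0) := V0; apply: filterS => n.
rewrite sub0r normrN => Ve.
have [M QM] := Q_bounded n.
apply: (@le_trans _ _ (\int[P]_w (b + V n w))).
  apply: (@E_le _ _ _ P _ _ (M + b + Qmax)) => //.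
  - exact: measurable_funD.
  - by move=> w; rewrite (le_trans (QM w))// -addrA lerDl addr_ge0.
  - move=> w; rewrite (le_trans (ler_normD _ _))// lerD// ger0_norm// lerDr.
    exact: le_trans (normr_ge0 _) (QM w).
  - apply: filterS regular => w rw; have Qm := Q_max n rw.
    rewrite -lerBlDl /V le_min le_max lexx orbT andbT.
    by rewrite lerBlDl (le_trans Qm)// lerDr.
rewrite RintegralD//; last 2 first.
- by apply: (@bounded_integrable _ _ _ P _ b) => // w; rewrite ger0_norm.
- exact: bounded_integrable (mV n) (Vb n).
by rewrite E_cst lerD2l (le_trans (ler_norm _)).
Qed.

Lemma E_localized e : 0 < e -> \forall n \near \oo, \int[P]_w S n w <= b + e.
Proof.
move=> e0.
have e2 : 0 < e / 2 by rewrite divr_gt0.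
have C0 : 0 <= C by have := le_trans (normr_ge0 _) (F2C 1 0); rewrite subr0 normr1 mulr1.
pose K := C * (12 * expR 2^-1) * t.
have K0 : 0 <= K by rewrite /K !mulr_ge0 ?expR_ge0// ltW.
(* A square, because the martingale part is controlled by the square root of the mesh. *)
have k0 : 0 < (e / 2 / (K + 1)) ^+ 2 by rewrite exprn_gt0// divr_gt0// ltr_wpDl.
have := E_Q e2; apply: filterS2 (@grid_small R t _ k0) => n hn Qn.
have [M QM] := Q_bounded n.
under eq_Rintegral do rewrite SE.
have iM k : P.-integrable setT (EFin \o (fun w => expR (- r * grid t n k) * Mart n k w)).
  apply: (@bounded_integrable _ _ _ P _ (expR (- r * grid t n k) * (B + B + h n / 2 * B2))).
    exact: measurable_funM.
  by move=> w; rewrite normrM ger0_norm ?expR_ge0// ler_wpM2l ?expR_ge0.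
have sumE (D : nat) : P.-integrable setT (EFin \o (fun w =>
     \sum_(k < D) expR (- r * grid t n k) * Mart n k w)) /\
   \int[P]_w (\sum_(k < D) expR (- r * grid t n k) * Mart n k w) =
   \sum_(k < D) \int[P]_w (expR (- r * grid t n k) * Mart n k w).
  elim: D => [|D [iD ED]].
    split.
      apply: (@bounded_integrable _ _ _ P _ 0); last by move=> w; rewrite big_ord0 normr0.
      by apply: measurable_sum => -[].
    under eq_Rintegral do rewrite big_ord0.
    by rewrite E_cst big_ord0.
  split.
    have -> : EFin \o (fun w => \sum_(k < D.+1) expR (- r * grid t n k) * Mart n k w) =
      EFin \o (fun w => \sum_(k < D) expR (- r * grid t n k) * Mart n k w +
         expR (- r * grid t n D) * Mart n D w).
      by apply/funext => w /=; rewrite big_ord_recr.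
    exact: (integrableD measurableT iD (iM D)).
  under eq_Rintegral do rewrite big_ord_recr/=.
  by rewrite RintegralD// ED big_ord_recr.
rewrite RintegralD//; last 2 first.
- exact: bounded_integrable (mQ n) QM.
- exact: (sumE n.+1).1.
rewrite (sumE n.+1).2 (splitr e) addrA lerD//.
apply: (@le_trans _ _ (\sum_(k < n.+1) C * (12 * expR (2^-1) * Num.sqrt (h n) ^+ 3))).
  by apply: ler_sum => k _; exact: E_Mart.
rewrite sumr_const card_ord.
have -> : C * (12 * expR (2^-1) * Num.sqrt (h n) ^+ 3) *+ n.+1 = K * Num.sqrt (h n).
  rewrite -[_ *+ n.+1]mulr_natr exprSr sqr_sqrtr ?(ltW (h0 n))// /K; set sq := Num.sqrt _.
  have : n.+1%:R != 0 :> R by rewrite pnatr_eq0.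
  by rewrite /h; move: (n.+1%:R) => q q0; field.
have sh : Num.sqrt (h n) <= e / 2 / (K + 1).
  rewrite -[leRHS]ger0_norm; last by rewrite ltW// divr_gt0// ltr_wpDl.
  by rewrite -sqrtr_sqr ler_wsqrtr// (le_trans (ler_norm _)).
rewrite (@le_trans _ _ ((K + 1) * Num.sqrt (h n)))//.
  by rewrite ler_wpM2r ?sqrtr_ge0// lerDl.
by rewrite mulrC -ler_pdivlMr// ltr_wpDl.
Qed.

End localized.

(** * Removing the truncation for bounded functions with a kink *)

Section excessive.
Context {R : realType} {d} {T : measurableType d} (P : probability T R).
Variables (X W L : R -> T -> R) (G : R -> set_system T) (x0 gam r : R).
Hypotheses (gam0 : 0 < gam) (r0 : 0 < r).
Hypothesis sG : forall s : R, 0 <= s -> sigma_algebra setT (G s).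
Hypothesis GT : forall s : R, 0 <= s -> G s `<=` measurable.
Hypothesis Gle : forall s t : R, 0 <= s -> s <= t -> G s `<=` G t.
Notation TG s := (g_sigma_algebraType (G s)).
Hypothesis Xc : forall w, continuous (X^~ w).
Hypothesis Lc : forall w, continuous (L^~ w).
Hypothesis XG : forall s : R, 0 <= s -> measurable_fun [set: TG s] (X s : TG s -> R).
Hypothesis WG : forall s : R, 0 <= s -> measurable_fun [set: TG s] (W s : TG s -> R).
Hypothesis LG : forall s : R, 0 <= s -> measurable_fun [set: TG s] (L s : TG s -> R).
Hypothesis XE : forall w (u v : R),
  X v w - X u w = W v w - W u w + gam * (L v w - L u w).
Hypothesis indep : forall (s t : R) (A : set T) (B : set R), 0 <= s -> s < t -> G s A -> measurable B ->
  P (A `&` (fun w => W t w - W s w) @^-1` B) =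
  (P A * normal_prob 0 (Num.sqrt (t - s)) B)%E.
Hypothesis regular : {ae P, forall w, regular_path X L x0 w}.

Variables (u : R -> R) (B K K1 N Del m : R) (tau : T -> \bar R).
Hypothesis uB : forall x, `|u x| <= B.
Hypothesis uK : forall x y, `|u x - u y| <= K * `|x - y|.
Hypothesis uS : forall x a : R, `|x| <= N -> 0 < a -> a < 1 ->
  sdiff u a x <= a ^+ 2 * (2 * r * u x + K1 * a) + Del * Num.max 0 (a - `|x|).
Hypothesis um : forall e : R, 0 < e -> exists2 d : R, 0 < d & forall z : R, 0 < z < d ->
     `|u z - u (- z) - 2 * m * z| <= e * z.
Hypothesis Delm : gam * m + Del / 2 = 0.
Hypothesis tauG : forall s : R, 0 <= s -> G s [set w | (s%:E <= tau w)%E].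
Hypothesis tau0 : forall w, (0 <= tau w)%E.
Hypothesis tauN : {ae P, forall w, forall s : R, 0 <= s -> (s%:E <= tau w)%E -> `|X s w| <= N}.

Let K0 : 0 <= K.
Proof. by have := le_trans (normr_ge0 _) (uK 1 0); rewrite subr0 normr1 mulr1. Qed.
Let B0 : 0 <= B. Proof. exact: le_trans (normr_ge0 _) (uB 0). Qed.

Notation D := (disc X r).

Definition stopped (t : R) (w : T) : R :=
  if tau w is s%:E then Num.min s t else t.

(** For bounded [u] the value 0 at [tau = +oo] is the limit of [exp(- r t) u(X_t)]. *)
Definition stopped_value (w : T) : R :=
  if tau w is s%:E then D u s w else 0.

Let uc : continuous u. Proof. exact: lipschitz_continuous uK. Qed.

Let mX s : 0 <= s -> measurable_fun setT (X s).
Proof. by move=> s0; exact: (adapted_measurable sG GT s0 (XG s0)). Qed.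
Let mL s : 0 <= s -> measurable_fun setT (L s).
Proof. by move=> s0; exact: (adapted_measurable sG GT s0 (LG s0)). Qed.

Let mD (v : R -> R) s : continuous v -> 0 <= s -> measurable_fun setT (D v s).
Proof.
move=> vc s0; apply: measurable_funM => //; apply: measurableT_comp; last exact: mX.
exact: continuous_measurable_fun.
Qed.

Let Dc (v : R -> R) w : continuous v -> continuous (fun s => D v s w).
Proof.
move=> vc s; rewrite /disc; apply: cvgM.
  apply: (@continuous_comp _ _ _ (fun s => - r * s) expR); last exact: continuous_expR.
  by apply: cvgM; [exact: cvg_cst|exact: cvg_id].
by apply: continuous_comp; [exact: Xc|exact: vc].
Qed.

Let D_bound (v : R -> R) s w (M : R) : (forall x, `|v x| <= M) -> 0 <= s ->
  `|D v s w| <= M.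
Proof.
move=> vM s0; rewrite normrM -[leRHS]mul1r ler_pM// ger0_norm ?expR_ge0//.
by rewrite -[leRHS]expR0 ler_expR mulNr oppr_le0 mulr_ge0// ltW.
Qed.

(** Telescoped, this is the discounted value at the first node after [tau], or at [t]. Whether to
    continue past a node is decided by the past of that node. *)
Definition running (t : R) (n : nat) (w : T) : R :=
  D u 0 w + \sum_(k < n.+1) \1_[set w | ((grid t n k)%:E <= tau w)%E] w *
    (D u (grid t n k.+1) w - D u (grid t n k) w).

Let before t n w k := w \in [set w | ((grid t n k)%:E <= tau w)%E].

Let beforeS t n w k : 0 <= t -> before t n w k.+1 -> before t n w k.
Proof.
move=> t0; rewrite /before !inE /=; apply: le_trans.
by rewrite lee_fin grid_le.
Qed.

Let running_cvg t w : 0 <= t -> running t n w @[n --> \oo] --> D u (stopped t w) w.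
Proof.
move=> t0; have Dcs := @Dc u w uc (stopped t w).
apply/cvgrPdist_le => /= e e0.
have /cvgrPdist_le/(_ e e0)[dl /= dl0 H] := Dcs.
have dl2 : 0 < dl / 2 by rewrite divr_gt0.
have := @grid_small R t _ dl2; apply: filterS => n hn.
have [j [jn Aj] E] := telescope_dec (fun k => D u (grid t n k) w) n.+1
  (fun k => @beforeS t n w k t0).
have -> : running t n w = D u (grid t n j) w.
  rewrite /running; under eq_bigr do rewrite indicE.
  by rewrite E grid0; ring.
apply: H => /=; rewrite (@le_lt_trans _ _ (dl / 2))//; last by rewrite ltr_pdivrMr// ltr_pMr// ltr1n.
apply: le_trans hn; rewrite [leRHS]ger0_norm ?divr_ge0//.
have j0 : (0 < j)%N.
  by have := Aj 0%N (ltn0Sn n) => <-; rewrite /before inE /= grid0.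
case: j j0 jn Aj E => // j _ jn Aj E.
have bj : ((grid t n j)%:E <= tau w)%E.
  by have := Aj j jn; rewrite ltnSn /before => /set_mem.
have st : grid t n j <= stopped t w <= grid t n j.+1.
  have gt k : (k <= n.+1)%N -> grid t n k <= t.
    by move=> kn; rewrite -[leRHS](gridn t n) grid_le.
  have [jn'|jn'] := leqP n.+1 j.+1.
    have jE : j = n by apply/eqP; rewrite eqn_leq -ltnS jn -ltnS jn'.
    rewrite jE in bj *; rewrite gridn /stopped; have gn := gt n (leqnSn n).
    case: (tau w) bj => [s| |]//=; last by rewrite lexx gn.
    by rewrite lee_fin le_min gn ge_min lexx orbT !andbT.
  have nb : ~~ before t n w j.+1 by rewrite Aj// ltnn.
  move: nb; rewrite /before notin_setE /= => /negP; rewrite -ltNge.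
  rewrite /stopped; case: (tau w) bj => [s| |]//=.
  have gj := gt j (ltnW jn).
  by rewrite lee_fin lte_fin le_min gj ge_min => -> /ltW ->.
have := gridS t n j; move: st => /andP[s1 s2] gg.
have tn : 0 <= t / n.+1%:R by rewrite divr_ge0.
by move: (t / _) gg tn => z gg tn; rewrite ler_norml; apply/andP; split; lra.
Qed.

Let stopped_ge0 t w : 0 <= t -> 0 <= stopped t w.
Proof.
move=> t0; rewrite /stopped; have := tau0 w; case: (tau w) => [s| |]//.
by rewrite lee_fin le_min => ->.
Qed.

Let running_bound t n w : 0 <= t -> `|running t n w| <= B.
Proof.
move=> t0.
have [j [jn Aj] E] := telescope_dec (fun k => D u (grid t n k) w) n.+1
  (fun k => @beforeS t n w k t0).
have -> : running t n w = D u (grid t n j) w.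
  rewrite /running; under eq_bigr do rewrite indicE.
  by rewrite E grid0; ring.
by apply: D_bound => //; exact: grid_ge0.
Qed.

Let running_measurable t n : 0 <= t -> measurable_fun setT (running t n).
Proof.
move=> t0; apply: measurable_funD; first exact: mD.
apply: measurable_sum => k; apply: measurable_funM.
  apply: measurable_indic; apply: (GT (grid_ge0 n k t0)).
  by apply: tauG; exact: grid_ge0.
by apply: measurable_funB; apply: mD => //; exact: grid_ge0.
Qed.

Let stopped_measurable t : 0 <= t -> measurable_fun setT (fun w => D u (stopped t w) w).
Proof.
move=> t0; apply: (@measurable_realfun.measurable_fun_cvg _ T R setT (running t)).
  by move=> n; exact: running_measurable.
by move=> w _; exact: running_cvg.
Qed.

Let aj (j : nat) : R := j.+1%:R^-1.
Let aj0 j : 0 < aj j. Proof. by rewrite invr_gt0 ltr0n. Qed.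

(** Rational times make this a countable intersection, hence measurable. Grids with an integer
    horizon have rational nodes, so on a tame path the truncation by [ok_at] at a scale [j >= J]
    never acts, whatever the mesh. *)
Definition tame (t : R) (J : nat) (eta : R) : set T :=
  [set w | forall q : rat, 0 <= (ratr q : R) <= t -> L (ratr q) w <= J%:R /\
    forall j, (J <= j)%N -> `|occ (X^~ w) (ratr q) (aj j) - L (ratr q) w| <= eta].

Let tame_measurable t J eta : measurable (tame t J eta).
Proof.
pose Fq (q : rat) : set T := if 0 <= (ratr q : R) <= t then
  [set w | L (ratr q) w <= J%:R] `&` \bigcap_(j in [set j | (J <= j)%N])
    [set w | `|occ (X^~ w) (ratr q) (aj j) - L (ratr q) w| <= eta] else setT.
have -> : tame t J eta = ~` \bigcup_q ~` Fq q.
  rewrite setC_bigcup; apply/seteqP; split => w /=.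
    move=> H q _; rewrite setCK /Fq; case: ifP => // qt.
    by have [H1 H2] := H q qt; split.
  move=> H q qt; have := H q I; rewrite setCK /Fq qt => -[H1 H2].
  by split => // j Jj; exact: H2.
apply: measurableC; apply: bigcupT_measurable_rat => q; apply: measurableC.
rewrite /Fq; case: ifP => // /andP[q0 qt].
apply: measurableI.
  by rewrite -[X in measurable X]setTI; apply: measurable_fun_le => //; exact: mL.
apply: bigcap_measurableType => j _.
rewrite -[X in measurable X]setTI; apply: measurable_fun_le => //.
apply: measurableT_comp => //; apply: measurable_funB; last exact: mL.
exact: (adapted_measurable sG GT q0 (occ_adapted sG Gle Xc XG q0 (aj0 j))).
Qed.

Let grid_rat (k n i : nat) : exists q : rat, (ratr q : R) = grid (k%:R : R) n i.
Proof.
exists (k%:R * i%:R / n.+1%:R).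
by rewrite /grid !rmorphM/= fmorphV/= !ratr_nat.
Qed.

Variables (U1 U : R -> R).
Hypothesis U1d : forall x, is_derive x (1 : R) U1 (u x).
Hypothesis Ud : forall x, is_derive x (1 : R) U (U1 x).

Let F j := moll U (aj j).
Let F1 j := moll1 U1 (aj j).
Let F2 j := moll2 u (aj j).
Let sig j := r * K * aj j + K1 * aj j / 2.

Hypothesis K10 : 0 <= K1.

(** [2 * sig j] collects [K1 * a] from the second difference and [2 * r * K * a] from replacing [u]
    by its mollification; [0 < j] ensures a scale below 1. *)
Let F2ub j p : (0 < j)%N -> `|p| <= N ->
  F2 j p <= 2 * r * F j p + Del * tri (aj j) p + 2 * sig j.
Proof.
move=> j0 pN.
have a1 : aj j < 1 by rewrite invf_lt1 ?ltr0n// ltr1n ltnS.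
have H := uS pN (aj0 j) a1.
have H1 : F2 j p <= 2 * r * u p + K1 * aj j + Del * tri (aj j) p.
  rewrite /F2 /moll2 ler_pdivrMr ?exprn_gt0// (le_trans H)// /tri.
  rewrite [leRHS]mulrDl lerD//; first by rewrite mulrC.
  by rewrite -mulrA divfK// gt_eqF// exprn_gt0.
rewrite (le_trans H1)//.
have := moll_close U1d Ud uK p (aj0 j).
rewrite ler_norml => /andP[+ _] => /(ler_wpM2l (ltW r0)).
rewrite /F /sig; move: (moll _ _ _) => *; lra.
Qed.

(** On a tame path both telescoped sums stop at the same index and differ by [K * aj j] at each end;
    on any other path each of the two increments is at most [2 * B]. *)
Let pathwise t n w J j eta : 0 <= t -> (J <= j)%N ->
  (exists k : nat, t = k%:R) -> regular_path X L x0 w ->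
  running t n w <= u x0 + \sum_(k < n.+1) \1_(active X L tau t J%:R eta (aj j) n k) w *
      (D (F j) (grid t n k.+1) w - D (F j) (grid t n k) w)
    + 2 * K * aj j + 4 * B * \1_(~` tame t J eta) w.
Proof.
move=> t0 Jj [tk tE] [Xw0 _ _ _ _].
have [i [iN Ai] E] := telescope_dec (fun k => D u (grid t n k) w) n.+1
  (fun k => @beforeS t n w k t0).
have AS k : w \in active X L tau t J%:R eta (aj j) n k.+1 ->
    w \in active X L tau t J%:R eta (aj j) n k.
  rewrite !inE => -[/= tk1 ok]; split => /=.
    by apply: le_trans tk1; rewrite lee_fin grid_le.
  by move=> l /= lk; apply: ok; rewrite /= leqW.
have [i' [iN' Ai'] E'] := telescope_dec (fun k => D (F j) (grid t n k) w) n.+1 AS.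
have -> : running t n w = u x0 + (D u (grid t n i) w - D u (grid t n 0) w).
  rewrite /running; under eq_bigr do rewrite indicE.
  by rewrite E /D mulr0 expR0 mul1r Xw0.
under eq_bigr do rewrite indicE.
rewrite E' -!addrA lerD2l !addrA.
have gi k := @grid_ge0 R t n k t0.
have FB x : `|F j x| <= B by exact: (moll_bound U1d Ud uB).
have close k : `|D u (grid t n k) w - D (F j) (grid t n k) w| <= K * aj j.
  rewrite /D -mulrBr normrM -[leRHS]mul1r ler_pM//.
    rewrite ger0_norm ?expR_ge0// -[leRHS]expR0 ler_expR mulNr oppr_le0.
    by rewrite mulr_ge0// ltW.
  by rewrite distrC; exact: (moll_close U1d Ud uK).
rewrite indicE; have [wt|wt] := boolP (w \in ~` tame t J eta).
  rewrite mulr1.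
  have := D_bound w uB (gi i); have := D_bound w uB (gi 0%N).
  have := D_bound w FB (gi i'); have := D_bound w FB (gi 0%N).
  have : 0 <= 2 * K * aj j by rewrite !mulr_ge0// ltW.
  rewrite !ler_norml => ? /andP[? ?] /andP[? ?] /andP[? ?] /andP[? ?]; lra.
rewrite mulr0 addr0.
have {}wt : tame t J eta w by move: wt; rewrite notin_setE /= => /contrapT.
have same k : (k < n.+1)%N -> before t n w k = (w \in active X L tau t J%:R eta (aj j) n k).
  move=> kn; apply/idP/idP; rewrite /before !inE => //; last by case.
  move=> gk; split => // l /= lk.
  have [q qE] := grid_rat tk n l; rewrite -tE in qE.
  have [|H1 H2] := wt q.
    by rewrite qE gi/= -[leRHS](gridn t n) grid_le// ltnW// (leq_ltn_trans lk).
  by rewrite qE in H1 H2; split => //; exact: H2.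
have ii : i = i'.
  apply/eqP; rewrite eqn_leq; apply/andP; split; rewrite leqNgt; apply/negP => lt.
    have kn : (i' < n.+1)%N := leq_trans lt iN.
    by have := Ai _ kn; rewrite lt same// Ai'// ltnn.
  have kn : (i < n.+1)%N := leq_trans lt iN'.
  by have := Ai' _ kn; rewrite lt -same// Ai// ltnn.
rewrite -ii; have := close i; have := close 0%N.
by rewrite !ler_norml => /andP[? ?] /andP[? ?]; lra.
Qed.

Let F1B j x : `|F1 j x| <= 2 * B / aj j.
Proof. exact: (moll1_bound U1d uB). Qed.

Let pay t : R := \int[P]_w D u (stopped t w) w.

Let bad t J eta : R := \int[P]_w \1_(~` tame t J eta) w.

Let indic_measurable t J eta :
  measurable_fun setT (\1_(~` tame t J eta) : T -> R).
Proof. by apply: measurable_indic; apply: measurableC; exact: tame_measurable. Qed.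

(** The mesh limit has been taken; [J], [j] and [eta] are still free. *)
Let E_stopped_localized t J j eta : 0 < t -> (exists k : nat, t = k%:R) ->
  (J <= j)%N -> (0 < j)%N -> 0 <= eta ->
  pay t <= u x0 + (gam * `|F1 j 0 - m| * J%:R + `|Del| / 2 * eta + t * sig j)
    + 2 * K * aj j + 4 * B * bad t J eta.
Proof.
move=> t0 tk Jj j0 eta0; apply/ler_addgt0Pr => e e0.
have e2 : 0 < e / 2 by rewrite divr_gt0.
have sig0 : 0 <= sig j.
  have := ltW (aj0 j) => aj00.
  by rewrite /sig addr_ge0// ?divr_ge0// !mulr_ge0// ltW.
have FB x : `|F j x| <= B by exact: (moll_bound U1d Ud uB).
have F2B x : `|F2 j x| <= 4 * B / aj j ^+ 2 by exact: (moll2_bound uB).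
have F2C x y : `|F2 j x - F2 j y| <= 4 * K / aj j ^+ 2 * `|x - y|.
  exact: (moll2_lipschitz uK).
have dF1 x : is_derive x (1 : R) (F j) (F1 j x) by exact: is_derive_moll.
have dF2 x : is_derive x (1 : R) (F1 j) (F2 j x) by exact: is_derive_moll1.
have H := E_localized gam0 r0 sG GT Gle Xc Lc XG WG LG XE indep regular
  dF1 dF2 FB (@F1B j) F2B F2C tauG t0 (ler0n _ J) eta0 (aj0 j) sig0 tauN
  (fun p pN => F2ub j0 pN) Delm e2.
have cv : \int[P]_w running t n w @[n --> \oo] --> pay t.
  apply: (@E_cvg _ _ _ P (running t) _ B).
  - by move=> n; apply: running_measurable; exact: ltW.
  - by apply: stopped_measurable; exact: ltW.
  - by move=> n w; apply: running_bound; exact: ltW.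
  - by apply: aeW => w; apply: running_cvg; exact: ltW.
have /cvgrPdist_le/(_ _ e2) cv2 := cv.
have [n [Hn cn]] := filter_ex (filterI H cv2).
set b := (gam * _ * _ + _ + _) in Hn *.
pose Sn w := \sum_(k < n.+1) \1_(active X L tau t J%:R eta (aj j) n k) w *
      (D (F j) (grid t n k.+1) w - D (F j) (grid t n k) w).
have gi k := @grid_ge0 R t n k (ltW t0).
have Fc : continuous (F j) by exact: is_derive_continuous dF1.
have mS : measurable_fun setT Sn.
  apply: measurable_sum => k; apply: measurable_funM.
    apply: measurable_indic; apply: (GT (gi k)).
    exact: (active_adapted sG Gle Xc XG LG _ _ tauG t0 (aj0 j)).
  by apply: measurable_funB; apply: mD.
have Sb w : `|Sn w| <= \sum_(k < n.+1) (B + B).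
  rewrite (le_trans (ler_norm_sum _ _ _))//; apply: ler_sum => k _.
  rewrite normrM -[leRHS]mul1r ler_pM ?indic_bound//.
  by rewrite (le_trans (ler_normB _ _))// lerD// D_bound.
pose M := \sum_(k < n.+1) (B + B).
have M0 : 0 <= M by apply: sumr_ge0 => k _; exact: addr_ge0.
have c0 : 0 <= 2 * K * aj j by rewrite !mulr_ge0// ltW.
pose Z w := u x0 + Sn w + 2 * K * aj j + 4 * B * \1_(~` tame t J eta) w.
have mI := indic_measurable t J eta.
have mZ : measurable_fun setT Z.
  by apply: measurable_funD; [apply: measurable_funD => //; exact: measurable_funD|exact: measurable_funM].
have ub w : `|4 * B * \1_(~` tame t J eta) w| <= 4 * B.
  by rewrite normrM ger0_norm ?mulr_ge0// ler_piMr ?mulr_ge0// indic_bound.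
have Zb w : `|Z w| <= B + M + 2 * K * aj j + 4 * B.
  rewrite (le_trans (ler_normD _ _))// lerD//.
  rewrite (le_trans (ler_normD _ _))// lerD//; last by rewrite ger0_norm.
  by rewrite (le_trans (ler_normD _ _))// lerD.
have HE : \int[P]_w running t n w <= \int[P]_w Z w.
  apply: (@E_le _ _ _ P _ _ (B + M + 2 * K * aj j + 4 * B)) => //.
  - by apply: running_measurable; exact: ltW.
  - move=> w; rewrite (le_trans (running_bound _ _ (ltW t0)))// -!addrA lerDl.
    by rewrite !addr_ge0// mulr_ge0.
  - apply: filterS regular => w rw.
    by apply: pathwise => //; exact: ltW.
have iS : P.-integrable setT (EFin \o Sn) by exact: bounded_integrable mS Sb.
have i1 : P.-integrable setT (EFin \o (fun w => u x0 + Sn w)).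
  apply: (@bounded_integrable _ _ _ P _ (B + M)); first exact: measurable_funD.
  by move=> w; rewrite (le_trans (ler_normD _ _))// lerD.
have i2 : P.-integrable setT (EFin \o (fun w => u x0 + Sn w + 2 * K * aj j)).
  apply: (@bounded_integrable _ _ _ P _ (B + M + 2 * K * aj j)).
    by apply: measurable_funD => //; exact: measurable_funD.
  move=> w; rewrite (le_trans (ler_normD _ _))// lerD//; last by rewrite ger0_norm.
  by rewrite (le_trans (ler_normD _ _))// lerD.
have i3 : P.-integrable setT (EFin \o (fun w => 4 * B * \1_(~` tame t J eta) w)).
  by apply: bounded_integrable ub; exact: measurable_funM.
have i4 : P.-integrable setT (EFin \o (\1_(~` tame t J eta) : T -> R)).
  by apply: bounded_integrable mI (indic_bound _).
have ic c : P.-integrable setT (EFin \o (fun=> c : R)).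
  exact: (@bounded_integrable _ _ _ P _ `|c|).
have ZE : \int[P]_w Z w = u x0 + \int[P]_w Sn w + 2 * K * aj j + 4 * B * bad t J eta.
  by rewrite RintegralD// RintegralD// RintegralD// !E_cst RintegralZl.
move: cn; rewrite ler_norml => /andP[_ cn].
rewrite ZE in HE.
have {}Hn : \int[P]_w Sn w <= b + e / 2 by exact: Hn.
move: cn HE Hn; lra.
Qed.

(** Every regular path is tame for all large [J]: the occupation functionals are monotone in time
    with a continuous limit, so they converge uniformly on [[0, t]]. *)
Let bad_cvg t eta : 0 <= t -> 0 < eta -> bad t J eta @[J --> \oo] --> (0 : R).
Proof.
move=> t0 eta0; rewrite -(E_cst P 0).
apply: (@E_cvg _ _ _ P _ _ 1) => //; first by move=> n w; exact: indic_bound.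
apply: filterS regular => w [_ _ Lm _ Lo].
have DN := @dini R (L^~ w) (fun j s => occ (X^~ w) s (aj j)) t t0 (@Lc w) _ _ _ _ eta0.
have {DN}[|||J1 _ HJ] := DN _.
- by move=> p q p0 pq _; exact: Lm.
- move=> j p q p0 pq _.
  by have /andP[] := occ_le (@Xc w) (aj0 j) p0 pq.
- move=> s /andP[s0 st]; apply/cvgrPdist_le => /= e e0.
  have [dl dl0 H] := Lo s s0 e e0.
  have := @grid_small R 1 (dl / 2) _; rewrite divr_gt0// => /(_ isT).
  apply: filterS => n; rewrite div1r ger0_norm ?invr_ge0// => ndl.
  rewrite distrC; apply: H; rewrite aj0/= (le_lt_trans ndl)//.
  by rewrite ltr_pdivrMr// ltr_pMr// ltr1n.
have [J2 HJ2] : exists J2 : nat, L t w <= J2%:R.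
  by exists (Num.truncn (L t w)).+1; rewrite ltW// truncnS_gt.
apply/cvgrPdist_le => /= e e0; near=> J.
rewrite sub0r normrN indicE memNset ?normr0 ?(ltW e0)//= => -[].
move=> q /andP[q0 qt]; split.
  rewrite (le_trans (Lm _ _ q0 qt))// (le_trans HJ2)// ler_nat.
  by near: J; exists J2.
move=> j Jj; apply: HJ => /=; last by rewrite q0.
by rewrite (leq_trans _ Jj)//; near: J; exists J1.
Unshelve. all: by end_near. Qed.

(** Order of choices: [eta], then [J] to make bad paths rare, then the scale [j], because
    [|F1 j 0 - m|] must be small compared with [1 / J]. Four errors get [e / 4] each. *)
Let E_stopped t : 0 < t -> (exists k : nat, t = k%:R) -> pay t <= u x0.
Proof.
move=> t0 tk; apply/ler_addgt0Pr => e e0.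
pose eta := e / 4 / (`|Del| + 1).
have D1 : 0 < `|Del| + 1 by rewrite ltr_wpDl.
have eta0 : 0 < eta by rewrite !divr_gt0.
have ebad : 0 < e / 4 / (4 * B + 1).
  by rewrite !divr_gt0// ltr_wpDl// mulr_ge0.
have /cvgrPdist_le/(_ _ ebad)[J _ HJ] := bad_cvg (ltW t0) eta0.
have {HJ} := HJ J (leqnn J); rewrite /= sub0r normrN => HJ.
have em : 0 < e / 4 / (gam * J%:R + 1).
  by rewrite !divr_gt0// ltr_wpDl// mulr_ge0// ltW.
have [dl dl0 Hdl] := moll1_cvg0 U1d um em.
pose c := t * (r * K + K1 / 2) + 2 * K.
have c0 : 0 <= c.
  by rewrite /c !addr_ge0 ?mulr_ge0 ?addr_ge0 ?mulr_ge0 ?divr_ge0 ?(ltW t0) ?(ltW r0).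
have eaj : 0 < Num.min (dl / 2) (e / 4 / (c + 1)).
  by rewrite lt_min !divr_gt0// ltr_wpDl.
have [j0 _ Hj0] := @grid_small R 1 _ eaj.
pose j := maxn (maxn J 1) j0.
have Jj : (J <= j)%N by rewrite /j !leq_max leqnn.
have j1 : (0 < j)%N by rewrite /j !leq_max leqnn orbT.
have ajle : aj j <= Num.min (dl / 2) (e / 4 / (c + 1)).
  have := Hj0 j; rewrite /= /j leq_maxr => /(_ isT).
  by rewrite div1r ger0_norm ?invr_ge0.
have H1 := E_stopped_localized t0 tk Jj j1 (ltW eta0).
have T1 : gam * `|F1 j 0 - m| * J%:R <= e / 4.
  have ajd : 0 < aj j < dl.
    rewrite aj0/= (le_lt_trans ajle)// gt_min ltr_pdivrMr// ltr_pMr// ltr1n//.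
  have Hm := Hdl _ ajd.
  rewrite mulrAC.
  have gJ : 0 <= gam * J%:R by rewrite mulr_ge0// ltW.
  rewrite (le_trans (ler_wpM2l gJ Hm))//.
  rewrite mulrA ler_pdivrMr ?ltr_wpDl// mulrC ler_wpM2l ?lerDl//.
  by rewrite divr_ge0// ltW.
have T2 : `|Del| / 2 * eta <= e / 4.
  have De : `|Del| * eta <= e / 4.
    rewrite /eta mulrA ler_pdivrMr// mulrC ler_wpM2l ?lerDl//.
    by rewrite divr_ge0// ltW.
  have := mulr_ge0 (normr_ge0 Del) (ltW eta0); lra.
have T3 : t * sig j + 2 * K * aj j <= e / 4.
  have -> : t * sig j + 2 * K * aj j = c * aj j by rewrite /sig /c; ring.
  have H2 : aj j <= e / 4 / (c + 1) by rewrite (le_trans ajle)// ge_min lexx orbT.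
  rewrite (le_trans (ler_wpM2l c0 H2))// mulrA ler_pdivrMr ?ltr_wpDl//.
  by rewrite mulrC ler_wpM2l ?lerDl// divr_ge0// ltW.
have T4 : 4 * B * bad t J eta <= e / 4.
  have B4 : 0 <= 4 * B by rewrite mulr_ge0.
  rewrite (le_trans (ler_wpM2l B4 (le_trans (ler_norm _) HJ)))//.
  rewrite mulrA ler_pdivrMr ?ltr_wpDl// mulrC ler_wpM2l ?lerDl//.
  by rewrite divr_ge0// ltW.
move: H1 T1 T2 T3 T4; lra.
Qed.

Let stopped_value_cvg w : D u (stopped n.+1%:R w) w @[n --> \oo] --> stopped_value w.
Proof.
rewrite /stopped_value /stopped; have := tau0 w.
case: (tau w) => [s| |]//; last first.
  move=> _; apply/cvgrPdist_le => /= e e0.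
  have kk : 0 < r * (e / (B + 1)) by rewrite mulr_gt0// divr_gt0// ltr_wpDl.
  apply: filterS (@grid_small R 1 _ kk) => n.
  rewrite div1r ger0_norm ?invr_ge0// => nk.
  rewrite sub0r normrN /disc normrM ger0_norm ?expR_ge0//.
  have H1 : expR (- r * n.+1%:R) <= e / (B + 1).
    rewrite mulNr expRN; have := expR_ge1Dx (r * n.+1%:R).
    have rn : 0 < r * n.+1%:R by rewrite mulr_gt0// ltr0n.
    move=> H; rewrite (@le_trans _ _ (r * n.+1%:R)^-1)//.
      by rewrite lef_pV2 ?posrE ?expR_gt0// (le_trans _ H)// lerDr.
    by rewrite invfM -ler_pdivlMl ?invr_gt0// invrK.
  rewrite (@le_trans _ _ (e / (B + 1) * (B + 1)))//.
    by rewrite ler_pM ?expR_ge0// (le_trans (uB _))// lerDl.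
  by rewrite divfK// gt_eqF// ltr_wpDl.
rewrite lee_fin => s0; apply: cvg_near_cst; near=> n.
rewrite min_l// ltW// (lt_le_trans (truncnS_gt s))// ler_nat ltnS.
by near: n; exists (Num.truncn s).
Unshelve. all: by end_near. Qed.

Lemma stopped_value_bound w : `|stopped_value w| <= B.
Proof.
rewrite /stopped_value; have := tau0 w; case: (tau w) => [s| |]; rewrite ?normr0//.
by rewrite lee_fin => s0; exact: D_bound.
Qed.

Lemma stopped_value_measurable : measurable_fun setT stopped_value.
Proof.
apply: (@measurable_realfun.measurable_fun_cvg _ T R setT
  (fun n w => D u (stopped n.+1%:R w) w)).
  by move=> n; exact: stopped_measurable.
by move=> w _; exact: stopped_value_cvg.
Qed.

Theorem excessive_bounded : \int[P]_w stopped_value w <= u x0.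
Proof.
have cv : pay n.+1%:R @[n --> \oo] --> \int[P]_w stopped_value w.
  apply: (@E_cvg _ _ _ P _ _ B).
  - by move=> n; exact: stopped_measurable.
  - exact: stopped_value_measurable.
  - by move=> n w; apply: D_bound => //; exact: stopped_ge0.
  - by apply: aeW => w; exact: stopped_value_cvg.
rewrite -(cvg_lim _ cv)//; apply: limr_le; first by apply/cvg_ex; eexists; exact: cv.
by apply: nearW => n; apply: E_stopped; [rewrite ltr0n|exists n.+1].
Qed.

End excessive.

(** * Supersolutions with a kink at the origin *)

Record sbm_system {R : realType} {d} {T : measurableType d} (P : probability T R)
    (X W L : R -> T -> R) (G : R -> set_system T) (x0 gam : R) : Prop := SbmSystem {
  sbm_gam : 0 < gam;
  sbm_sigma : forall s, 0 <= s -> sigma_algebra setT (G s);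
  sbm_sub : forall s, 0 <= s -> G s `<=` measurable;
  sbm_mono : forall s t, 0 <= s -> s <= t -> G s `<=` G t;
  sbm_Xc : forall w, continuous (X^~ w);
  sbm_Lc : forall w, continuous (L^~ w);
  sbm_X : forall s, 0 <= s ->
    measurable_fun [set: g_sigma_algebraType (G s)] (X s : g_sigma_algebraType (G s) -> R);
  sbm_W : forall s, 0 <= s ->
    measurable_fun [set: g_sigma_algebraType (G s)] (W s : g_sigma_algebraType (G s) -> R);
  sbm_L : forall s, 0 <= s ->
    measurable_fun [set: g_sigma_algebraType (G s)] (L s : g_sigma_algebraType (G s) -> R);
  sbm_eq : forall w (u v : R),
    X v w - X u w = W v w - W u w + gam * (L v w - L u w);
  sbm_indep : forall (s t : R) (A : set T) (B : set R), 0 <= s -> s < t -> G s A ->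
    measurable B -> P (A `&` (fun w => W t w - W s w) @^-1` B) =
      (P A * normal_prob 0 (Num.sqrt (t - s)) B)%E;
  sbm_regular : {ae P, forall w, regular_path X L x0 w} }.

Definition clamp {R : realType} (c x : R) : R := Num.max (- c) (Num.min x c).

(* [v] is a supersolution of [v''/2 = r v] off the origin, with slope jump [Del]
   there: [dw] is the derivative of [v] with its kink removed. *)
Definition supersolution {R : realType} (r Del : R) (v dw : R -> R) : Prop :=
  (forall x, is_derive x (1 : R) (fun x => v x - Del / 2 * `|x|) (dw x)) /\
  (forall q p S, q <= p -> (forall s, q <= s <= p -> v s <= S) ->
     dw p - dw q <= (p - q) * (2 * r * S)).

Section clamp.
Context {R : realType}.
Variables (r Del N : R) (v dw : R -> R).
Hypotheses (r0 : 0 < r) (N0 : 0 <= N) (vS : supersolution r Del v dw).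
(** The margin 1 ensures that second differences of step [a < 1] at [|x| <= N] see only [v]. *)
Let c := N + 1.
Let c0 : 0 < c. Proof. by rewrite /c ltr_wpDl. Qed.
Let w x := v x - Del / 2 * `|x|.
Let wd x : is_derive x (1 : R) w (dw x). Proof. exact: (vS.1 x). Qed.
Let u x := v (clamp c x).

Lemma clamp_id (x : R) : `|x| <= c -> clamp c x = x.
Proof.
by rewrite ler_norml /clamp => /andP[x1 x2]; rewrite (min_l x2) max_r.
Qed.

Lemma clamp_bound (x : R) : `|clamp c x| <= c.
Proof.
rewrite ler_norml /clamp le_max lexx/= ge_max ge_min lexx orbT andbT.
by rewrite (le_trans _ (ltW c0))// oppr_le0 ltW.
Qed.

Lemma clamp_lip (x y : R) : `|clamp c x - clamp c y| <= `|x - y|.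
Proof.
have maxE (k p : R) : Num.max k p = k + Num.max 0 (p - k).
  by rewrite /Num.max; case: ltP => ?; case: ltP => ?; lra.
have minE (k p : R) : Num.min p k = k - Num.max 0 (k - p).
  by rewrite /Num.max /Num.min; case: ltP => ?; case: ltP => ?; lra.
have eD (k a b : R) : k + a - (k + b) = a - b by ring.
have eB (k a b : R) : k - a - (k - b) = b - a by ring.
rewrite /clamp (maxE _ (Num.min x c)) (maxE _ (Num.min y c)) eD.
rewrite (le_trans (max0_lip _ _))//.
have -> : Num.min x c - - c - (Num.min y c - - c) = Num.min x c - Num.min y c by ring.
by rewrite !minE eB (le_trans (max0_lip _ _))// eB.
Qed.

Lemma supersolution_continuous : continuous v.
Proof.
have -> : v = fun x => w x + Del / 2 * `|x| by apply/funext => x; rewrite /w subrK.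
move=> x; apply: cvgD; first exact: (is_derive_continuous wd).
by apply: cvgM; [exact: cvg_cst|exact: cvg_norm].
Qed.

Lemma supersolution_bounded : exists2 B, 0 <= B & forall x, `|x| <= c -> `|v x| <= B.
Proof.
have vc : {within `[- c, c], continuous (fun x => `|v x|)}.
  apply: continuous_subspaceT => x; apply: continuous_comp.
    exact: supersolution_continuous.
  exact: norm_continuous.
have cc : - c <= c by rewrite (le_trans _ (ltW c0))// oppr_le0 ltW.
have [z _ zmax] := EVT_max cc vc.
exists `|v z| => // x xc; apply: zmax; rewrite in_itv/= -ler_norml//.
Qed.

(** Increments of [dw] are bounded from above only; comparison with the left end [- c] bounds [dw]
    from above, comparison with the right end [c] from below. *)
Lemma supersolution_lipschitz : exists K, forall x y, `|x| <= c -> `|y| <= c ->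
  `|v x - v y| <= K * `|x - y|.
Proof.
have [B B0 vB] := supersolution_bounded.
have vub x : - c <= x <= c -> v x <= B.
  by rewrite -ler_norml => /vB; apply: le_trans; exact: ler_norm.
pose M := 2 * c * (2 * r * B) + `|dw c| + `|dw (- c)|.
have B2 : 0 <= 2 * r * B by rewrite !mulr_ge0// ltW.
have dwM x : - c <= x <= c -> `|dw x| <= M.
  move=> /andP[x1 x2].
  have H1 := vS.2 (- c) x B x1 _; have {}H1 := H1 _.
  have H2 := vS.2 x c B x2 _; have {}H2 := H2 _.
  have {}H1 : dw x - dw (- c) <= (x - - c) * (2 * r * B).
    by apply: H1 => s /andP[s1 s2]; apply: vub; rewrite s1 (le_trans s2).
  have {}H2 : dw c - dw x <= (c - x) * (2 * r * B).
    by apply: H2 => s /andP[s1 s2]; apply: vub; rewrite s2 (le_trans _ s1).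
  have H3 : (x - - c) * (2 * r * B) <= 2 * c * (2 * r * B).
    by rewrite ler_wpM2r//; lra.
  have H4 : (c - x) * (2 * r * B) <= 2 * c * (2 * r * B).
    by rewrite ler_wpM2r//; lra.
  have := ler_norm (dw (- c)); have := ler_norm (- dw c); rewrite normrN.
  have := normr_ge0 (dw (- c)); have := normr_ge0 (dw c).
  by rewrite ler_norml /M => *; apply/andP; split; lra.
exists (M + `|Del| / 2) => x y; rewrite !ler_norml => xc yc.
have -> : v x - v y = (w x - w y) + Del / 2 * (`|x| - `|y|) by rewrite /w; ring.
rewrite mulrDl -ler_norml (le_trans (ler_normD _ _))// lerD//.
  have E a b : - c <= a <= c -> - c <= b <= c -> a <= b -> `|w b - w a| <= M * `|b - a|.
    move=> /andP[a1 a2] /andP[b1 b2] ab.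
    have [e /andP[e1 e2] ->] := MVT_le wd ab; rewrite normrM ler_wpM2r// dwM//.
    by rewrite (le_trans a1)// (le_trans e2).
  have [xy|/ltW yx] := leP x y; last exact: E.
  by rewrite distrC [`|x - y|]distrC; exact: E.
rewrite !normrM (@gtr0_norm _ 2^-1) ?invr_gt0//.
by rewrite ler_wpM2l ?mulr_ge0// ler_dist_dist.
Qed.

Lemma sdiff_norm (a x : R) : 0 < a -> sdiff (fun y : R => `|y|) a x = 2 * Num.max 0 (a - `|x|).
Proof.
move=> a0; rewrite /sdiff.
have [x0|x0] := leP 0 x.
  rewrite (@ger0_norm _ (x + a)) ?addr_ge0 ?(ltW a0)// (ger0_norm x0).
  have [xa|xa] := leP a x.
    by rewrite ger0_norm ?subr_ge0// max_l ?subr_le0//; lra.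
  by rewrite ltr0_norm ?subr_lt0// max_r ?subr_ge0 ?(ltW xa)//; lra.
rewrite (@ltr0_norm _ (x - a)); last by rewrite subr_lt0 (lt_trans x0).
rewrite (ltr0_norm x0).
have [xa|xa] := leP 0 (x + a).
  rewrite (ger0_norm xa) max_r; lra.
rewrite (ltr0_norm xa) max_l; lra.
Qed.

(** [K * a] pays for the oscillation of [v] on [[x - a, x + a]]; the kink contributes its second
    difference exactly. *)
Lemma clamp_sdiff K x a : (forall x y, `|x| <= c -> `|y| <= c ->
    `|v x - v y| <= K * `|x - y|) -> `|x| <= N -> 0 < a -> a < 1 ->
  sdiff u a x <= a ^+ 2 * (2 * r * u x + 2 * r * K * a) + Del * Num.max 0 (a - `|x|).
Proof.
move=> vK xN a0 a1.
have xc : `|x| <= c by rewrite (le_trans xN)// /c lerDl.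
have near_x s : x - a <= s <= x + a -> `|s| <= c.
  move: xN; rewrite !ler_norml /c => /andP[? ?] /andP[? ?]; apply/andP; split; lra.
have xa1 : `|x + a| <= c by apply: near_x; lra.
have xa2 : `|x - a| <= c by apply: near_x; lra.
have -> : sdiff u a x = sdiff w a x + Del / 2 * sdiff (fun y : R => `|y|) a x.
  by rewrite /sdiff /u /w !clamp_id//; ring.
rewrite sdiff_norm// mulrA divfK// lerD2r /u clamp_id//.
have -> : 2 * r * v x + 2 * r * K * a = 2 * r * (v x + K * a) by ring.
have K0 : 0 <= K.
  have := vK 0 c; rewrite normr0 sub0r normrN gtr0_norm// lexx (ltW c0).
  move=> /(_ isT isT) H; have := le_trans (normr_ge0 _) H.
  by rewrite pmulr_lge0.
apply: (sdiff_le wd (ltW a0)) => z /andP[z0 za].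
have := vS.2 (x - z) (x + z) (v x + K * a) _ _.
have -> : x + z - (x - z) = 2 * z by ring.
apply; first by lra.
move=> s /andP[s1 s2]; rewrite -lerBlDl (le_trans (ler_norm _))//.
have sc : `|s| <= c by apply: near_x; lra.
rewrite (le_trans (vK _ _ sc xc))// ler_wpM2l// ler_norml.
by apply/andP; split; lra.
Qed.

(** The even term [Del / 2 * |x|] cancels in [v z - v (- z)], so the symmetric derivative at 0 is
    [dw 0]. *)
Lemma clamp_symderiv (e : R) : 0 < e -> exists2 dl : R, 0 < dl & forall z : R, 0 < z < dl ->
  `|u z - u (- z) - 2 * dw 0 * z| <= e * z.
Proof.
move=> e0.
have [dl /= dl0 H] : \forall h \near (0 : R), `|w h - w 0 - dw 0 * h| <= e / 2 * `|h|.
  have /is_derive1_caratheodory[g [gE gc g0]] := wd 0.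
  have e2 : 0 < e / 2 by rewrite divr_gt0.
  have /cvgrPdist_le/(_ _ e2) := gc; apply: filterS => z; rewrite g0 => gz.
  rewrite gE subr0 -mulrBl normrM ler_wpM2r//.
  by rewrite distrC.
exists (Num.min dl c); first by rewrite lt_min dl0.
move=> z /andP[z0]; rewrite lt_min => /andP[zd zc].
have zn : `|z| <= c by rewrite gtr0_norm// ltW.
have nz : `|- z| <= c by rewrite normrN.
rewrite /u !clamp_id//.
have -> : v z - v (- z) - 2 * dw 0 * z =
    (w z - w 0 - dw 0 * z) - (w (- z) - w 0 - dw 0 * (- z)).
  by rewrite /w normrN; ring.
have H1 := H z; have H2 := H (- z).
rewrite /= sub0r normrN (gtr0_norm z0) in H1.
rewrite /= opprK add0r normrN (gtr0_norm z0) in H2.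
rewrite (le_trans (ler_normB _ _))//.
have := H1 zd; have := H2 zd; lra.
Qed.

End clamp.

(** * Supersolutions stopped inside a bounded interval *)

Section compact.
Context {R : realType} {d} {T : measurableType d} (P : probability T R).
Variables (X W L : R -> T -> R) (G : R -> set_system T) (x0 gam r : R).
Hypothesis sbm : sbm_system P X W L G x0 gam.
Hypothesis r0 : 0 < r.
Variables (Del N : R) (v dw : R -> R) (tau : T -> \bar R).
Hypotheses (vS : supersolution r Del v dw) (vD : gam * dw 0 + Del / 2 = 0).
Hypothesis tauG : forall s : R, 0 <= s -> G s [set w | (s%:E <= tau w)%E].
Hypothesis tau0 : forall w, (0 <= tau w)%E.
Hypothesis N0 : 0 <= N.
Hypothesis x0N : `|x0| <= N.
Hypothesis tauN : {ae P, forall w, forall s : R, 0 <= s -> (s%:E <= tau w)%E -> `|X s w| <= N}.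

Let u x := v (clamp (N + 1) x).

Lemma stopped_clamp : exists M, [/\
  measurable_fun setT (stopped_value X r u tau),
  (forall w, `|stopped_value X r u tau w| <= M) &
  \int[P]_w stopped_value X r u tau w <= v x0].
Proof.
have [B B0 vB] := supersolution_bounded N0 vS.
have [K vK] := supersolution_lipschitz r0 N0 vS.
have N1 : 0 < N + 1 by rewrite ltr_wpDl.
have K0 : 0 <= K.
  have := vK 0 (N + 1); rewrite normr0 sub0r normrN gtr0_norm// lexx (ltW N1).
  move=> /(_ isT isT) H; have := le_trans (normr_ge0 _) H.
  by rewrite pmulr_lge0.
have uB x : `|u x| <= B by apply: vB; exact: clamp_bound.
have uK x y : `|u x - u y| <= K * `|x - y|.
  rewrite (le_trans (vK _ _ (clamp_bound N0 x) (clamp_bound N0 y)))//.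
  by rewrite ler_wpM2l// clamp_lip.
have uc : continuous u by exact: lipschitz_continuous uK.
have [U1 U1d] := antiderivative uc.
have U1c : continuous U1 by exact: is_derive_continuous U1d.
have [U Ud] := antiderivative U1c.
exists B; split.
- exact: (stopped_value_measurable r0 (sbm_sigma sbm) (sbm_sub sbm) (sbm_Xc sbm) (sbm_X sbm) uB uK tauG tau0).
- exact: (stopped_value_bound X r0 uB tau0).
have -> : v x0 = u x0.
  by rewrite /u clamp_id// (le_trans x0N)// lerDl.
have K1 : 0 <= 2 * r * K by rewrite !mulr_ge0// ltW.
exact: (excessive_bounded (sbm_gam sbm) r0 (sbm_sigma sbm) (sbm_sub sbm) (sbm_mono sbm)
  (sbm_Xc sbm) (sbm_Lc sbm) (sbm_X sbm) (sbm_W sbm) (sbm_L sbm) (sbm_eq sbm)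
  (sbm_indep sbm) (sbm_regular sbm) uB uK (fun x a => clamp_sdiff N0 vS vK)
  (clamp_symderiv N0 vS) vD tauG tau0 tauN U1d Ud K1).
Qed.

End compact.

(** * First passage times *)

Section integral_ae.
Context {R : realType} {d} {T : measurableType d} (mu : {measure set T -> \bar R}).
Local Open Scope ereal_scope.
Import HBNNSimple.

(* No measurability: the integral of a nonnegative function is a supremum over
   simple functions below it, and the payoff involves a limsup over real times. *)
Lemma ge0_le_integral_ae (f g : T -> \bar R) : (forall w, 0 <= f w) -> (forall w, 0 <= g w) ->
  {ae mu, forall w, f w <= g w} -> \int[mu]_w f w <= \int[mu]_w g w.
Proof.
move=> f0 g0 [N [mN N0 fgN]].
rewrite (ge0_integralTE mu f0) (ge0_integralTE mu g0).
apply: ge_ereal_sup => _ [h /= hf <-].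
have mCN := measurableC mN.
pose h' := proj_nnsfun h mCN.
apply: (@le_trans _ _ (sintegral mu h')); last first.
  apply: ereal_sup_ubound; exists h' => //= w; rewrite mindicE.
  have [wN|_] := boolP (_ \in _); last by rewrite mulr0 g0.
  rewrite mulr1 (le_trans (hf w))//.
  by move: wN; rewrite inE /= => wN; apply: contrapT => fg; apply: wN; apply: fgN.
have HE (k : {nnsfun T >-> R}) : sintegral mu k = \int[mu]_w (k w)%:E.
  by rewrite integral_nnsfun// patch_setT.
rewrite !HE le_eqVlt; apply/orP; left; apply/eqP; apply: ae_eq_integral => //.
- exact/measurable_EFinP.
- exact/measurable_EFinP.
- exists N; split => // w /= wh; apply: contrapT => wN; apply: wh => _.
  by rewrite /h' /= mindicE mem_set// mulr1.
Qed.

Lemma ge0_integral_ae (f g : T -> \bar R) : (forall w, 0 <= f w) -> (forall w, 0 <= g w) ->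
  {ae mu, forall w, f w = g w} -> \int[mu]_w f w = \int[mu]_w g w.
Proof.
move=> f0 g0 fg; apply/eqP; rewrite eq_le; apply/andP; split; apply: ge0_le_integral_ae => //.
  by apply: filterS fg => w ->.
by apply: filterS fg => w ->.
Qed.

(** Fatou with a possibly non-measurable [f], which only has to lie below [f_ n] for large [n] at
    each point. *)
Lemma fatou_bound (f_ : nat -> T -> \bar R) (f : T -> \bar R) (c : \bar R) :
  (forall n, measurable_fun setT (f_ n)) -> (forall n w, 0 <= f_ n w) ->
  (forall w, 0 <= f w) -> (forall w, \forall n \near \oo, f w <= f_ n w) ->
  (forall n, \int[mu]_w f_ n w <= c) -> \int[mu]_w f w <= c.
Proof.
move=> mf f_0 f0 ff Hc.
have noN : ~ (\oo : set_system nat) set0 by exact: filter_not_empty.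
apply: (@le_trans _ _ (\int[mu]_w limn_einf (f_^~ w))).
  apply: ge0_le_integral_ae => //.
    move=> w; rewrite /limn_einf; rewrite -/(limf_einf (f_^~ w) \oo) limf_einfE.
    apply: le_ereal_sup_tmp; exists (ereal_inf ((f_^~ w) @` setT)).
      by exists setT => //; exact: filterT.
    by apply: le_ereal_inf_tmp => _ [n _ <-].
  apply: aeW => w; rewrite -[leRHS]/(limf_einf (f_^~ w) \oo) limf_einfE.
  apply: le_ereal_sup_tmp; exists (ereal_inf ((f_^~ w) @` [set n | f w <= f_ n w])).
    by exists [set n | f w <= f_ n w] => //; exact: ff.
  by apply: le_ereal_inf_tmp => _ [n /= fn <-].
apply: le_trans; first by apply: fatou => // n; exact: mf.
rewrite -[leLHS]/(limf_einf (fun n => \int[mu]_w f_ n w) \oo) limf_einfE.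
apply: ge_ereal_sup => _ [V FV <-].
have [V0|/set0P[n Vn]] := eqVneq V set0; first by move: FV; rewrite V0 => /noN.
by apply: (le_trans _ (Hc n)); apply: ereal_inf_lbound; exists n.
Qed.

End integral_ae.

Section first_time.
Context {R : realType}.
Implicit Types (p : R -> Prop) (f : R -> R) (s t : R).

Definition first_time p : \bar R := ereal_inf [set t%:E | t in [set t | 0 <= t /\ p t]].

Lemma first_time_ge p (y : \bar R) :
  (y <= first_time p)%E <-> forall t, 0 <= t -> p t -> (y <= t%:E)%E.
Proof.
split=> [H t t0 pt|H]; first by apply: (le_trans H); apply: ereal_inf_lbound; exists t.
by apply: le_ereal_inf_tmp => _ [t [t0 pt] <-]; exact: H.
Qed.

Lemma first_time_ge0 p : (0 <= first_time p)%E.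
Proof. by apply/first_time_ge => t; rewrite lee_fin. Qed.

Lemma first_time_le p t : 0 <= t -> p t -> (first_time p <= t%:E)%E.
Proof. by move=> t0 pt; apply: ereal_inf_lbound; exists t. Qed.

Lemma first_time_before p s t : (s%:E <= first_time p)%E -> 0 <= t -> t < s -> ~ p t.
Proof.
by move=> /first_time_ge H t0 ts /(H _ t0); rewrite lee_fin leNgt ts.
Qed.

Lemma first_time_near p s e : first_time p = s%:E -> 0 < e ->
  exists t, [/\ 0 <= t, s <= t, t < s + e & p t].
Proof.
move=> ps e0; apply: contrapT => H.
have : ((s + e)%:E <= first_time p)%E.
  apply/first_time_ge => t t0 pt; rewrite lee_fin leNgt; apply/negP => ts.
  by apply: H; exists t; split => //; rewrite -lee_fin -ps first_time_le.
by rewrite ps lee_fin gerDl leNgt e0.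
Qed.

Lemma first_time_attained f s : continuous f -> first_time (fun t => f t <= 0) = s%:E ->
  0 <= s /\ f s <= 0.
Proof.
move=> fc fs; split; first by rewrite -lee_fin -fs first_time_ge0.
rewrite leNgt; apply/negP => fs0.
have /(@cvgr_gt _ _ _ _ _)/(_ 0 fs0)[e /= e0 H] := fc s.
have [t [t0 st te]] := first_time_near fs e0.
rewrite leNgt H//= ltr_norml; apply/andP; split; lra.
Qed.

Lemma le_from_left f s (lam : R) : continuous f -> 0 < s ->
  (forall t, 0 <= t -> t < s -> f t <= lam) -> f s <= lam.
Proof.
move=> fc s0 H; rewrite leNgt; apply/negP => fs.
have /(@cvgr_gt _ _ _ _ _)/(_ lam fs)[e /= e0 He] := fc s.
pose t := Num.max 0 (s - e / 2).
have ts : t < s by rewrite gt_max s0/= ltrBlDr ltrDl divr_gt0.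
have t0 : 0 <= t by rewrite le_max lexx.
have st : s - e / 2 <= t by rewrite le_max lexx orbT.
have := H _ t0 ts; rewrite leNgt He//= ltr_norml; apply/andP; split; lra.
Qed.

Lemma first_time_continuous f (lam : R) s : continuous f -> f 0 <= lam -> 0 <= s ->
  (s%:E <= first_time (fun t => (lam < f t)%R))%E <-> (forall t, 0 <= t <= s -> f t <= lam).
Proof.
move=> fc f0 s0; split => [H t /andP[t0 ts]|H].
  move: t0; rewrite le_eqVlt => /predU1P[<-//|t0].
  apply: le_from_left => // v v0 vt; rewrite leNgt; apply/negP.
  by apply: (first_time_before H v0); rewrite (lt_le_trans vt).
apply/first_time_ge => t t0 ft; rewrite lee_fin leNgt; apply/negP => ts.
by have := H t; rewrite t0 (ltW ts) leNgt ft => /(_ isT).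
Qed.

Lemma rat_between f (a b : R) (lam : R) s : continuous f -> a < b -> a <= s <= b -> lam < f s ->
  exists q : rat, a <= (ratr q : R) < b /\ lam < f (ratr q).
Proof.
move=> fc ab /andP[sa sb] fs.
have /(@cvgr_gt _ _ _ _ _)/(_ lam fs)[e /= e0 He] := fc s.
have [q] : exists q : rat, (ratr q : R) \in `](Num.max a (s - e)), (Num.min b (s + e))[.
  by apply: rat_in_itvoo; rewrite gt_max !lt_min ab; apply/and3P; split; lra.
rewrite in_itv/= gt_max lt_min => /andP[/andP[q1 q2] /andP[q3 q4]].
exists q; rewrite (ltW q1) q3; split => //; apply: He => /=; rewrite ltr_norml.
apply/andP; split; lra.
Qed.

(** Rational times strictly before [s] decide the event, which therefore lies in the filtration at
    [s] without right-continuity. *)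
Lemma first_time_strictE f (lam : R) s : continuous f -> 0 <= s ->
  (s%:E <= first_time (fun t => (lam < f t)%R))%E <->
  forall q : rat, 0 <= (ratr q : R) < s -> f (ratr q) <= lam.
Proof.
move=> fc s0; split => [H q /andP[q0 qs]|H].
  by rewrite leNgt; apply/negP; exact: (first_time_before H).
apply/first_time_ge => t t0 ft; rewrite lee_fin leNgt; apply/negP => ts.
have [|q [qq fq]] := rat_between fc (le_lt_trans t0 ts) _ ft; first by rewrite t0 ltW.
by have := H q qq; rewrite leNgt fq.
Qed.

(** A hit of the closed set by time [t] is detected through near hits at rational times of [[0, t]];
    compactness turns near hits into a true one. *)
Lemma first_time_leE f t : continuous f -> 0 <= t ->
  (first_time (fun s => (f s <= 0)%R) <= t%:E)%E <->
  forall n, exists q : rat, 0 <= (ratr q : R) <= t /\ f (ratr q) < n.+1%:R^-1.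
Proof.
move=> fc t0; split => [H n|H].
  have [s [s0 st fs]] : exists s, [/\ 0 <= s, s <= t & f s <= 0].
    have := first_time_ge0 (fun s => (f s <= 0)%R).
    case E : (first_time _) H => [s| |]//; rewrite lee_fin => st _.
    by have [s0 fs] := first_time_attained fc E; exists s.
  have fs' : f s < n.+1%:R^-1 by rewrite (le_lt_trans fs)// invr_gt0.
  move: t0; rewrite le_eqVlt => /predU1P[t0|t0].
    exists 0; rewrite rmorph0 -t0 lexx; split => //.
    by rewrite (_ : 0 = s)//; apply/eqP; rewrite eq_le s0 t0 st.
  have nf : continuous (- f) by move=> z; apply: cvgN; exact: fc.
  have [||q [qq fq]] := @rat_between (- f) 0 t (- n.+1%:R^-1) s nf t0.
  - by rewrite s0.
  - by rewrite /= ltrN2.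
  exists q; split; last by move: fq; rewrite /= ltrN2.
  by move: qq => /andP[-> /ltW].
have [c /[!in_itv]/= /andP[c0 ct] cmin] := EVT_min t0 (continuous_subspaceT fc).
have fc0 : f c <= 0.
  rewrite leNgt; apply/negP => fc0.
  have [n _ /(_ n (leqnn n))] := @grid_small R 1 _ fc0.
  rewrite div1r ger0_norm ?invr_ge0// => nf.
  have [q [qt fq]] := H n.
  have := cmin (ratr q); rewrite in_itv/= => /(_ qt); rewrite leNgt.
  by rewrite (lt_le_trans fq).
by apply: (le_trans (first_time_le c0 fc0)); rewrite lee_fin.
Qed.

End first_time.

(** * Localization at exit times of growing intervals *)

Section stopping.
Context {R : realType} {d} {T : measurableType d} (P : probability T R).
Variables (X W L : R -> T -> R) (G : R -> set_system T) (x0 gam r : R).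
Hypothesis sbm : sbm_system P X W L G x0 gam.
Hypothesis r0 : 0 < r.
Notation TG s := (g_sigma_algebraType (G s)).

Lemma first_time_adapted (Y : R -> T -> R) (lam : R) : (forall w, continuous (Y^~ w)) ->
  (forall s : R, 0 <= s -> measurable_fun [set: TG s] (Y s : TG s -> R)) ->
  forall s : R, 0 <= s -> G s [set w | (s%:E <= first_time (fun t => (lam < Y t w)%R))%E].
Proof.
move=> Yc mY s s0; rewrite -(sub_measurableE (sbm_sigma sbm s0)).
pose Fq (q : rat) : set (TG s) := if 0 <= (ratr q : R) < s then
  [set w | Y (ratr q) w <= lam] else setT.
rewrite (_ : [set w | _] = ~` \bigcup_q ~` Fq q).
  apply: measurableC; apply: bigcupT_measurable_rat => q; apply: measurableC.
  rewrite /Fq; case: ifP => // /andP[q0 qs].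
  rewrite -[X in measurable X]setTI; apply: measurable_fun_le => //.
  exact: (adapt_le (sbm_sigma sbm) (sbm_mono sbm) q0 (ltW qs) (mY _ q0)).
rewrite setC_bigcup; apply/seteqP; split => w /=.
  move=> /(first_time_strictE _ (Yc w) s0) H q _; rewrite setCK /Fq.
  by case: ifP => // qs; exact: H.
move=> H; apply/(first_time_strictE _ (Yc w) s0) => q qs.
by have := H q I; rewrite setCK /Fq qs.
Qed.

Definition exit_time (N : R) (w : T) : \bar R := first_time (fun t => N < `|X t w|).

Let XNc w : continuous (fun t => `|X t w|).
Proof.
move=> t; apply: (@continuous_comp _ _ _ (X^~ w) (@Num.norm _ _)); first exact: (sbm_Xc sbm).
exact: norm_continuous.
Qed.

Let N n : R := `|x0| + n%:R.
Let N0 n : 0 <= N n. Proof. by rewrite /N addr_ge0. Qed.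
Let x0N n : `|x0| <= N n. Proof. by rewrite /N lerDl. Qed.

Lemma exit_time_large w s : exists n0, forall n, (n0 <= n)%N ->
  (s%:E <= exit_time (N n) w)%E /\ forall t, 0 <= t <= s -> `|X t w| <= N n.
Proof.
have [M HM] : exists M, forall t, 0 <= t <= s -> `|X t w| <= M.
  have [s0|s0] := leP 0 s; last first.
    by exists 0 => t /andP[t0 ts]; have := le_lt_trans (le_trans t0 ts) s0; rewrite ltxx.
  have [c _ cmax] := EVT_max s0 (continuous_subspaceT (@XNc w)).
  by exists `|X c w| => t ts; apply: cmax; rewrite in_itv.
exists (Num.truncn M).+1 => n n0.
have MN : M <= N n.
  rewrite /N (le_trans (ltW (truncnS_gt M)))// -[leLHS]add0r lerD//.
  by rewrite ler_nat.
split; last by move=> t ts; rewrite (le_trans (HM t ts)).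
apply/first_time_ge => t t0 Nt; rewrite lee_fin leNgt; apply/negP => ts.
by move: Nt; rewrite ltNge (le_trans (HM t _))// t0 ltW.
Qed.

Variables (Del : R) (v dw : R -> R) (tau : T -> \bar R).
Hypothesis tauG : forall s : R, 0 <= s -> G s [set w | (s%:E <= tau w)%E].
Hypothesis tau0 : forall w, (0 <= tau w)%E.

Let tn n w : \bar R := Order.min (tau w) (exit_time (N n) w).

Let tn0 n w : (0 <= tn n w)%E.
Proof. by rewrite le_min tau0 first_time_ge0. Qed.

Let tnG n s : 0 <= s -> G s [set w | (s%:E <= tn n w)%E].
Proof.
move=> s0.
have Y1 := @first_time_adapted (fun t w => `|X t w|) (N n) XNc _ s s0.
have {}Y1 : G s [set w | (s%:E <= exit_time (N n) w)%E].
  by apply: Y1 => t t0; apply: measurableT_comp => //; exact: (sbm_X sbm).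
rewrite -(sub_measurableE (sbm_sigma sbm s0)) in Y1 *.
rewrite (_ : [set w | _] = [set w | (s%:E <= tau w)%E] `&` [set w | (s%:E <= exit_time (N n) w)%E]).
  apply: measurableI; last exact: Y1.
  by rewrite (sub_measurableE (sbm_sigma sbm s0)); exact: tauG.
by apply/seteqP; split => w /=; rewrite /tn le_min; [move=> /andP|case=> -> ->].
Qed.

Let tnN n : {ae P, forall w, forall s : R, 0 <= s -> (s%:E <= tn n w)%E -> `|X s w| <= N n}.
Proof.
apply: filterS (sbm_regular sbm) => w [X0 _ _ _ _] s s0.
rewrite le_min => /andP[_ H].
have /first_time_continuous := H; apply => //; first by rewrite X0.
by rewrite s0 lexx.
Qed.

Let S n := stopped_value X r (fun x => v (clamp (N n + 1) x)) (tn n).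

Let S_eventually w s : tau w = s%:E ->
  exists n0, forall n, (n0 <= n)%N -> S n w = stopped_value X r v tau w.
Proof.
move=> ts; have s0 : 0 <= s by rewrite -lee_fin -ts.
have [n0 H] := exit_time_large w s; exists n0 => n nn.
have [H1 H2] := H n nn.
rewrite /S /stopped_value /tn ts min_l// /disc clamp_id//.
by rewrite (le_trans (H2 s _)) ?s0 ?lexx// lerDl.
Qed.

Lemma stopped_value_EFin_ge0 (f : R -> R) w : (forall x, 0 <= f x) ->
  (0 <= (stopped_value X r f tau w)%:E)%E.
Proof.
move=> f0; rewrite lee_fin /stopped_value; case: (tau w) => // s.
by rewrite /disc mulr_ge0// expR_ge0.
Qed.

Hypothesis vS : supersolution r Del v dw.
Hypothesis vD : gam * dw 0 + Del / 2 = 0.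

(** Nonnegativity allows Fatou along the exit times; paths that never stop count as 0 on the left,
    so nothing about their limit is needed. *)
Lemma supersolution_stopped : (forall x, 0 <= v x) ->
  (\int[P]_w (stopped_value X r v tau w)%:E <= (v x0)%:E)%E.
Proof.
move=> v0.
have HS n := stopped_clamp sbm r0 vS vD (@tnG n) (@tn0 n) (N0 n) (x0N n) (@tnN n).
have mS n : measurable_fun setT (S n) by have [M []] := HS n.
have S0 n w : (0 <= (S n w)%:E)%E.
  rewrite lee_fin /S /stopped_value; case: (tn n w) => // s.
  by rewrite /disc mulr_ge0// expR_ge0.
have ES n : (\int[P]_w (S n w)%:E <= (v x0)%:E)%E.
  have [M [_ SM EM]] := HS n.
  have iS := bounded_integrable P (mS n) SM.
  rewrite -[leLHS]fineK; last exact: (integrable_fin_num measurableT iS).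
  by rewrite lee_fin.
apply: (fatou_bound _ _ _ _ ES) => //.
- by move=> n; exact/measurable_EFinP.
- by move=> w; exact: stopped_value_EFin_ge0.
- move=> w; case E : (tau w) => [s| |].
  + by have [n0 Hn] := S_eventually E; exists n0 => // n /= nn; rewrite Hn.
  + by apply: nearW => n; rewrite {1}/stopped_value E.
  + by apply: nearW => n; rewrite {1}/stopped_value E.
Qed.


(** [v] and [- v] give both inequalities before each exit time, and boundedness of [v] up to [tau]
    allows dominated convergence. As [f] may fail to be measurable, it is compared with a measurable
    nonnegative version [h]. *)
Lemma stopped_equality (B Del' : R) (dw' : R -> R) :
  supersolution r Del' (fun x => - v x) dw' -> gam * dw' 0 + Del' / 2 = 0 ->
  {ae P, forall w, forall s : R, 0 <= s -> (s%:E <= tau w)%E -> `|v (X s w)| <= B} ->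
  forall f : T -> \bar R, (forall w, 0 <= f w)%E ->
  {ae P, forall w, f w = (stopped_value X r v tau w)%:E} ->
  (\int[P]_w f w = (v x0)%:E)%E.
Proof.
move=> vSN vDN vB f f0 fv.
have HS n := stopped_clamp sbm r0 vS vD (@tnG n) (@tn0 n) (N0 n) (x0N n) (@tnN n).
have HSN n := stopped_clamp sbm r0 vSN vDN (@tnG n) (@tn0 n) (N0 n) (x0N n) (@tnN n).
have mS n : measurable_fun setT (S n) by have [M []] := HS n.
have mSV : measurable_fun setT (stopped_value X r v tau).
  apply: (@measurable_realfun.measurable_fun_cvg _ T R setT
    (fun n => stopped_value X r (fun x => v (clamp (N n + 1) x)) tau)).
    move=> n; have [B' _ vB'] := supersolution_bounded (N0 n) vS.
    have [K vK] := supersolution_lipschitz r0 (N0 n) vS.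
    have K0 : 0 <= K.
      have N1 : 0 < N n + 1 by rewrite ltr_wpDl.
      have := vK 0 (N n + 1); rewrite normr0 sub0r normrN gtr0_norm// lexx (ltW N1).
      move=> /(_ isT isT) H; have := le_trans (normr_ge0 _) H.
      by rewrite pmulr_lge0.
    apply: (@stopped_value_measurable _ _ _ X G r r0 (sbm_sigma sbm) (sbm_sub sbm)
      (sbm_Xc sbm) (sbm_X sbm) _ B' K) => // [x|x y].
      by apply: vB'; exact: clamp_bound.
    rewrite (le_trans (vK _ _ (clamp_bound (N0 n) x) (clamp_bound (N0 n) y)))//.
    by rewrite ler_wpM2l// clamp_lip.
  move=> w _; apply: cvg_near_cst; rewrite /stopped_value; case E : (tau w) => [s| |].
  - have s0 : 0 <= s by rewrite -lee_fin -E.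
    have [n0 Hn] := exit_time_large w s; exists n0 => // n /= nn.
    have [_ H] := Hn n nn; rewrite /disc clamp_id//.
    by rewrite (le_trans (H s _)) ?s0 ?lexx// lerDl.
  - exact: nearW.
  - exact: nearW.
(* When [tau] is infinite the exit times grow beyond every [s], and this bound forces the limit
   0. *)
have small w n s : (forall s : R, 0 <= s -> (s%:E <= tau w)%E -> `|v (X s w)| <= B) ->
    (forall s : R, 0 <= s -> (s%:E <= tn n w)%E -> `|X s w| <= N n) ->
    (s%:E <= tn n w)%E -> `|S n w| <= expR (- r * s) * B.
  move=> Bw Nw; have B0 : 0 <= B by exact: (le_trans (normr_ge0 _) (Bw 0 (lexx _) (tau0 w))).
  rewrite /S /stopped_value; have := tn0 n w; case E : (tn n w) => [t| |]//; last first.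
    by rewrite normr0 mulr_ge0// expR_ge0.
  rewrite !lee_fin => t0 st; rewrite /disc normrM ger0_norm ?expR_ge0//.
  have tt : (t%:E <= tn n w)%E by rewrite E.
  rewrite clamp_id; last by rewrite (le_trans (Nw t t0 tt))// lerDl.
  apply: ler_pM => //.
    by rewrite ler_expR ler_wnM2l// oppr_le0 ltW.
  by apply: Bw => //; move: tt; rewrite le_min => /andP[].
have aeN : {ae P, forall w, forall n, forall s : R, 0 <= s -> (s%:E <= tn n w)%E -> `|X s w| <= N n}.
  exact/ae_foralln.
have SB : {ae P, forall w, forall n, `|S n w| <= B}.
  apply: filterS2 vB aeN => w Bw Nw n.
  by have := small w n 0 Bw (Nw n) (tn0 n w); rewrite mulr0 expR0 mul1r.
have cS : {ae P, forall w, S n w @[n --> \oo] --> stopped_value X r v tau w}.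
  apply: filterS2 vB aeN => w Bw Nw; case E : (tau w) => [s| |]; last 2 first.
  - rewrite /stopped_value E; apply/cvgrPdist_le => /= e e0.
    have B0 : 0 <= B by exact: (le_trans (normr_ge0 _) (Bw 0 (lexx _) (tau0 w))).
    have kk : 0 < r * (e / (B + 1)) by rewrite mulr_gt0// divr_gt0// ltr_wpDl.
    have [m _ /(_ m (leqnn m)) Hm] := @grid_small R 1 _ kk.
    have [n0 Hn] := exit_time_large w m.+1%:R; exists n0 => // n /= nn.
    have [mn _] := Hn n nn; rewrite sub0r normrN.
    have tm : (m.+1%:R%:E <= tn n w)%E by rewrite le_min E leey mn.
    rewrite (le_trans (small w n _ Bw (Nw n) tm))//.
    have H1 : expR (- r * m.+1%:R) <= e / (B + 1).
      rewrite mulNr expRN; have := expR_ge1Dx (r * m.+1%:R).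
      have rn : 0 < r * m.+1%:R by rewrite mulr_gt0// ltr0n.
      move=> H; rewrite (@le_trans _ _ (r * m.+1%:R)^-1)//.
        by rewrite lef_pV2 ?posrE ?expR_gt0// (le_trans _ H)// lerDr.
      rewrite invfM -ler_pdivlMl ?invr_gt0// invrK.
      by move: Hm; rewrite div1r ger0_norm ?invr_ge0.
    rewrite (@le_trans _ _ (e / (B + 1) * (B + 1)))//.
      by rewrite ler_pM ?expR_ge0// lerDl.
    by rewrite divfK// gt_eqF// ltr_wpDl.
  - by have := tau0 w; rewrite E.
  have [n0 Hn] := S_eventually E.
  by apply: cvg_near_cst; exists n0 => // n /= nn; rewrite Hn.
have [iSV cE] := E_cvg_ae mS mSV SB cS.
pose h w := (Num.max 0 (stopped_value X r v tau w))%:E.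
have mh : measurable_fun setT h.
  by apply/measurable_EFinP; exact: measurable_maxr.
have SVh : {ae P, forall w, h w = (stopped_value X r v tau w)%:E}.
  apply: filterS fv => w fw; rewrite /h max_r// -lee_fin -fw.
  exact: f0.
transitivity (\int[P]_w h w)%E.
  apply: ge0_integral_ae => // [w|]; first by rewrite lee_fin le_max lexx.
  by apply: filterS2 fv SVh => w -> ->.
transitivity (\int[P]_w (stopped_value X r v tau w)%:E)%E.
  apply: ae_eq_integral => //; first exact/measurable_EFinP.
  by apply: filterS SVh => w ->.
rewrite -[LHS]fineK; last exact: (integrable_fin_num measurableT iSV).
congr EFin; apply/eqP; rewrite eq_le; apply/andP; split.
  rewrite -[leLHS](cvg_lim _ cE)//; apply: limr_le; first by apply/cvg_ex; eexists; exact: cE.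
  by apply: nearW => n; have [M []] := HS n.
rewrite -[leRHS](cvg_lim _ cE)//; apply: limr_ge; first by apply/cvg_ex; eexists; exact: cE.
apply: nearW => n; have [M [_ SM _]] := HS n; have [_ [_ _]] := HSN n.
rewrite (_ : stopped_value _ _ _ _ = fun w => -1 * S n w).
  rewrite RintegralZl; [|exact: measurableT|exact: (bounded_integrable P (mS n) SM)].
  by rewrite mulN1r lerN2.
apply/funext => w; rewrite /S /stopped_value; case: (tn n w) => [s| |].
- by rewrite /disc; ring.
- by rewrite mulr0.
- by rewrite mulr0.
Qed.

End stopping.

(** * Maximal inequality and growth of paths *)

Section growth.
Context {R : realType} {d} {T : measurableType d} (P : probability T R).
Variables (X W L : R -> T -> R) (G : R -> set_system T) (x0 gam r : R).
Hypothesis sbm : sbm_system P X W L G x0 gam.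
Hypothesis r0 : 0 < r.
Variables (Del : R) (v dw : R -> R).
Hypothesis vS : supersolution r Del v dw.
Hypothesis vD : gam * dw 0 + Del / 2 = 0.
Hypothesis v0 : forall x, 0 <= v x.

Let Y t w := disc X r v t w.

Let Yc w : continuous (Y^~ w).
Proof.
move=> s; rewrite /Y /disc; apply: cvgM.
  apply: (@continuous_comp _ _ _ (fun s => - r * s) expR); last exact: continuous_expR.
  by apply: cvgM; [exact: cvg_cst|exact: cvg_id].
apply: continuous_comp; first exact: (sbm_Xc sbm).
exact: (supersolution_continuous vS).
Qed.

Let tau (lam : R) w := first_time (fun t => lam < Y t w).

Let tauG lam s : 0 <= s -> G s [set w | (s%:E <= tau lam w)%E].
Proof.
apply: (first_time_adapted sbm) => // t t0; apply: measurable_funM => //.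
apply: measurableT_comp; last exact: (sbm_X sbm).
by apply: continuous_measurable_fun; exact: (supersolution_continuous vS).
Qed.

(** The event that [tau lam] is finite, written with integer times to be visibly measurable. *)
Let hit lam : set T := ~` \bigcap_n [set w | (n%:R%:E <= tau lam w)%E].

Let hit_measurable lam : measurable (hit lam).
Proof.
apply: measurableC; apply: bigcapT_measurable => n.
by apply: (sbm_sub sbm (ler0n _ n)); exact: tauG.
Qed.

Let hitE lam w t : 0 <= t -> lam < Y t w -> hit lam w.
Proof.
move=> t0 lY H; have := H (Num.truncn t).+1 I => /= /(first_time_before)/(_ t0).
by apply => //; exact: truncnS_gt.
Qed.

(** Stop when the discounted supersolution first exceeds [lam]: by continuity it is at least [lam]
    at that time. *)
Let maximal_inequality lam : 0 < lam -> (lam%:E * P (hit lam) <= (v x0)%:E)%E.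
Proof.
move=> lam0.
apply: le_trans (supersolution_stopped sbm r0 (@tauG lam) _ vS vD v0); last first.
  by move=> w; exact: first_time_ge0.
rewrite -[leLHS](_ : (\int[P]_w (lam * \1_(hit lam) w)%:E)%E = _); last first.
  under eq_integral do rewrite EFinM.
  rewrite ge0_integralZl//; last 2 first.
  - by apply/measurable_EFinP; exact: measurable_indic.
  - by rewrite lee_fin ltW.
  by rewrite integral_indic// setIT.
apply: ge0_le_integral_ae.
- by move=> w; rewrite lee_fin mulr_ge0// ltW.
- by move=> w; exact: stopped_value_EFin_ge0.
apply: aeW => w; rewrite lee_fin indicE.
have [wh|_] := boolP (_ \in _); last first.
  by rewrite mulr0 -lee_fin stopped_value_EFin_ge0.
rewrite mulr1 /stopped_value; case E : (tau lam w) => [s| |].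
- rewrite leNgt; apply/negP => /(@cvgr_lt _ _ _ _ _ _ (@Yc w s) lam)[e /= e0 H].
  have [t [t0 st te lt]] := first_time_near E e0.
  have Ht : Y t w < lam by apply: H; rewrite /= ltr_norml; apply/andP; split; lra.
  by move: Ht; rewrite ltNge (ltW lt).
- exfalso; move: wh; rewrite inE => -[] n _ /=; by rewrite E leey.
- by have := first_time_ge0 (fun t => lam < Y t w); rewrite -/(tau lam w) E.
Qed.

Lemma supersolution_path_bounded :
  {ae P, forall w, exists lam : R, forall t, 0 <= t -> disc X r v t w <= lam}.
Proof.
exists (\bigcap_n hit n.+1%:R); split.
- by apply: bigcapT_measurable => n; exact: hit_measurable.
- apply/eqP; rewrite eq_le measure_ge0 andbT.
  set E := \bigcap_n _.
  have mE : measurable E by apply: bigcapT_measurable => n; exact: hit_measurable.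
  have H n : (n.+1%:R%:E * P E <= (v x0)%:E)%E.
    apply: le_trans (maximal_inequality (ltr0Sn R n)); apply: lee_wpmul2l => //.
    by apply: le_measure; rewrite ?inE//; move=> w; apply.
  have PEf : P E \is a fin_num by exact: fin_num_measure.
  rewrite -(fineK PEf) lee_fin; rewrite leNgt; apply/negP => PE0.
  have vx : 0 < fine (P E) / (v x0 + 1) by rewrite divr_gt0// ltr_wpDl.
  have [n _ /(_ n (leqnn n))] := @grid_small R 1 _ vx.
  rewrite div1r ger0_norm ?invr_ge0//.
  have := H n; rewrite -(fineK PEf) -EFinM lee_fin => H1.
  rewrite ler_pdivlMr ?ltr_wpDl// ler_pdivrMl// => H2.
  by have := le_trans H2 H1; rewrite gerDl ler10.
- move=> w /= H n _; apply: contrapT => nh; apply: H; exists n.+1%:R => t t0.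
  by rewrite leNgt; apply/negP => lt; apply: nh; exact: hitE lt.
Qed.

(** The maximal inequality only bounds [exp(- r t) v(X_t)]. This suffices, because [g] lies below
    any multiple of [v] up to a constant, and constants are discounted away. *)
Lemma discounted_limsup (g : R -> R) (Z : R -> T -> R) :
  (forall t w, 0 <= t -> Z t w = X t w) -> (forall x, 0 <= g x) ->
  (forall del : R, 0 < del -> exists C, forall x, g x <= del * v x + C) ->
  {ae P, forall w,
    limf_esup (fun t => (expR (- r * t) * g (Z t w))%:E) (pinfty_nbhs R) = 0%E}.
Proof.
move=> ZX g0 gv; apply: filterS supersolution_path_bounded => w [lam Hlam].
have lam0 : 0 <= lam.
  by rewrite (le_trans _ (Hlam 0 (lexx _)))// mulr_ge0// expR_ge0.
apply/eqP; rewrite eq_le; apply/andP; split; last first.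
  apply: limf_esup_ge0 => [|t]; first exact: filter_not_empty.
  by rewrite lee_fin mulr_ge0// expR_ge0.
apply/lee_addgt0Pr => e e0; rewrite add0e.
pose del := e / 2 / (lam + 1).
have l1 : 0 < lam + 1 by rewrite ltr_wpDl.
have del0 : 0 < del by rewrite !divr_gt0.
have [C HC] := gv _ del0.
(* From this time on [exp(r t) >= 1 + r t] brings the discounted constant [C] below [e / 2]. *)
pose V := [set t : R | 0 <= t /\ (`|C| + 1) / (e / 2) / r <= t].
have FV : pinfty_nbhs R V.
  by apply: filterI; apply: nbhs_pinfty_ge; exact: num_real.
rewrite limf_esupE; apply: (@le_trans _ _ (ereal_sup
    ((fun t => (expR (- r * t) * g (Z t w))%:E) @` V))).
  by apply: ereal_inf_lbound; exists V.
apply: ge_ereal_sup => _ [t [t0 Vt] <-]; rewrite lee_fin ZX//.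
have H1 : expR (- r * t) * g (X t w) <= del * disc X r v t w + expR (- r * t) * `|C|.
  have -> : del * disc X r v t w + expR (- r * t) * `|C| =
      expR (- r * t) * (del * v (X t w) + `|C|) by rewrite /disc; ring.
  rewrite ler_wpM2l ?expR_ge0// (le_trans (HC _))// lerD2l ler_norm//.
have H2 : del * disc X r v t w <= e / 2.
  rewrite (le_trans (ler_wpM2l (ltW del0) (Hlam t t0)))// /del mulrAC.
  by rewrite ler_pdivrMr// ler_wpM2l// ?ltW ?divr_gt0// ltrDl.
have H3 : expR (- r * t) * `|C| <= e / 2.
  rewrite mulNr expRN mulrC ler_pdivrMr ?expR_gt0//.
  have e2 : 0 < e / 2 by rewrite divr_gt0.
  rewrite -ler_pdivrMl// mulrC.
  have := expR_ge1Dx (r * t); move: Vt; rewrite ler_pdivrMr// mulrDl [t * r]mulrC.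
  have : 0 <= 1 / (e / 2) by rewrite divr_ge0// ltW.
  by move=> *; lra.
rewrite (le_trans H1)//; lra.
Qed.

End growth.

(** * Skew Brownian motion *)

Lemma continuous_extend_left {R : realType} (f : R -> R) :
  {within `[0, +oo[, continuous f} -> continuous (fun t : R => f (Num.max t 0)).
Proof.
move=> /subspace_continuousP fc t.
have ms (s : R) : `[0, +oo[%classic (Num.max s 0) by rewrite /= in_itv/= le_max lexx orbT.
have mc : (fun s : R => Num.max s 0) @ t --> within `[0, +oo[ (nbhs (Num.max t 0)).
  have H : (fun s : R => Num.max s 0) @ t --> Num.max t 0.
    exact: (@continuous_max R R (fun s => s) (fun=> 0) t (@cvg_id _ _) (@cvg_cst _ _ _ _ _)).
  by move=> A HA; apply: (@filterS _ (nbhs t) _ _ _ _ (H _ HA)) => s; apply; exact: ms.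
exact: (cvg_comp _ _ mc (fc _ (ms t))).
Qed.

Section augmentation.
Context {R : realType} {d} {T : measurableType d} (P : probability T R).
Implicit Types (W : R -> T -> R) (A B : set T).

Lemma past_events_mono W (s t : R) : s <= t -> past_events W s `<=` past_events W t.
Proof.
move=> st A [u /=]; rewrite in_itv/= => /andP[u0 us] HA; exists u => //=.
by rewrite in_itv/= u0 (le_trans us).
Qed.

Lemma natural_measurable W s : (forall t : R, 0 <= t -> measurable_fun setT (W t)) ->
  natural_filtration W s `<=` measurable.
Proof.
move=> mW; apply: smallest_sub; first exact: sigma_algebra_measurable.
move=> A [u /=]; rewrite in_itv/= => /andP[u0 _] [B mB <-]; exact: (mW u u0 measurableT B mB).
Qed.

(** The sets that agree with a natural event off a measurable null set form a sigma-algebra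
    containing the generators. *)
Lemma augmented_approx W s A : augmented_filtration P W s A ->
  exists B N, [/\ natural_filtration W s B, measurable N, P N = 0%E &
    forall w, ~ N w -> (A w <-> B w)].
Proof.
move: A; apply: smallest_sub => [|A]; last first.
  case=> [HA|[N [mN N0 AN]]].
    by exists A, set0; split=> //; exact: sub_sigma_algebra.
  exists set0, N; split => //; first exact: sigma_algebra0.
  by move=> w nN; split=> // /AN.
split.
- by exists set0, set0; split=> //; exact: sigma_algebra0.
- move=> A [B [N [HB mN N0 AB]]]; exists (setT `\` B), N; split => //.
    by have [_ + _] := @smallest_sigma_algebra _ setT (past_events W s); apply.
  by move=> w /AB H; split=> -[_ h]; split=> // /H.
- move=> F /choice[B /choice[N H]]; exists (\bigcup_n B n), (\bigcup_n N n); split.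
  + by apply: sigma_algebra_bigcup => n; have [] := H n.
  + by apply: bigcupT_measurable => n; have [] := H n.
  + apply/negligibleP; first by apply: bigcupT_measurable => n; have [] := H n.
    by apply: negligible_bigcup => n; have [_ mN N0 _] := H n; exact/negligibleP.
  + move=> w nN; split=> -[n _ h]; exists n => //; have [_ _ _ /(_ w) E] := H n.
      by apply/E => // Nw; apply: nN; exists n.
    by apply/E => // Nw; apply: nN; exists n.
Qed.

Lemma augmented_indep W : (forall t : R, 0 <= t -> measurable_fun setT (W t)) ->
  forall (s : R) A E, measurable A -> augmented_filtration P W s A -> measurable E ->
  (forall B, natural_filtration W s B -> P (B `&` E) = (P B * P E)%E) ->
  P (A `&` E) = (P A * P E)%E.
Proof.
move=> mW s A E mA /augmented_approx[B [N [nB mN N0 AB]]] mE /(_ B nB) HB.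
have mB : measurable B by exact: natural_measurable nB.
have eqP C D : measurable C -> measurable D -> (forall w, ~ N w -> (C w <-> D w)) -> P C = P D.
  move=> mC mD CD.
  have H C' D' : measurable C' -> measurable D' -> (forall w, ~ N w -> C' w -> D' w) -> (P C' <= P D')%E.
    move=> mC' mD' sub; apply: (@le_trans _ _ (P (D' `|` N))).
      apply: le_measure; rewrite ?inE//; first exact: measurableU.
      by move=> w Cw; have [Nw|nN] := pselect (N w); [right|left; exact: sub].
    apply: (le_trans (measureU2 _ mD' mN)); rewrite -[leRHS]adde0 leeD2l//.
    by rewrite le_eqVlt; apply/orP; left; apply/eqP; exact: N0.
  apply/eqP; rewrite eq_le !H// => w /CD E'; by move=> /E'.
rewrite (eqP (A `&` E) (B `&` E)) ?HB ?(eqP A B)//; try exact: measurableI.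
by move=> w /AB H; split=> -[h ?]; split=> //; apply/H.
Qed.

End augmentation.

Section construction.
Context {R : realType} {d} {T : measurableType d} (P : probability T R).
Variables (beta x0 : R) (X : R -> T -> R).
Hypothesis hbeta : 1 / 2 < beta.
Hypothesis hX : skew_brownian_motion beta x0 P X.

(* Freezing a path at negative times turns continuity on [0, +oo[ into
   continuity on R. *)
Definition extend_left (Y : R -> T -> R) (t : R) (w : T) : R := Y (Num.max t 0) w.

Lemma extend_left_ge0 Y (t : R) w : 0 <= t -> extend_left Y t w = Y t w.
Proof. by move=> t0; rewrite /extend_left max_l. Qed.

(** All from the defining limit: a single time is a null set, occupation sets grow with time, and
    for flatness [e] is taken below the minimum of [|f|] on [[u, v]]. *)
Lemma local_time_path (f : R -> R) (l : R -> R) : continuous f ->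
  (forall t : R, 0 <= t -> (2 * e)^-1 *
       fine (lebesgue_measure [set s : R | 0 <= s <= t /\ `|f s| < e])
     @[e --> 0^'+] --> l t) ->
  [/\ l 0 = 0, (forall u v, 0 <= u -> u <= v -> l u <= l v) &
    (forall u v, 0 <= u -> u <= v -> (forall s, u <= s <= v -> f s <> 0) -> l v = l u)].
Proof.
move=> fc fl; split.
- have := fl 0 (lexx _); under eq_fun => e.
    rewrite (_ : fine _ = 0).
      rewrite mulr0; over.
    rewrite (_ : lebesgue_measure _ = 0%E)//; apply/eqP; rewrite eq_le measure_ge0 andbT.
    rewrite -(lebesgue_measure_set1 (0 : R)); apply: le_measure; rewrite ?inE.
    + exact: measurable_occupation.
    + exact: measurable_set1.
    + by move=> s /= [/andP[s0 s1] _]; apply/eqP; rewrite eq_le s0 s1.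
  by move=> H; exact: (@cvg_unique _ (@Rhausdorff R) _ _ _ _ H (@cvg_cst _ _ _ _ _)).
- move=> u v u0 uv; have v0 := le_trans u0 uv.
  apply: ler_cvg_to (fl u u0) (fl v v0) _.
  near=> e; have e0 : 0 < e by near: e; exact: nbhs_right_gt.
  rewrite ler_wpM2l ?invr_ge0 ?mulr_ge0 ?(ltW e0)//.
  have fin t : (lebesgue_measure [set s : R | (0 <= s <= t)%R /\ (`|f s| < e)%R] < +oo)%E.
    apply: (@le_lt_trans _ _ (lebesgue_measure `[0, t]%classic)).
      apply: le_measure; rewrite ?inE//; first exact: measurable_occupation.
      by move=> s /= [st _]; rewrite in_itv.
    by rewrite lebesgue_measure_itv/=; case: ifP => _; rewrite ?ltry.
  apply: fine_le; rewrite ?ge0_fin_numE//.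
  apply: le_measure; rewrite ?inE; try exact: measurable_occupation.
  by move=> s /= [/andP[s0 su] sf]; rewrite s0 (le_trans su).
- move=> u v u0 uv fn; have v0 := le_trans u0 uv.
  have nc : continuous (fun s => `|f s|).
    by move=> t; apply: (@continuous_comp _ _ _ f (@Num.norm _ _)); [exact: fc|exact: norm_continuous].
  have [c /[!in_itv]/= cuv cmin] := EVT_min uv (continuous_subspaceT nc).
  have m0 : 0 < `|f c| by rewrite normr_gt0; apply/eqP; exact: fn.
  apply: (@cvg_unique _ (@Rhausdorff R) _ _ _ _ (fl v v0)).
  apply: cvg_trans (fl u u0); apply: near_eq_cvg; near=> e.
  have em : e < `|f c| by near: e; exact: nbhs_right_lt.
  congr (_ * fine (lebesgue_measure _)); apply/seteqP; split => s /= [/andP[s0 su] sf].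
    by rewrite s0 (le_trans su).
  split=> //; rewrite s0 leNgt; apply/negP => us.
  have := cmin s; rewrite in_itv/= (ltW us) su => /(_ isT).
  by rewrite leNgt (lt_trans sf em).
Unshelve. all: by end_near. Qed.

Lemma skew_brownian_motion_system : exists W L G,
  sbm_system P (extend_left X) W L G x0 (2 * beta - 1) /\
  (forall t A, 0 <= t -> natural_filtration X t A -> G t A).
Proof.
have [mX Xc [W [l [[mW Wc W0 Wn Wi] lt Xa XE]]]] := hX.
pose gam := 2 * beta - 1.
have gam0 : 0 < gam by move: hbeta; rewrite /gam; lra.
pose X' := extend_left X; pose W' := extend_left W.
(* The local time is given only almost surely. Solving the equation for it, possible as [gam > 0],
   yields a version that is adapted, continuous and satisfies the equation for every [w]. *)
pose L t w := (X' t w - x0 - W' t w) / gam.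
(* Augmented events need not be measurable: [P.-negligible] contains all the
   subsets of null sets. *)
pose G s : set_system T := [set A | measurable A /\ augmented_filtration P W s A].
have X'c w : continuous (X'^~ w) by exact: continuous_extend_left (Xc w).
have W'c w : continuous (W'^~ w) by exact: continuous_extend_left (Wc w).
have sG s : sigma_algebra setT (G s).
  split.
  - by split=> //; exact: sigma_algebra0.
  - move=> A [mA HA]; split; first by rewrite setTD; exact: measurableC.
    by have [_ + _] := @smallest_sigma_algebra _ setT (past_events W s `|` P.-negligible); apply.
  - move=> F HF; split; first by apply: bigcupT_measurable => n; have [] := HF n.
    by apply: sigma_algebra_bigcup => n; have [] := HF n.
have augm s t : s <= t -> augmented_filtration P W s `<=` augmented_filtration P W t.
  move=> st; apply: sub_sigma_algebra2 => A [HA|HA]; [left|by right].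
  exact: past_events_mono HA.
have GX s : 0 <= s -> measurable_fun [set: g_sigma_algebraType (G s)]
    (X' s : g_sigma_algebraType (G s) -> R).
  move=> s0 _ B mB; rewrite setTI (sub_measurableE (sG s)).
  have -> : (X' s : T -> R) = X s by apply/funext => w; exact: extend_left_ge0.
  by split; [rewrite -[X in measurable X]setTI; exact: mX|exact: Xa].
have GW s : 0 <= s -> measurable_fun [set: g_sigma_algebraType (G s)]
    (W' s : g_sigma_algebraType (G s) -> R).
  move=> s0 _ B mB; rewrite setTI (sub_measurableE (sG s)).
  have -> : (W' s : T -> R) = W s by apply/funext => w; exact: extend_left_ge0.
  split; first by rewrite -[X in measurable X]setTI; exact: mW.
  apply: sub_sigma_algebra; left; exists s => /=; first by rewrite in_itv/= s0 lexx.
  by exists B => //; rewrite setTI.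
exists W', L, G; split; last first.
  move=> t A t0 HA; split; first exact: natural_measurable HA.
  move: A HA; apply: smallest_sub; first exact: smallest_sigma_algebra.
  move=> A [u /=]; rewrite in_itv/= => /andP[u0 ut] [B mB <-].
  by rewrite setTI; apply: (augm u t ut); exact: Xa.
split => //.
- by move=> s s0 A [].
- by move=> s t s0 st A [mA HA]; split=> //; exact: augm HA.
- move=> w t; apply: cvgM; last exact: cvg_cst.
  apply: cvgB; last exact: W'c.
  by apply: cvgB; [exact: X'c|exact: cvg_cst].
- move=> s s0; apply: measurable_funM => //; apply: measurable_funB; last exact: GW.
  by apply: measurable_funB => //; exact: GX.
- move=> w u v; rewrite -/gam -/X' /L -mulrBl mulrC divfK ?gt_eqF//.
  by move: (X' _ _) (X' _ _) (W' _ _) (W' _ _) => *; ring.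
- move=> s t A B s0 st [mA HA] mB; have t0 := le_lt_trans s0 st.
  have -> : (fun w => W' t w - W' s w) = (fun w => W t w - W s w).
    by apply/funext => w; rewrite /W' !extend_left_ge0// ltW.
  have mE : measurable ((fun w => W t w - W s w) @^-1` B).
    by rewrite -[X in measurable X]setTI; apply: measurable_funB => //; apply: mW => //; exact: ltW.
  have := augmented_indep mW mA HA mE (fun B' HB' => Wi s t B' B s0 st HB' mB).
  by rewrite (Wn s t B s0 st mB).
- apply: filterS3 W0 lt XE => w Ww lw Xw.
  have Ll t : 0 <= t -> L t w = l t w.
    move=> t0; rewrite /L /X' /W' !extend_left_ge0// Xw// -/gam.
    have -> : x0 + W t w + gam * l t w - x0 - W t w = l t w * gam by ring.
    by rewrite mulfK// gt_eqF.
  have lX' t : 0 <= t -> (2 * e)^-1 *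
       fine (lebesgue_measure [set s : R | 0 <= s <= t /\ `|X' s w| < e])
     @[e --> 0^'+] --> l t w.
    move=> t0; rewrite (_ : (fun e : R => _) = (fun e : R => (2 * e)^-1 *
       fine (lebesgue_measure [set s : R | 0 <= s <= t /\ `|X s w| < e]))); first exact: lw.
    apply/funext => e; congr (_ * fine (lebesgue_measure _)).
    by apply/seteqP; split => s /= [/andP[s0 st]]; rewrite /X' extend_left_ge0// s0.
  have [l0 lm lf] := local_time_path (X'c w) lX'.
  split.
  + by rewrite /X' extend_left_ge0// Xw// Ww l0 mulr0 !addr0.
  + by rewrite Ll.
  + by move=> u v u0 uv; rewrite !Ll ?lm// (le_trans u0).
  + by move=> u v u0 uv H; rewrite !Ll ?(le_trans u0)//; exact: lf.
  + move=> t t0 eta eta0; rewrite Ll//.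
    exact: (occ_cvg (X'c w) (lX' t t0) eta0).
Qed.

End construction.

(** * Gluing *)

Section gluing.
Context {R : realType}.
Implicit Types (f g v dw D dD : R -> R) (r : R).

Lemma is_derive_slope f (x l : R) :
  is_derive x (1 : R) f l <->
  forall e : R, 0 < e -> exists2 dl : R, 0 < dl & forall y, `|y - x| < dl ->
    `|f y - f x - l * (y - x)| <= e * `|y - x|.
Proof.
split.
  move=> /is_derive1_caratheodory[h [hE hc hx]] e e0.
  have /cvgrPdist_le/(_ _ e0)[dl /= dl0 H] := hc; exists dl => // y yx.
  rewrite hE -mulrBl normrM ler_wpM2r// distrC -hx; apply: H.
  by rewrite /= distrC.
move=> H.
have cv : h^-1 *: (f (h *: (1 : R) + x) - f x) @[h --> 0^'] --> l.
  apply/cvgrPdist_le => /= e e0; have [dl dl0 Hd] := H e e0.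
  exists dl => //= h /=; rewrite sub0r normrN => hd h0.
  rewrite /GRing.scale/= mulr1.
  have := Hd (h + x); rewrite addrK => /(_ hd) hh.
  rewrite distrC -(ler_pM2r (x := `|h|)) ?normr_gt0// -normrM mulrBl.
  by rewrite mulrAC mulVf// mul1r.
apply: DeriveDef; first by apply/cvg_ex; exists l.
exact: cvg_lim cv.
Qed.

Lemma is_derive_glue f f1 f2 (x l : R) :
  is_derive x (1 : R) f1 l -> is_derive x (1 : R) f2 l ->
  (exists2 dl : R, 0 < dl & forall y, `|y - x| < dl ->
    (y <= x -> f y = f1 y) /\ (x <= y -> f y = f2 y)) ->
  is_derive x (1 : R) f l.
Proof.
move=> /is_derive_slope d1 /is_derive_slope d2 [dl0 dl00 Hf].
apply/is_derive_slope => e e0.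
have [dl1 dl10 H1] := d1 e e0; have [dl2 dl20 H2] := d2 e e0.
exists (Num.min dl0 (Num.min dl1 dl2)); first by rewrite !lt_min dl00 dl10.
move=> y; rewrite !lt_min => /andP[y0 /andP[y1 y2]].
have xx : `|x - x| < dl0 by rewrite subrr normr0.
have [Hx1 Hx2] := Hf x xx.
have [Hy1 Hy2] := Hf y y0.
have [yx|xy] := leP y x; first by rewrite Hy1// Hx1//; exact: H1.
by rewrite Hy2 ?(ltW xy)// Hx2//; exact: H2.
Qed.

Lemma is_derive_local f f1 (x l : R) : is_derive x (1 : R) f1 l ->
  (exists2 dl : R, 0 < dl & forall y, `|y - x| < dl -> f y = f1 y) ->
  is_derive x (1 : R) f l.
Proof.
move=> d1 [dl dl0 H]; apply: (is_derive_glue d1 d1); exists dl => // y yx.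
by split=> _; exact: H.
Qed.

Lemma near_left (c x : R) : x < c ->
  exists2 dl : R, 0 < dl & forall y, `|y - x| < dl -> y < c.
Proof.
move=> xc; exists (c - x); rewrite ?subr_gt0// => y.
by rewrite ltr_norml => /andP[_ ?]; lra.
Qed.

Lemma near_right (c x : R) : c < x ->
  exists2 dl : R, 0 < dl & forall y, `|y - x| < dl -> c < y.
Proof.
move=> xc; exists (x - c); rewrite ?subr_gt0// => y.
by rewrite ltr_norml => /andP[? _]; lra.
Qed.

(* The integrated form of [dw' <= 2 r v]. *)
Definition concave_on (r : R) v dw (q p : R) :=
  forall S, (forall s, q <= s <= p -> v s <= S) -> dw p - dw q <= (p - q) * (2 * r * S).

Lemma concave_on_trans r v dw (q c p : R) : q <= c -> c <= p ->
  concave_on r v dw q c -> concave_on r v dw c p -> concave_on r v dw q p.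
Proof.
move=> qc cp H1 H2 S HS.
have := H1 S; have := H2 S => {}H2 {}H1.
have : dw c - dw q <= (c - q) * (2 * r * S).
  by apply: H1 => s /andP[s1 s2]; apply: HS; rewrite s1 (le_trans s2).
have : dw p - dw c <= (p - c) * (2 * r * S).
  by apply: H2 => s /andP[s1 s2]; apply: HS; rewrite s2 (le_trans _ s1).
by move: (2 * r * S) => K *; lra.
Qed.

Lemma concave_on_glue r v dw (c : R) (U : R -> Prop) :
  (forall q p, q <= p -> p <= c -> concave_on r v dw q p) ->
  (forall q p, c <= q -> q <= p -> U p -> concave_on r v dw q p) ->
  forall q p, q <= p -> U p -> concave_on r v dw q p.
Proof.
move=> H1 H2 q p qp Up.
have [pc|/ltW cp] := leP p c; first exact: H1.
have [cq|/ltW qc] := leP c q; first exact: H2.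
by apply: (concave_on_trans qc cp); [exact: H1|exact: H2].
Qed.

Lemma concave_on_derive r v dw D dD (q p : R) : 0 < r -> q <= p ->
  {within `[q, p], continuous D} ->
  (forall x, q < x < p -> is_derive x (1 : R) D (dD x)) ->
  (forall x, q < x < p -> dD x <= 2 * r * v x) ->
  dw p - dw q = D p - D q -> concave_on r v dw q p.
Proof.
move=> r0 qp Dc Dd Dv E S HS; rewrite E.
move: qp; rewrite le_eqVlt => /predU1P[->|qp]; first by rewrite !subrr mul0r.
have [c cqp ->] := @MVT _ D dD q p qp (fun x xqp => Dd x xqp) Dc.
move: cqp; rewrite in_itv/= => cqp; rewrite mulrC ler_wpM2l ?subr_ge0 ?(ltW qp)//.
rewrite (le_trans (Dv c cqp))// ler_wpM2l ?mulr_ge0 ?(ltW r0)//.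
by apply: HS; move: cqp => /andP[/ltW -> /ltW].
Qed.

End gluing.

(** * Solutions on the two half-lines and the transmission condition at 0 *)

Section exponentials.
Context {R : realType}.
Variables (beta r : R).
Hypotheses (hbeta : 1 / 2 < beta < 1) (r0 : 0 < r).

Let th : R := Num.sqrt (2 * r).
Let gam : R := 2 * beta - 1.

Lemma rate_gt0 : 0 < th.
Proof. by rewrite sqrtr_gt0 mulr_gt0. Qed.

Lemma rate_sqr : th * th = 2 * r.
Proof. by rewrite -expr2 sqr_sqrtr// mulr_ge0// ltW. Qed.

Lemma is_derive_expRM (k x : R) :
  is_derive x (1 : R) (fun y => expR (k * y)) (k * expR (k * x)).
Proof.
have d1 : is_derive x (1 : R) (fun y : R => k * y) k.
  apply/is_derive_slope => e e0; exists 1 => // y _.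
  by rewrite [X in `|X|](_ : _ = 0) ?normr0 ?mulr_ge0// ?(ltW e0)//; ring.
have := @is_derive1_comp R expR (fun y => k * y) x _ _ (is_derive_expR _) d1.
by rewrite mulrC.
Qed.

Definition two_exp (A B x : R) := A * expR (th * x) + B * expR (- th * x).

Lemma is_derive_two_exp (A B x : R) :
  is_derive x (1 : R) (two_exp A B) (two_exp (th * A) (- (th * B)) x).
Proof.
have d1 := is_derive_expRM th x; have d2 := is_derive_expRM (- th) x.
have := is_deriveD (is_deriveZ A d1) (is_deriveZ B d2).
rewrite /GRing.scale/= => H; apply: (is_derive_eq H).
by rewrite /two_exp; ring.
Qed.

Definition kinked (A1 B1 A2 B2 x : R) : R :=
  if x <= 0 then two_exp A1 B1 x else two_exp A2 B2 x.

Definition kink (A1 B1 A2 B2 : R) : R := th * ((A2 - B2) - (A1 - B1)).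

(** The derivative minus [Del / 2] times the sign of [x]; at 0 both branches equal the mean of the
    one-sided slopes. *)
Definition kinked_deriv (A1 B1 A2 B2 x : R) : R :=
  if x <= 0 then two_exp (th * A1) (- (th * B1)) x + kink A1 B1 A2 B2 / 2
  else two_exp (th * A2) (- (th * B2)) x - kink A1 B1 A2 B2 / 2.

Lemma two_exp0 (A B : R) : two_exp A B 0 = A + B.
Proof. by rewrite /two_exp !mulr0 expR0 !mulr1. Qed.

Section kinked.
Variables A1 B1 A2 B2 : R.
Hypothesis AB : A1 + B1 = A2 + B2.
Let v := kinked A1 B1 A2 B2.
Let dw := kinked_deriv A1 B1 A2 B2.
Let Del := kink A1 B1 A2 B2.

Lemma kinked_ge0 (x : R) : 0 <= x -> v x = two_exp A2 B2 x.
Proof.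
rewrite /v /kinked le_eqVlt => /predU1P[<-|x0]; first by rewrite lexx !two_exp0.
by rewrite leNgt x0.
Qed.

Lemma kinked_deriv_ge0 (x : R) : 0 <= x ->
  dw x = two_exp (th * A2) (- (th * B2)) x - Del / 2.
Proof.
rewrite /dw /kinked_deriv le_eqVlt => /predU1P[<-|x0]; last by rewrite leNgt x0.
by rewrite lexx !two_exp0 /Del /kink; lra.
Qed.

Lemma supersolution_kinked : supersolution r Del v dw.
Proof.
have D1 (x : R) : is_derive x (1 : R) (fun x => two_exp A1 B1 x + Del / 2 * x)
    (two_exp (th * A1) (- (th * B1)) x + Del / 2).
  have := is_deriveD (is_derive_two_exp A1 B1 x) (is_deriveZ (Del / 2) (is_derive_id x (1 : R))).
  by rewrite /GRing.scale/= => H; apply: (is_derive_eq H); rewrite mulr1.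
have D2 (x : R) : is_derive x (1 : R) (fun x => two_exp A2 B2 x - Del / 2 * x)
    (two_exp (th * A2) (- (th * B2)) x - Del / 2).
  have := is_deriveB (is_derive_two_exp A2 B2 x) (is_deriveZ (Del / 2) (is_derive_id x (1 : R))).
  by rewrite /GRing.scale/= => H; apply: (is_derive_eq H); rewrite mulr1.
split => [x|].
  have E1 y : y <= 0 -> v y - Del / 2 * `|y| = two_exp A1 B1 y + Del / 2 * y.
    by move=> y0; rewrite /v /kinked y0 ler0_norm//; ring.
  have E2 y : 0 <= y -> v y - Del / 2 * `|y| = two_exp A2 B2 y - Del / 2 * y.
    by move=> y0; rewrite kinked_ge0// ger0_norm.
  case: (ltgtP x 0) => [xn|xp|x0].
  - rewrite /dw /kinked_deriv (ltW xn); apply: (is_derive_local (D1 x)).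
    by have [dl dl0 H] := near_left xn; exists dl => // y /H /ltW /E1.
  - rewrite kinked_deriv_ge0 ?(ltW xp)//; apply: (is_derive_local (D2 x)).
    by have [dl dl0 H] := near_right xp; exists dl => // y /H /ltW /E2.
  - have D1' := D1 x; have D2' := D2 x.
    rewrite -kinked_deriv_ge0 ?x0// in D2'.
    have dE : dw 0 = two_exp (th * A1) (- (th * B1)) 0 + Del / 2.
      by rewrite /dw /kinked_deriv lexx.
    rewrite {2}x0 -dE in D1'; rewrite x0 in D1' D2' *.
    apply: (is_derive_glue D1' D2'); exists 1 => // y _.
    by split=> y0; [exact: E1|exact: E2].
have second (A B q p : R) (c : R) : q <= p ->
    (forall x, q <= x <= p -> v x = two_exp A B x) ->
    dw q = two_exp (th * A) (- (th * B)) q + c ->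
    dw p = two_exp (th * A) (- (th * B)) p + c -> concave_on r v dw q p.
  move=> qp vE dq dp.
  apply: (@concave_on_derive R r v dw (two_exp (th * A) (- (th * B)))
    (two_exp (th * (th * A)) (- (th * - (th * B)))) q p r0 qp).
  - apply: continuous_subspaceT; exact: is_derive_continuous (is_derive_two_exp _ _).
  - by move=> x _; exact: is_derive_two_exp.
  - move=> x /andP[/ltW q1 /ltW q2]; rewrite vE ?q1// -rate_sqr /two_exp.
    by rewrite le_eqVlt; apply/orP; left; apply/eqP; ring.
  - by rewrite dq dp; ring.
move=> q p S qp HS.
apply: (@concave_on_glue R r v dw 0 (fun=> True) _ _ q p qp I S HS).
  move=> q' p' qp' p0; apply: (second A1 B1 q' p' (Del / 2) qp').
  - by move=> x /andP[_ x1]; rewrite /v /kinked (le_trans x1).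
  - by rewrite /dw /kinked_deriv (le_trans qp' p0).
  - by rewrite /dw /kinked_deriv p0.
move=> q' p' q0 qp' _; apply: (second A2 B2 q' p' (- (Del / 2)) qp').
- by move=> x /andP[x1 _]; rewrite kinked_ge0// (le_trans q0).
- by rewrite kinked_deriv_ge0.
- by rewrite kinked_deriv_ge0// (le_trans q0).
Qed.

(** With [dw 0] the mean and [Del] the difference of the one-sided slopes, [gam * dw 0 + Del / 2] is
    [beta v'(0+) - (1 - beta) v'(0-)]: it vanishes when the derivative with respect to the scale
    function is continuous. *)
Lemma kinked_jump : beta * (A2 - B2) = (1 - beta) * (A1 - B1) ->
  gam * dw 0 + Del / 2 = 0.
Proof.
rewrite /dw /kinked_deriv lexx two_exp0 /Del /kink /gam => E.
have -> : (2 * beta - 1) * (th * A1 + - (th * B1) + th * (A2 - B2 - (A1 - B1)) / 2) +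
   th * (A2 - B2 - (A1 - B1)) / 2 =
   th * (beta * (A2 - B2) - (1 - beta) * (A1 - B1)) by field.
by rewrite E subrr mulr0.
Qed.

End kinked.

Let hb1 : 1 / 2 < beta. Proof. by case/andP: hbeta. Qed.
Let hb2 : beta < 1. Proof. by case/andP: hbeta. Qed.
Let beta0 : beta != 0. Proof. by rewrite gt_eqF//; move: hb1; lra. Qed.
Let beta1 : 1 - beta != 0. Proof. by rewrite gt_eqF//; move: hb2; lra. Qed.

Definition lin (a b x : R) : R := a * psi beta r x + b * phi beta r x.

(** Coefficients of [exp(th x)] (letter A) and [exp(- th x)] (letter B) in [a psi + b phi], on the
    negative half-line (index 1) and the positive one (index 2). *)
Definition linA1 (a b : R) := a + b * (1 - 2 * beta) / (2 * (1 - beta)).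
Definition linB1 (b : R) := b / (2 * (1 - beta)).
Definition linA2 (a : R) := a / (2 * beta).
Definition linB2 (a b : R) := a * (1 - (2 * beta)^-1) + b.

Lemma linAB (a b : R) : linA1 a b + linB1 b = linA2 a + linB2 a b.
Proof. by rewrite /linA1 /linB1 /linA2 /linB2; field; rewrite beta0 beta1. Qed.

Lemma linE (a b x : R) :
  lin a b x = kinked (linA1 a b) (linB1 b) (linA2 a) (linB2 a b) x.
Proof.
have [x0|x0] := leP 0 x.
  rewrite (kinked_ge0 (linAB a b))// /lin /psi /phi x0 -/th /two_exp /linA2 /linB2.
  by move: (expR _) (expR _) => *; field.
rewrite /lin /psi /phi /kinked (ltW x0) leNgt x0/= -/th /two_exp /linA1 /linB1.
by move: (expR _) (expR _) => *; field.
Qed.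

Lemma lin_le0 (a b x : R) : x <= 0 -> lin a b x = two_exp (linA1 a b) (linB1 b) x.
Proof. by move=> x0; rewrite linE /kinked x0. Qed.

Lemma lin_ge0 (a b x : R) : 0 <= x -> lin a b x = two_exp (linA2 a) (linB2 a b) x.
Proof. by move=> x0; rewrite linE (kinked_ge0 (linAB a b)). Qed.

Definition lin_kink (a b : R) := kink (linA1 a b) (linB1 b) (linA2 a) (linB2 a b).
Definition lin_deriv (a b : R) := kinked_deriv (linA1 a b) (linB1 b) (linA2 a) (linB2 a b).

Lemma supersolution_lin (a b : R) : supersolution r (lin_kink a b) (lin a b) (lin_deriv a b).
Proof.
rewrite (_ : lin a b = kinked (linA1 a b) (linB1 b) (linA2 a) (linB2 a b)).
  exact: supersolution_kinked (linAB a b).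
by apply/funext => x; exact: linE.
Qed.

Lemma lin_jump (a b : R) : (2 * beta - 1) * lin_deriv a b 0 + lin_kink a b / 2 = 0.
Proof.
apply: kinked_jump; rewrite /linA1 /linB1 /linA2 /linB2; field.
by rewrite beta0 beta1.
Qed.

Lemma psi_gt0 (x : R) : 0 < psi beta r x.
Proof.
rewrite /psi; case: ifP => _; last exact: expR_gt0.
have b2 : 0 < (2 * beta)^-1 by rewrite invr_gt0; move: hb1; lra.
have b3 : (2 * beta)^-1 <= 1 by rewrite invf_le1; move: hb1; lra.
by rewrite ltr_pwDl// ?mulr_gt0 ?expR_gt0// mulr_ge0 ?expR_ge0// subr_ge0.
Qed.

Lemma phi_gt0 (x : R) : 0 < phi beta r x.
Proof.
rewrite /phi; case: ifPn => [_|]; first exact: expR_gt0.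
rewrite -ltNge => x0; rewrite mulr_gt0 ?invr_gt0//; first by move: hb2; lra.
have H : expR (Num.sqrt (2 * r) * x) <= expR (- Num.sqrt (2 * r) * x).
  rewrite ler_expR mulNr -/th; have : th * x < 0 by rewrite pmulr_rlt0// rate_gt0.
  by lra.
have := expR_gt0 (Num.sqrt (2 * r) * x).
move: (expR _) (expR _) H => A B *; move: hb1 hb2 => *; nra.
Qed.

(** The value 1 at the origin separates: [psi y1 < 1 < psi y2] and [phi y2 < 1 < phi y1]. *)
Lemma wronskian_gt0 (y1 y2 : R) : y1 < 0 -> 0 < y2 ->
  0 < psi beta r y2 * phi beta r y1 - phi beta r y2 * psi beta r y1.
Proof.
move=> y10 y20.
have e1 : expR (th * y1) < 1 by rewrite -expR0 ltr_expR pmulr_rlt0// rate_gt0.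
have e2 : 1 < expR (th * y2) by rewrite -expR0 ltr_expR mulr_gt0// rate_gt0.
have E1 : expR (- th * y1) = (expR (th * y1))^-1 by rewrite mulNr expRN.
have E2 : expR (- th * y2) = (expR (th * y2))^-1 by rewrite mulNr expRN.
have P1 : psi beta r y1 < 1 by rewrite /psi leNgt y10/=.
have F2 : phi beta r y2 < 1.
  by rewrite /phi (ltW y20) -/th E2 invf_lt1// (lt_trans _ e2).
have F1 : 1 < phi beta r y1.
  rewrite /phi leNgt y10/= -/th E1 ltr_pdivlMl; last by move: hb2; lra.
  have ei : 1 < (expR (th * y1))^-1 by rewrite invf_gt1 ?expR_gt0.
  move: e1 ei (expR_gt0 (th * y1)); set A := expR _; set B := A^-1.
  clearbody B; clearbody A => *; move: hb1 hb2 => *; nra.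
have P2 : 1 < psi beta r y2.
  rewrite /psi (ltW y20) -/th E2; move: e2; set u := expR _ => u1.
  have u0 : 0 < u by exact: lt_trans u1.
  rewrite -subr_gt0.
  have -> : (2 * beta)^-1 * u + (1 - (2 * beta)^-1) * u^-1 - 1 =
      (2 * beta)^-1 * u^-1 * ((u - 1) * (u - gam)).
    by rewrite /gam; field; rewrite beta0 gt_eqF.
  have b2 : 0 < 2 * beta by move: hb1; lra.
  have ug : gam < u by rewrite (lt_trans _ u1)// /gam; move: hb2; lra.
  by rewrite !mulr_gt0 ?invr_gt0 ?subr_gt0.
have := psi_gt0 y1; have := phi_gt0 y2; nra.
Qed.

End exponentials.

(** * The operators [L_psi] and [L_phi] on each half-line *)

Section wronskians.
Context {R : realType}.
Variables (beta r : R).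
Hypotheses (hbeta : 1 / 2 < beta < 1) (r0 : 0 < r).
Let th : R := Num.sqrt (2 * r).
Let hb1 : 1 / 2 < beta. Proof. by case/andP: hbeta. Qed.
Let hb2 : beta < 1. Proof. by case/andP: hbeta. Qed.
Let beta0 : beta != 0. Proof. by rewrite gt_eqF//; move: hb1; lra. Qed.
Let beta1 : 1 - beta != 0. Proof. by rewrite gt_eqF//; move: hb2; lra. Qed.

Lemma is_derive_div (f h : R -> R) (x f' h' : R) : h x != 0 ->
  is_derive x (1 : R) f f' -> is_derive x (1 : R) h h' ->
  is_derive x (1 : R) (fun z => f z / h z) ((f' * h x - f x * h') / h x ^+ 2).
Proof.
move=> hx fd hd.
have := is_deriveM fd (is_deriveV hx hd).
rewrite /GRing.scale/= => H; apply: (is_derive_eq H).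
by field.
Qed.

Lemma is_derive_lin_lt0 (a b x : R) : x < 0 -> is_derive x (1 : R) (lin beta r a b)
  (two_exp r (th * linA1 beta a b) (- (th * linB1 beta b)) x).
Proof.
move=> x0; apply: (is_derive_local (is_derive_two_exp r _ _ x)).
have [dl dl0 H] := near_left x0; exists dl => // y /H /ltW y0.
exact: lin_le0.
Qed.

Lemma is_derive_lin_gt0 (a b x : R) : 0 < x -> is_derive x (1 : R) (lin beta r a b)
  (two_exp r (th * linA2 beta a) (- (th * linB2 beta a b)) x).
Proof.
move=> x0; apply: (is_derive_local (is_derive_two_exp r _ _ x)).
have [dl dl0 H] := near_right x0; exists dl => // y /H /ltW y0.
exact: lin_ge0.
Qed.

Lemma psiE : psi beta r = lin beta r 1 0.
Proof. by apply/funext => x; rewrite /lin mul1r mul0r addr0. Qed.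

Lemma phiE : phi beta r = lin beta r 0 1.
Proof. by apply/funext => x; rewrite /lin mul1r mul0r add0r. Qed.

Lemma derive1_scale_lt0 (x : R) : x < 0 -> derive1 (scale beta) x = (1 - beta)^-1.
Proof.
move=> x0; rewrite derive1E; apply: derive_val.
apply: (is_derive_local (f1 := fun y => y * (1 - beta)^-1)).
  apply/is_derive_slope => e e0; exists 1 => // y _.
  by rewrite [X in `|X|](_ : _ = 0) ?normr0 ?mulr_ge0// ?(ltW e0)//; ring.
have [dl dl0 H] := near_left x0; exists dl => // y /H y0.
by rewrite /scale leNgt y0.
Qed.

Lemma derive1_scale_gt0 (x : R) : 0 < x -> derive1 (scale beta) x = beta^-1.
Proof.
move=> x0; rewrite derive1E; apply: derive_val.
apply: (is_derive_local (f1 := fun y => y * beta^-1)).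
  apply/is_derive_slope => e e0; exists 1 => // y _.
  by rewrite [X in `|X|](_ : _ = 0) ?normr0 ?mulr_ge0// ?(ltW e0)//; ring.
have [dl dl0 H] := near_right x0; exists dl => // y /H /ltW y0.
by rewrite /scale y0.
Qed.

Lemma derive1_div (f h : R -> R) (x s f' h' : R) : 0 < h x ->
  is_derive x (1 : R) f f' -> is_derive x (1 : R) h h' ->
  h x ^+ 2 / s^-1 * derive1 (fun z => f z / h z) x = s * (f' * h x - f x * h').
Proof.
move=> hx fd hd; rewrite derive1E.
have hx0 : h x != 0 by rewrite gt_eqF.
have H := is_derive_div hx0 fd hd; rewrite (@derive_val _ _ _ _ _ _ _ H) invrK.
by field.
Qed.

Variables (f : R -> R) (x f' : R).
Hypothesis fd : is_derive x (1 : R) f f'.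
Let p := expR (th * x) * (f' - th * f x).
Let q := expR (- th * x) * (f' + th * f x).

Lemma L_psi_lt0 : x < 0 -> L_psi beta r f x = (1 - beta) * p.
Proof.
move=> x0; rewrite /L_psi derive1_scale_lt0//.
have := is_derive_lin_lt0 1 0 x0; rewrite -psiE => d1.
rewrite (derive1_div _ (psi_gt0 r hbeta x) fd d1).
rewrite psiE lin_le0// ?(ltW x0)// /two_exp /linA1 /linB1 -/th /p.
by move: (expR _) (expR _) => *; field.
Qed.

Lemma L_phi_lt0 : x < 0 -> L_phi beta r f x = (q - (2 * beta - 1) * p) / 2.
Proof.
move=> x0; rewrite /L_phi derive1_scale_lt0//.
have := is_derive_lin_lt0 0 1 x0; rewrite -phiE => d1.
rewrite (derive1_div _ (phi_gt0 hbeta r0 x) fd d1).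
rewrite phiE lin_le0// ?(ltW x0)// /two_exp /linA1 /linB1 -/th /p /q.
by move: (expR _) (expR _) => *; field.
Qed.

Lemma L_psi_gt0 : 0 < x -> L_psi beta r f x = (p + (2 * beta - 1) * q) / 2.
Proof.
move=> x0; rewrite /L_psi derive1_scale_gt0//.
have := is_derive_lin_gt0 1 0 x0; rewrite -psiE => d1.
rewrite (derive1_div _ (psi_gt0 r hbeta x) fd d1).
rewrite psiE lin_ge0// ?(ltW x0)// /two_exp /linA2 /linB2 -/th /p /q.
by move: (expR _) (expR _) => *; field.
Qed.

Lemma L_phi_gt0 : 0 < x -> L_phi beta r f x = beta * q.
Proof.
move=> x0; rewrite /L_phi derive1_scale_gt0//.
have := is_derive_lin_gt0 0 1 x0; rewrite -phiE => d1.
rewrite (derive1_div _ (phi_gt0 hbeta r0 x) fd d1).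
rewrite phiE lin_ge0// ?(ltW x0)// /two_exp /linA2 /linB2 -/th /q.
by move: (expR _) (expR _) => *; field.
Qed.

End wronskians.

(** * The candidate value function *)

Section reward.
Context {R : realType}.
Variables (beta r xs eps : R) (g : R -> R).
Hypotheses (hbeta : 1 / 2 < beta < 1) (r0 : 0 < r).
Hypotheses (g_cont : continuous g) (g_mono : {homo g : x y / x <= y}).
Hypothesis g_ge0 : forall x, 0 <= g x.
Hypothesis g_max : forall y, g y / psi beta r y <= g xs / psi beta r xs.
Hypotheses (hxs : xs < 0) (g_C2 : C2_from xs g).
Hypothesis g_slope : 0 < beta * derive1 g 0
             < (1 - beta) * Num.sqrt (2 * r)
               * expR (- Num.sqrt (2 * r) * xs) * g xs.
Hypothesis eps0 : 0 < eps.
Hypothesis g_super : forall x, xs <= x ->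
  second_derivative_from xs g x - 2 * r * g x < - eps.

Let th : R := Num.sqrt (2 * r).
Let gam : R := 2 * beta - 1.
Let hb1 : 1 / 2 < beta. Proof. by case/andP: hbeta. Qed.
Let hb2 : beta < 1. Proof. by case/andP: hbeta. Qed.
Let th0 : 0 < th. Proof. exact: rate_gt0. Qed.
Let thth : th * th = 2 * r. Proof. exact: rate_sqr. Qed.

Let g1 : R -> R := derive1 g.
Let g2 : R -> R := second_derivative_from xs g.

Let gd x : xs <= x -> is_derive x (1 : R) g (g1 x).
Proof.
move=> x0; have [H _ _] := g_C2; rewrite /g1 derive1E.
by apply: DeriveDef => //; exact: H.
Qed.

Let g1_slope x : xs <= x -> forall e : R, 0 < e -> exists2 dl : R, 0 < dl &
  forall y, xs <= y -> `|y - x| < dl -> `|g1 y - g1 x - g2 x * (y - x)| <= e * `|y - x|.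
Proof.
move=> x0 e e0; have [_ /(_ x x0) H _] := g_C2.
have /cvgrPdist_le/(_ _ e0)[dl /= dl0 Hd] := H.
exists dl => // y y0 yx.
have [->|yx0] := eqVneq y x; first by rewrite !subrr mulr0 subrr normr0 mulr0.
have := Hd y; rewrite /= distrC => /(_ yx yx0); rewrite in_itv/= andbT => /(_ y0).
rewrite distrC -(ler_pM2r (x := `|y - x|)) ?normr_gt0 ?subr_eq0// -normrM mulrBl.
by rewrite divfK ?subr_eq0.
Qed.

Let g1d x : xs < x -> is_derive x (1 : R) g1 (g2 x).
Proof.
move=> x0; apply/is_derive_slope => e e0.
have [dl dl0 H] := g1_slope (ltW x0) e0; have [dl' dl'0 H'] := near_right x0.
exists (Num.min dl dl'); first by rewrite lt_min dl0.
by move=> y; rewrite lt_min => /andP[y1 /H' /ltW y2]; exact: H.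
Qed.

(** Continuity is taken within [[xs, +oo[], since at [xs] itself the second derivative is
    one-sided. *)
Let A : set R := `[xs, +oo[.

Let g1c x : xs <= x -> g1 @ within A (nbhs x) --> g1 x.
Proof.
move=> x0; have [dl dl0 H] := g1_slope x0 ltr01.
apply/cvgrPdist_le => /= e e0.
have k0 : 0 < `|g2 x| + 1 by rewrite ltr_wpDl.
exists (Num.min dl (e / (`|g2 x| + 1))) => /=; first by rewrite lt_min dl0 divr_gt0.
move=> y /=; rewrite lt_min distrC => /andP[yd ye]; rewrite /A/= in_itv/= andbT => y0.
have := H y y0 yd; rewrite mul1r => Hy.
have : `|g2 x * (y - x)| = `|g2 x| * `|y - x| by rewrite normrM.
move: ye; rewrite ltr_pdivlMr// mulrDr mulr1 => ye E.
have -> : g1 x - g1 y = - (g1 y - g1 x - g2 x * (y - x)) - g2 x * (y - x) by ring.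
rewrite (le_trans (ler_normB _ _))// normrN E.
by move: Hy ye; move: `|y - x| `|g2 x| `|_ - _ - _| => *; lra.
Qed.

Let within_c (f : R -> R) x : continuous f -> f @ within A (nbhs x) --> f x.
Proof. by move=> fc; apply: cvg_trans (fc x); apply: cvg_app; exact: cvg_within. Qed.

(* The solution of [v'' = 2 r v] tangent to [g] at [x] is
   [(q exp(th z) - p exp(- th z)) / (2 th)] with [p = pmom x], [q = qmom x]. *)
Definition pmom x := expR (th * x) * (g1 x - th * g x).
Definition qmom x := expR (- th * x) * (g1 x + th * g x).
Notation p := pmom.
Notation q := qmom.

Let expMc (k : R) : continuous (fun y : R => expR (k * y)).
Proof. exact: is_derive_continuous (is_derive_expRM k). Qed.

Let pc x : xs <= x -> p @ within A (nbhs x) --> p x.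
Proof.
move=> x0; apply: cvgM; first exact: (@within_c (fun y => expR (th * y))).
apply: cvgB; first exact: g1c.
by apply: cvgM; [exact: cvg_cst|exact: within_c].
Qed.

Let qc x : xs <= x -> q @ within A (nbhs x) --> q x.
Proof.
move=> x0; apply: cvgM; first exact: (@within_c (fun y => expR (- th * y))).
apply: cvgD; first exact: g1c.
by apply: cvgM; [exact: cvg_cst|exact: within_c].
Qed.

Let G x := g2 x - 2 * r * g x.

Let pd x : xs < x -> is_derive x (1 : R) p (expR (th * x) * G x).
Proof.
move=> x0.
have := is_deriveM (is_derive_expRM th x)
  (is_deriveB (g1d x0) (is_deriveZ th (gd (ltW x0)))).
rewrite /GRing.scale/= => H; apply: (is_derive_eq H).
rewrite -[(g1 - th \*: g) x]/(g1 x - th * g x) /G -thth; ring.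
Qed.

Let qd x : xs < x -> is_derive x (1 : R) q (expR (- th * x) * G x).
Proof.
move=> x0.
have := is_deriveM (is_derive_expRM (- th) x)
  (is_deriveD (g1d x0) (is_deriveZ th (gd (ltW x0)))).
rewrite /GRing.scale/= => H; apply: (is_derive_eq H).
rewrite -[(g1 + th \*: g) x]/(g1 x + th * g x) /G -thth; ring.
Qed.

Let Gneg x : xs <= x -> G x < - eps. Proof. exact: g_super. Qed.

Let subA (f : R -> R) a b : (forall x, xs <= x -> f @ within A (nbhs x) --> f x) ->
  xs <= a -> {within `[a, b], continuous f}.
Proof.
move=> fc a0; apply: (@continuous_subspaceW _ _ _ A).
  by move=> x /=; rewrite /A/= !in_itv/= andbT => /andP[? _]; exact: le_trans a0 _.
by apply/subspace_continuousP => x; rewrite /A/= in_itv/= andbT; exact: fc.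
Qed.

Let mean (f df : R -> R) a b : (forall x, xs <= x -> f @ within A (nbhs x) --> f x) ->
  (forall x, xs < x -> is_derive x (1 : R) f (df x)) ->
  xs <= a -> a < b -> exists2 c, a < c < b & f b - f a = df c * (b - a).
Proof.
move=> fc fd a0 ab.
have fd' x : x \in `]a, b[ -> is_derive x (1 : R) f (df x).
  by rewrite in_itv/= => /andP[ax _]; apply: fd; exact: le_lt_trans ax.
have [c] := MVT ab fd' (@subA f a b fc a0).
by rewrite in_itv/= => cab ->; exists c.
Qed.

Let p_decr a b : xs <= a -> a < b -> p b < p a.
Proof.
move=> a0 ab; have [c /andP[ac cb]] := mean pc pd a0 ab.
have := Gneg (le_trans a0 (ltW ac)); have := expR_gt0 (th * c).
move: (expR _) => E E0 Gc Ep; rewrite -subr_lt0 Ep pmulr_llt0 ?subr_gt0//.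
by rewrite pmulr_rlt0//; move: eps0; lra.
Qed.

Let q_decr a b : xs <= a -> a < b -> q b < q a.
Proof.
move=> a0 ab; have [c /andP[ac cb]] := mean qc qd a0 ab.
have := Gneg (le_trans a0 (ltW ac)); have := expR_gt0 (- th * c).
move: (expR _) => E E0 Gc Ep; rewrite -subr_lt0 Ep pmulr_llt0 ?subr_gt0//.
by rewrite pmulr_rlt0//; move: eps0; lra.
Qed.

(* [L_phi - L_psi], which has the same expression on both half-lines. *)
Let m x := (q x - p x) / 2.

Let mc x : xs <= x -> m @ within A (nbhs x) --> m x.
Proof.
by move=> x0; apply: cvgM; [apply: cvgB; [exact: qc|exact: pc]|exact: cvg_cst].
Qed.

(** [G] is negative and the other factor changes sign at 0, whence the two opposite monotonicities
    of [m]. *)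
Let md x : xs < x -> is_derive x (1 : R) m ((expR (- th * x) - expR (th * x)) / 2 * G x).
Proof.
move=> x0; have := is_deriveM (is_deriveB (qd x0) (pd x0)) (is_derive_cst (2^-1 : R) x (1 : R)).
rewrite /GRing.scale/= => H; apply: (is_derive_eq H).
by move: (expR _) (expR _) => *; ring.
Qed.

Let m_decr a b : xs <= a -> a < b -> b <= 0 -> m b < m a.
Proof.
move=> a0 ab b0; have [c /andP[ac cb] Em] := mean mc md a0 ab.
rewrite -subr_lt0 Em pmulr_llt0 ?subr_gt0//.
have := Gneg (le_trans a0 (ltW ac)) => Gc.
have H : expR (th * c) < expR (- th * c).
  rewrite ltr_expR mulNr; have : th * c < 0 by rewrite pmulr_rlt0// (lt_le_trans cb).
  lra.
by rewrite pmulr_rlt0 ?divr_gt0 ?subr_gt0//; move: eps0; lra.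
Qed.

Let m_incr a b : 0 <= a -> a < b -> m a < m b.
Proof.
move=> a0 ab; have xa : xs <= a by rewrite (le_trans (ltW hxs)).
have [c /andP[ac cb] Em] := mean mc md xa ab.
rewrite -subr_gt0 Em pmulr_lgt0 ?subr_gt0//.
have := Gneg (le_trans xa (ltW ac)) => Gc.
have H : expR (- th * c) < expR (th * c).
  rewrite ltr_expR mulNr; have : 0 < th * c by rewrite mulr_gt0// (le_lt_trans a0).
  lra.
have H2 : (expR (- th * c) - expR (th * c)) / 2 < 0 by lra.
by rewrite nmulr_rgt0//; move: eps0; lra.
Qed.

Let g1_ge0 x : xs <= x -> 0 <= g1 x.
Proof.
move=> x0; rewrite leNgt; apply/negP => gx.
have e0 : 0 < - g1 x / 2 by lra.
have [dl dl0 H] := (is_derive_slope _ _ _).1 (gd x0) _ e0.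
have := H (x + dl / 2); rewrite addrAC subrr add0r => /(_ _).
have d2 : 0 < dl / 2 by rewrite divr_gt0.
rewrite gtr0_norm// ltr_pdivrMr// ltr_pMr// ltr1n => /(_ isT).
have : g x <= g (x + dl / 2) by apply: g_mono; rewrite lerDl ltW.
rewrite ler_norml => gg /andP[_]; nra.
Qed.

Let psixs : psi beta r xs = expR (th * xs).
Proof. by rewrite /psi leNgt hxs. Qed.

Let g_left x : x < 0 -> g x <= g xs * expR (- th * xs) * expR (th * x).
Proof.
move=> x0; have := g_max x; rewrite psixs.
rewrite (_ : psi beta r x = expR (th * x)); last by rewrite /psi leNgt x0.
by rewrite ler_pdivrMr ?expR_gt0// mulNr expRN.
Qed.

Let g_at0 : g 0 <= g xs * expR (- th * xs).
Proof.
have := g_max 0; rewrite psixs (_ : psi beta r 0 = 1) ?divr1; last first.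
  by rewrite /psi lexx !mulr0 expR0 !mulr1 addrC subrK.
by rewrite mulNr expRN.
Qed.

(** Smooth fit: [f = g - c exp(th .)] is nonpositive on [x < 0], vanishes at the interior point [xs]
    and is differentiable there, so its derivative is 0. *)
Let smooth_xs : g1 xs = th * g xs.
Proof.
pose f y := g y - g xs * expR (- th * xs) * expR (th * y).
have fd : is_derive xs (1 : R) f (g1 xs - th * g xs).
  have := is_deriveB (gd (lexx xs)) (is_deriveZ (g xs * expR (- th * xs)) (is_derive_expRM th xs)).
  rewrite /GRing.scale/= => H; apply: (is_derive_eq H).
  rewrite mulrCA mulrA -!mulrA mulNr expRN mulVf ?mulr1// gt_eqF// expR_gt0//.
have fx : f xs = 0.
  by rewrite /f mulNr expRN -mulrA mulVf ?mulr1 ?subrr// gt_eqF// expR_gt0.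
have f0 y : y < 0 -> f y <= 0 by move=> y0; rewrite /f subr_le0; exact: g_left.
set l := g1 xs - th * g xs in fd; suff : l = 0 by rewrite /l; lra.
have [//|l0] := eqVneq l 0; exfalso.
have l2 : 0 < `|l| / 2 by rewrite divr_gt0// normr_gt0.
have [dl dl0 H] := (is_derive_slope _ _ _).1 fd _ l2.
have [dl' dl'0 H'] := near_left hxs.
pose h := Num.min dl dl' / 2.
have h0 : 0 < h by rewrite divr_gt0// lt_min dl0.
have hd : h < Num.min dl dl' by rewrite /h ltr_pdivrMr// ltr_pMr ?ltr1n// lt_min dl0.
move: hd; rewrite lt_min => /andP[hd hd'].
(* A step in the direction in which a nonzero slope would make [f] positive. *)
pose y := xs + Num.sg l * h.
have yx : y - xs = Num.sg l * h by rewrite /y; ring.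
have ny : `|y - xs| = h by rewrite yx normrM normr_sg l0 mul1r gtr0_norm.
have lh : l * (Num.sg l * h) = `|l| * h by rewrite mulrA [l * _]mulrC -normrEsg.
have := H y; rewrite ny fx subr0 => /(_ hd); rewrite yx lh ler_norml => /andP[Hy _].
have := f0 y (H' y _); rewrite ny => /(_ hd').
by move: Hy; move: l2 => l2; nra.
Qed.

Let p_xs : p xs = 0.
Proof. by rewrite /p smooth_xs subrr mulr0. Qed.

Definition fits (x y : R) := [/\ xs < x < 0, 0 < y,
  (1 - beta) * p x = (p y + gam * q y) / 2 & (q x - gam * p x) / 2 = beta * q y].

Lemma fitsE (x y : R) : fits x y <-> [/\ xs < x < 0, 0 < y,
  L_psi beta r g x = L_psi beta r g y & L_phi beta r g x = L_phi beta r g y].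
Proof.
have E : xs < x < 0 -> 0 < y -> [/\ L_psi beta r g x = (1 - beta) * p x,
    L_psi beta r g y = (p y + gam * q y) / 2,
    L_phi beta r g x = (q x - gam * p x) / 2 & L_phi beta r g y = beta * q y].
  move=> /andP[x1 x2] y0; have dx := gd (ltW x1).
  have dy := gd (le_trans (ltW hxs) (ltW y0)).
  by split; [rewrite (L_psi_lt0 r hbeta dx)|rewrite (L_psi_gt0 r hbeta dy)|
    rewrite (L_phi_lt0 hbeta r0 dx)|rewrite (L_phi_gt0 hbeta r0 dy)].
by split=> -[h1 h2]; have [-> -> -> ->] := E h1 h2; split.
Qed.

Let fits_m x y : fits x y -> m x = m y.
Proof. by rewrite /m => -[_ _]; rewrite /gam => h1 h2; lra. Qed.

(* [m] decreases on [xs, 0] and increases on [0, +oo[, so of two solutions the one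
   with the larger [x] has the smaller [y]; but [L_psi] decreases on both sides. *)
Lemma fits_unique (x y x' y' : R) : fits x y -> fits x' y' -> x = x' /\ y = y'.
Proof.
have lt_absurd u t u' t' : fits u t -> fits u' t' -> u < u' -> False.
  move=> H H' uu; have := fits_m H; have := fits_m H'.
  move: H H' => [/andP[u1 u2] t0 E1 E2] [/andP[u1' u2'] t0' E1' E2'] m' m1.
  have mm : m t' < m t by rewrite -m' -m1; exact: m_decr (ltW u1) uu (ltW u2').
  have tt : t' < t.
    rewrite ltNge le_eqVlt; apply/negP => /predU1P[tE|tt].
      by rewrite tE ltxx in mm.
    by have := lt_trans mm (m_incr (ltW t0) tt); rewrite ltxx.
  have t1' := le_trans (ltW hxs) (ltW t0').
  have Hp := p_decr (ltW u1) uu; have Hp2 := p_decr t1' tt; have Hq2 := q_decr t1' tt.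
  have H1 : (1 - beta) * p u' < (1 - beta) * p u by rewrite ltr_pM2l ?subr_gt0.
  have H2 : gam * q t < gam * q t' by rewrite ltr_pM2l// /gam; move: hb1; lra.
  by lra.
move=> H H'; have xx : x = x'.
  by apply/eqP; rewrite eq_le !leNgt; apply/andP; split; apply/negP;
    [exact: lt_absurd H' H|exact: lt_absurd H H'].
split=> //; have := fits_m H; have := fits_m H'; rewrite xx => -> mm.
have [[_ y0 _ _] [_ y0' _ _]] := (H, H').
apply/eqP; rewrite eq_le !leNgt; apply/andP; split; apply/negP => yy.
  by have := m_incr (ltW y0') yy; rewrite mm ltxx.
by have := m_incr (ltW y0) yy; rewrite mm ltxx.
Qed.

(** The uniform [eps] makes [p] fall at least linearly, while [q] stays nonnegative because [g] is
    non-decreasing. *)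
Let m_unbounded : exists2 y : R, 0 <= y & m xs <= m y.
Proof.
have p_lin y : 0 < y -> p y <= p 0 - eps * y.
  move=> y0; have [c /andP[c0 _] E] := mean pc pd (ltW hxs) y0.
  have Gc := Gneg (le_trans (ltW hxs) (ltW c0)).
  have e1 : 1 <= expR (th * c) by rewrite -expR0 ler_expR mulr_ge0// ltW.
  have Ec : expR (th * c) * G c <= - eps.
    by move: eps0; move: (expR _) e1 => z z1 ee; nra.
  have := ler_wpM2r (ltW y0) Ec; rewrite -{1}[y]subr0 -E; lra.
have q0 y : 0 < y -> 0 <= q y.
  move=> y0; rewrite /q mulr_ge0 ?expR_ge0// addr_ge0 ?g1_ge0 ?mulr_ge0 ?(ltW th0)//.
  by rewrite (le_trans (ltW hxs) (ltW y0)).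
pose y := (`|2 * m xs + p 0| + 1) / eps.
have y0 : 0 < y by rewrite divr_gt0// ltr_wpDl.
exists y; first exact: ltW.
have ey : eps * y = `|2 * m xs + p 0| + 1 by rewrite /y mulrC divfK// gt_eqF.
suff : 2 * m xs <= q y - p y by rewrite [m y]/m => H; lra.
have := p_lin y y0; have := q0 y y0; rewrite ey.
have := ler_norm (2 * m xs + p 0); move: (m xs) (`|_|) => *; lra.
Qed.

Lemma fits_exists : exists x y : R, fits x y.
Proof.
have [B B0 mB] := m_unbounded.
have m0xs : m 0 < m xs by exact: m_decr.
have m_inj y y' : 0 <= y -> 0 <= y' -> m y = m y' -> y = y'.
  move=> y0 y0' E; apply/eqP; rewrite eq_le !leNgt; apply/andP; split; apply/negP => yy.
    by have := m_incr y0' yy; rewrite E ltxx.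
  by have := m_incr y0 yy; rewrite E ltxx.
have m_le a c : xs <= a -> a <= c -> c <= 0 -> m c <= m a.
  by move=> a0; rewrite le_eqVlt => /predU1P[->//|ac] c0; exact/ltW/m_decr.
have m_ge a c : 0 <= a -> a <= c -> m a <= m c.
  by move=> a0; rewrite le_eqVlt => /predU1P[->//|ac]; exact/ltW/m_incr.
have mcB : {within `[0, B], continuous m} by apply: (subA mc); exact: ltW.
have ivtY z : m 0 <= z <= m B -> exists2 y, 0 <= y <= B & m y = z.
  move=> /andP[z1 z2]; have [|y] := @IVT R m 0 B z B0 mcB.
    by rewrite ge_min z1/= le_max z2 orbT.
  by rewrite in_itv/=; exists y.
have [Ym Ym0 mYm] : exists2 y, 0 <= y <= B & m y = m xs.
  by apply: ivtY; rewrite ltW.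
move: Ym0 => /andP[Ym0 YmB].
have /choice[Y HY] x : exists y, xs <= x <= 0 -> 0 <= y <= Ym /\ m y = m x.
  have [x0|nx] := boolP (xs <= x <= 0); last by exists 0.
  move: (x0) => /andP[x1 x2].
  have [|y /andP[y0 yB] yE] := ivtY (m x).
    by rewrite m_le// (le_trans _ mB)// m_le.
  exists y => _; split=> //; rewrite y0/= leNgt; apply/negP => yy.
  have := m_incr Ym0 yy; rewrite yE mYm ltNge m_le//.
have xsI : xs <= xs <= 0 by apply/andP; split; [exact: lexx|exact: ltW].
have zI : xs <= (0 : R) <= 0 by apply/andP; split; [exact: ltW|exact: lexx].
(* [Y] is strictly decreasing and onto the interval between its end values, hence continuous. *)
have Yc : {within `[xs, 0], continuous Y}.
  apply: segment_dec_surj_continuous.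
    move=> x x'; rewrite !in_itv/= => hx hx'.
    have [/andP[y0 _] yE] := HY x hx; have [/andP[y0' _] yE'] := HY x' hx'.
    move: hx hx' => /andP[x1 x2] /andP[x1' x2'].
    have [xx|xx] := leP x' x.
      rewrite leNgt; apply/negP => yy.
      by have := m_incr y0' yy; rewrite yE yE' ltNge m_le.
    by apply/negP => yy; have := m_ge _ _ y0 yy; rewrite yE yE' leNgt m_decr.
  move=> y /=; have [/andP[yx0 yxm] yxE] := HY xs xsI.
  have [/andP[y00 _] y0E] := HY 0 zI.
  have -> : Y 0 = 0 by apply: m_inj.
  rewrite in_itv/= => /andP[y0 yx].
  have mcx : {within `[xs, 0], continuous m} by apply: (subA mc).
  have [|x] := @IVT R m xs 0 (m y) (ltW hxs) mcx.
    rewrite ge_min le_max (m_ge 0 y)// -yxE (m_ge y (Y xs))// orbT//.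
  rewrite in_itv/= => x0 xE; exists x; first by rewrite /= in_itv.
  have [/andP[Yx0 _] YxE] := HY x x0; apply: m_inj => //.
  by rewrite YxE xE.
(* The gap in the [L_phi] equation along the pairs; where it vanishes, [m x = m (Y x)] gives the
   [L_psi] equation as well. *)
pose h x := (q x - gam * p x) / 2 - beta * q (Y x).
have hc : {within `[xs, 0], continuous h}.
  apply/subspace_continuousP => x xx.
  have xx' : xs <= x <= 0 by move: xx; rewrite /= in_itv.
  have sub (f : R -> R) : (forall z, xs <= z -> f @ within A (nbhs z) --> f z) ->
      f @ within `[xs, 0] (nbhs x) --> f x.
    move=> fc; move/subspace_continuousP: (@subA f xs 0 fc (lexx _)); exact.
  apply: cvgB.
    apply: cvgM; last exact: cvg_cst.
    apply: cvgB; first exact: sub qc.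
    by apply: cvgM; [exact: cvg_cst|exact: sub pc].
  apply: cvgM; first exact: cvg_cst.
  move/subspace_continuousP: Yc => /(_ x xx) Yx.
  apply: (cvg_comp _ _ Yx); have [/andP[Y0 _] _] := HY x xx'.
  apply: differentiable_continuous; apply/derivable1_diffP.
  exact: (@ex_derive _ _ _ _ _ _ _ (qd (lt_le_trans hxs Y0))).
have [/andP[Y00 _] Y0E] := HY 0 zI.
have Y0 : Y 0 = 0 by apply: m_inj.
have q_le a c : xs <= a -> a <= c -> q c <= q a.
  by move=> a0; rewrite le_eqVlt => /predU1P[->//|ac]; exact/ltW/q_decr.
have q00 : q 0 = g1 0 + th * g 0 by rewrite /q mulr0 expR0 mul1r.
have p00 : p 0 = g1 0 - th * g 0 by rewrite /p mulr0 expR0 mul1r.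
have [sl1 sl2] : 0 < beta * g1 0 /\
    beta * g1 0 < (1 - beta) * (th * (g xs * expR (- th * xs))).
  move: g_slope => /andP[s1 s2]; split=> //; rewrite (lt_le_trans s2)//.
  by rewrite le_eqVlt; apply/orP; left; apply/eqP; rewrite /th; ring.
have b0 : 0 < beta by move: hb1; lra.
have g10 : 0 < g1 0 by rewrite -(pmulr_rgt0 _ b0).
(* The pair at 0 is [(0, 0)], and [h 0 = - (2 beta - 1) g'(0)]: this uses [g'(0) > 0] from (ii). *)
have h0 : h 0 < 0.
  rewrite /h Y0 q00 p00 /gam.
  have -> : (g1 0 + th * g 0 - (2 * beta - 1) * (g1 0 - th * g 0)) / 2
    - beta * (g1 0 + th * g 0) = - ((2 * beta - 1) * g1 0) by field.
  by rewrite oppr_lt0 mulr_gt0//; move: hb1; lra.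
(* Put [M = th g(xs) exp(- th xs)], so [h xs >= M - beta q(0)]. By (ii), and by maximality of [xs]
   compared with 0, [beta q(0) = beta g'(0) + beta th g(0) < (1 - beta) M + beta M]. *)
have hxs0 : 0 < h xs.
  have [/andP[Yx0 _] _] := HY xs xsI.
  have Q := q_le 0 (Y xs) (ltW hxs) Yx0.
  have qxs : q xs = 2 * (th * (g xs * expR (- th * xs))).
    by rewrite /q smooth_xs; move: (expR _) => *; ring.
  rewrite /h p_xs qxs mulr0 subr0.
  have G0 : th * g 0 <= th * (g xs * expR (- th * xs)) by rewrite ler_wpM2l// ltW.
  have := ler_wpM2l (ltW b0) Q; have := ler_wpM2l (ltW b0) G0.
  rewrite q00; move: sl2; move: (th * (_ * _)) (th * g 0) => *; lra.
have [|x] := @IVT R h xs 0 0 (ltW hxs) hc.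
  by rewrite ge_min le_max (ltW h0) (ltW hxs0) orbT.
rewrite in_itv/= => /andP[x1 x2] hx.
have xx : xs < x < 0.
  rewrite !lt_neqAle x1 x2 !andbT; apply/andP; split; apply/negP => /eqP xE.
    by move: hxs0; rewrite xE hx ltxx.
  by move: h0; have := hx; rewrite {1}xE => ->; rewrite ltxx.
move: xx => /andP[x1' x2'].
have [|/andP[Yx0 _] YxE] := HY x; first by rewrite x1.
exists x, (Y x); split.
- by rewrite x1' x2'.
- rewrite lt_neqAle Yx0 andbT; apply/negP => /eqP E.
  have := m_decr x1 x2' (lexx 0); rewrite -YxE -E ltxx//.
- by move: YxE hx; rewrite /m /h /gam => *; lra.
- by move: hx; rewrite /h => /eqP; rewrite subr_eq0 => /eqP.
Qed.

(** * The candidate attached to a solution of the system *)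

Section candidate.
Variables y1 y2 : R.
Hypothesis fit : fits y1 y2.

Let y1x : xs < y1. Proof. by have [/andP[]] := fit. Qed.
Let y10 : y1 < 0. Proof. by have [/andP[]] := fit. Qed.
Let y20 : 0 < y2. Proof. by have [] := fit. Qed.
Let xs2 : xs <= y2. Proof. exact: ltW (lt_trans hxs y20). Qed.

(** [L_phi psi = th] and [L_psi phi = - th], so these coefficients give [a psi + b phi] the common
    values of [L_phi g] and [L_psi g] at [y1] and [y2]. *)
Let a := beta * q y2 / th.
Let b := - ((1 - beta) * p y1) / th.

Definition middle : R -> R := lin beta r a b.
Notation H := middle.

Let thN0 : th != 0. Proof. by rewrite gt_eqF. Qed.
Let betaN0 : beta != 0. Proof. by rewrite gt_eqF//; move: hb1; lra. Qed.
Let betaN1 : 1 - beta != 0. Proof. by rewrite gt_eqF//; move: hb2; lra. Qed.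

(** Left of 0 the coefficients are those of the solution tangent to [g] at [y1], right of 0 those of
    the one tangent at [y2]; the two equations of [fits] make a single function serve both. *)
Let A1E : linA1 beta a b = q y1 / (2 * th).
Proof.
have [_ _ _ E] := fit; have -> : a = (q y1 - gam * p y1) / 2 / th by rewrite E.
by rewrite /linA1 /b /gam; field; rewrite thN0 betaN1.
Qed.

Let B1E : linB1 beta b = - (p y1) / (2 * th).
Proof. by rewrite /linB1 /b; field; rewrite thN0 betaN1. Qed.

Let A2E : linA2 beta a = q y2 / (2 * th).
Proof. by rewrite /linA2 /a; field; rewrite thN0 betaN0. Qed.

Let B2E : linB2 beta a b = - (p y2) / (2 * th).
Proof.
have [_ _ E _] := fit; rewrite /linB2 /b E /a /gam.
by field; rewrite thN0 betaN0.
Qed.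

Let H_le0 x : x <= 0 -> H x = two_exp r (q y1 / (2 * th)) (- (p y1) / (2 * th)) x.
Proof. by move=> x0; rewrite /H lin_le0// A1E B1E. Qed.

Let H_ge0 x : 0 <= x -> H x = two_exp r (q y2 / (2 * th)) (- (p y2) / (2 * th)) x.
Proof. by move=> x0; rewrite /H lin_ge0// A2E B2E. Qed.

Let expNK (x : R) : expR (- th * x) = (expR (th * x))^-1.
Proof. by rewrite mulNr expRN. Qed.

Let fit_value y : two_exp r (q y / (2 * th)) (- (p y) / (2 * th)) y = g y.
Proof.
rewrite /two_exp /q /p -/th expNK; have := expR_gt0 (th * y).
by move: (expR _) => E E0; field; rewrite thN0 gt_eqF.
Qed.

Let fit_slope y : two_exp r (th * (q y / (2 * th))) (- (th * (- (p y) / (2 * th)))) y = g1 y.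
Proof.
rewrite /two_exp /q /p -/th expNK; have := expR_gt0 (th * y).
by move: (expR _) => E E0; field; rewrite thN0 gt_eqF.
Qed.

Lemma middle_y1 : H y1 = g y1.
Proof. by rewrite H_le0 ?(ltW y10)// fit_value. Qed.

Lemma middle_y2 : H y2 = g y2.
Proof. by rewrite H_ge0 ?(ltW y20)// fit_value. Qed.

Let Del := lin_kink beta r a b.
Let dH := lin_deriv beta r a b.

Let dH_y1 : dH y1 = g1 y1 + Del / 2.
Proof.
rewrite /dH /lin_deriv /kinked_deriv (ltW y10) -/(lin_kink _ _ _ _) -/Del A1E B1E.
by rewrite fit_slope.
Qed.

Let dH_y2 : dH y2 = g1 y2 - Del / 2.
Proof.
rewrite /dH /lin_deriv kinked_deriv_ge0 ?(ltW y20)//.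
by rewrite -/(lin_kink _ _ _ _) -/Del A2E B2E fit_slope.
Qed.

Let c1 := g xs * expR (- th * xs).

Definition candidate (x : R) : R :=
  if x <= xs then c1 * expR (th * x) else if x <= y1 then g x
  else if x <= y2 then H x else g x.
Notation v := candidate.

(** The slope shifted by [Del / 2] left of 0 and by [- Del / 2] right of it, to remove the kink;
    [dH] already contains its shift. *)
Definition candidate_deriv (x : R) : R :=
  if x <= xs then c1 * (th * expR (th * x)) + Del / 2 else if x <= y1 then g1 x + Del / 2
  else if x <= y2 then dH x else g1 x - Del / 2.
Notation dv := candidate_deriv.

Let c1xs : c1 * expR (th * xs) = g xs.
Proof. by rewrite /c1 expNK divfK// gt_eqF// expR_gt0. Qed.

Lemma candidate1 x : x <= xs -> v x = c1 * expR (th * x).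
Proof. by rewrite /v => ->. Qed.

Lemma candidate2 x : xs <= x -> x <= y1 -> v x = g x.
Proof.
rewrite /v => x1 ->; case: ifP => // x2.
have -> : x = xs by apply/eqP; rewrite eq_le x1 x2.
exact: c1xs.
Qed.

Lemma candidate3 x : y1 <= x -> x <= y2 -> v x = H x.
Proof.
move=> x1 x2; rewrite /v x2 leNgt (lt_le_trans y1x x1)/=; case: ifP => // x3.
have -> : x = y1 by apply/eqP; rewrite eq_le x1 x3.
by rewrite middle_y1.
Qed.

Lemma candidate4 x : y2 <= x -> v x = g x.
Proof.
move=> x1; have y12 := lt_trans y10 y20.
rewrite /v leNgt (lt_le_trans (lt_trans hxs y20) x1)/= leNgt (lt_le_trans y12 x1)/=.
case: ifP => // x3; have -> : x = y2 by apply/eqP; rewrite eq_le x1 x3.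
exact: middle_y2.
Qed.

Let dv1 x : x <= xs -> dv x = c1 * (th * expR (th * x)) + Del / 2.
Proof. by rewrite /dv => ->. Qed.

Let dv2 x : xs <= x -> x <= y1 -> dv x = g1 x + Del / 2.
Proof.
rewrite /dv => x1 ->; case: ifP => // x2.
have -> : x = xs by apply/eqP; rewrite eq_le x1 x2.
by rewrite mulrCA c1xs smooth_xs.
Qed.

Let dv3 x : y1 <= x -> x <= y2 -> dv x = dH x.
Proof.
move=> x1 x2; rewrite /dv x2 leNgt (lt_le_trans y1x x1)/=; case: ifP => // x3.
have -> : x = y1 by apply/eqP; rewrite eq_le x1 x3.
by rewrite dH_y1.
Qed.

Let dv4 x : y2 <= x -> dv x = g1 x - Del / 2.
Proof.
move=> x1; have y12 := lt_trans y10 y20.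
rewrite /dv leNgt (lt_le_trans (lt_trans hxs y20) x1)/= leNgt (lt_le_trans y12 x1)/=.
case: ifP => // x3; have -> : x = y2 by apply/eqP; rewrite eq_le x1 x3.
exact: dH_y2.
Qed.

Let w x := v x - Del / 2 * `|x|.

Let w1 x : x <= xs -> w x = c1 * expR (th * x) + Del / 2 * x.
Proof.
by move=> x0; rewrite /w candidate1// ler0_norm ?(le_trans x0 (ltW hxs))//; ring.
Qed.
Let w2 x : xs <= x -> x <= y1 -> w x = g x + Del / 2 * x.
Proof.
by move=> x0 x1; rewrite /w candidate2// ler0_norm ?(le_trans x1 (ltW y10))//; ring.
Qed.
Let w3 x : y1 <= x -> x <= y2 -> w x = H x - Del / 2 * `|x|.
Proof. by move=> x0 x1; rewrite /w candidate3. Qed.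
Let w4 x : y2 <= x -> w x = g x - Del / 2 * x.
Proof. by move=> x0; rewrite /w candidate4// ger0_norm// (le_trans (ltW y20)). Qed.

Let d1 x : is_derive x (1 : R) (fun x => c1 * expR (th * x) + Del / 2 * x)
  (c1 * (th * expR (th * x)) + Del / 2).
Proof.
have := is_deriveD (is_deriveZ c1 (is_derive_expRM th x)) (is_deriveZ (Del / 2) (is_derive_id x (1 : R))).
by rewrite /GRing.scale/= => h; apply: (is_derive_eq h); rewrite mulr1.
Qed.
Let d2 x : xs <= x -> is_derive x (1 : R) (fun x => g x + Del / 2 * x) (g1 x + Del / 2).
Proof.
move=> x0; have := is_deriveD (gd x0) (is_deriveZ (Del / 2) (is_derive_id x (1 : R))).
by rewrite /GRing.scale/= => h; apply: (is_derive_eq h); rewrite mulr1.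
Qed.
Let HS : supersolution r Del H dH. Proof. exact: supersolution_lin. Qed.
Let d4 x : xs <= x -> is_derive x (1 : R) (fun x => g x - Del / 2 * x) (g1 x - Del / 2).
Proof.
move=> x0; have := is_deriveB (gd x0) (is_deriveZ (Del / 2) (is_derive_id x (1 : R))).
by rewrite /GRing.scale/= => h; apply: (is_derive_eq h); rewrite mulr1.
Qed.

Let between (l x u : R) : l < x -> x < u -> exists2 dl : R, 0 < dl &
  forall y, `|y - x| < dl -> l <= y /\ y <= u.
Proof.
move=> lx xu; have [e1 e10 E1] := near_right lx; have [e2 e20 E2] := near_left xu.
exists (Num.min e1 e2); first by rewrite lt_min e10.
by move=> y; rewrite lt_min => /andP[/E1/ltW ? /E2/ltW ?].
Qed.

Let dw x : is_derive x (1 : R) w (dv x).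
Proof.
case: (ltgtP x xs) => [x1|x1|->]; last 1 first.
- have D1 := d1 xs; have D2 := d2 (lexx xs).
  rewrite -dv1// in D1; rewrite -dv2 ?(ltW y1x)// in D2.
  apply: (is_derive_glue D1 D2); have [e e0 E] := near_left y1x.
  by exists e => // y /E /ltW h; split=> h'; [exact: w1|exact: w2].
- rewrite dv1 ?(ltW x1)//; apply: (is_derive_local (d1 x)).
  by have [e e0 E] := near_left x1; exists e => // y /E /ltW /w1.
case: (ltgtP x y1) => [x2|x2|->]; last 1 first.
- have D2 := d2 (ltW y1x); have D3 := HS.1 y1.
  rewrite -dv2 ?(ltW y1x)// in D2; rewrite -dv3 ?(ltW (lt_trans y10 y20))// in D3.
  apply: (is_derive_glue D2 D3); have [e e0 E] := between y1x (lt_trans y10 y20).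
  by exists e => // y /E [h1 h2]; split=> h'; [exact: w2|exact: w3].
- rewrite dv2 ?(ltW x1) ?(ltW x2)//; apply: (is_derive_local (d2 (ltW x1))).
  by have [e e0 E] := between x1 x2; exists e => // y /E [h1 h2]; exact: w2.
case: (ltgtP x y2) => [x3|x3|->]; last 1 first.
- have D3 := HS.1 y2; have D4 := d4 xs2.
  rewrite -dv3 ?(ltW (lt_trans y10 y20))// in D3; rewrite -dv4// in D4.
  apply: (is_derive_glue D3 D4); have [e e0 E] := near_right (lt_trans y10 y20).
  by exists e => // y /E /ltW h; split=> h'; [exact: w3|exact: w4].
- rewrite dv3 ?(ltW x2) ?(ltW x3)//; apply: (is_derive_local (HS.1 x)).
  by have [e e0 E] := between x2 x3; exists e => // y /E [h1 h2]; exact: w3.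
rewrite dv4 ?(ltW x3)//; apply: (is_derive_local (d4 (ltW x1))).
by have [e e0 E] := near_right x3; exists e => // y /E /ltW; exact: w4.
Qed.

Let concave_g (l u c : R) : xs <= l -> l <= u -> (forall x, l <= x <= u -> v x = g x) ->
  dv l = g1 l + c -> dv u = g1 u + c -> concave_on r v dv l u.
Proof.
move=> l0 lu vE Dl Du.
apply: (@concave_on_derive R r v dv g1 g2 l u r0 lu).
- exact: subA g1c l0.
- by move=> x /andP[lx _]; apply: g1d; exact: le_lt_trans lx.
- move=> x /andP[/ltW lx /ltW xu]; rewrite vE ?lx//.
  by have := g_super (le_trans l0 lx); rewrite -/(g2 x); move: eps0; lra.
- by rewrite Dl Du; ring.
Qed.

(** [v'' = 2 r v] on the exponential and middle pieces, and (iii) holds where [v = g]. Slopes agree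
    at [xs], [y1], [y2], so the integrated inequalities chain across the pieces. *)
Lemma supersolution_candidate : supersolution r Del v dv.
Proof.
split=> [x|]; first exact: dw.
have G1 l u : l <= u -> u <= xs -> concave_on r v dv l u.
  move=> lu u0.
  apply: (@concave_on_derive R r v dv (two_exp r (th * c1) 0)
    (two_exp r (th * (th * c1)) (- (th * 0))) l u r0 lu).
  - by apply: continuous_subspaceT; exact: is_derive_continuous (is_derive_two_exp _ _ _).
  - by move=> x _; exact: is_derive_two_exp.
  - move=> x /andP[_ /ltW xu]; rewrite candidate1 ?(le_trans xu)// -thth /two_exp.
    by rewrite le_eqVlt; apply/orP; left; apply/eqP; ring.
  - rewrite !dv1 ?(le_trans lu)// /two_exp -/th !mul0r !addr0.
    by move: (expR _) (expR _) => *; ring.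
have G2 l u : l <= u -> u <= y1 -> concave_on r v dv l u.
  apply: (@concave_on_glue R r v dv xs (fun u => u <= y1)) => // l' u' l0 lu u0.
  apply: (@concave_g l' u' (Del / 2)) => //.
  - by move=> x /andP[x1 x2]; rewrite candidate2 ?(le_trans l0 x1) ?(le_trans x2).
  - by rewrite dv2// (le_trans lu).
  - by rewrite dv2// (le_trans l0).
have G3 l u : l <= u -> u <= y2 -> concave_on r v dv l u.
  apply: (@concave_on_glue R r v dv y1 (fun u => u <= y2)) => // l' u' l0 lu u0 S hS.
  rewrite !dv3 ?(le_trans l0 lu) ?(le_trans lu u0)//; apply: HS.2 => // x /andP[x1 x2].
  rewrite -candidate3 ?(le_trans l0 x1) ?(le_trans x2 u0)//.
  by apply: hS; rewrite x1.
move=> l u S lu hS.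
apply: (@concave_on_glue R r v dv y2 (fun=> True) G3 _ l u lu I S hS).
move=> l' u' l0 lu' _; apply: (@concave_g l' u' (- (Del / 2))) => //.
- exact: le_trans xs2 l0.
- by move=> x /andP[x1 x2]; rewrite candidate4// (le_trans l0).
- by rewrite dv4.
- by rewrite dv4// (le_trans l0).
Qed.

Lemma candidate_jump : (2 * beta - 1) * dv 0 + Del / 2 = 0.
Proof. by rewrite dv3 ?(ltW y10) ?(ltW y20)//; exact: lin_jump. Qed.

Let twoc A' B' : continuous (two_exp r A' B').
Proof. exact: is_derive_continuous (is_derive_two_exp _ _ _). Qed.

(** [(H - g) exp(- th .)] vanishes at [y1] and has derivative [exp(- 2 th z) (p y1 - p z)],
    nonnegative beyond [y1] because [p] decreases. *)
Let above_left x : y1 <= x -> x <= 0 -> g x <= H x.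
Proof.
move=> x1 x0; rewrite H_le0//; set A' := _ / _; set B' := _ / _.
pose F y := (two_exp r A' B' y - g y) * expR (- th * y).
have F1 : F y1 = 0 by rewrite /F fit_value subrr mul0r.
suff : 0 <= F x by rewrite /F pmulr_lge0 ?expR_gt0// subr_ge0.
move: x1; rewrite le_eqVlt => /predU1P[<-|x1]; first by rewrite F1.
have Fc z : xs <= z -> F @ within A (nbhs z) --> F z.
  move=> z0; apply: cvgM; last exact: (@within_c (fun y => expR (- th * y))).
  by apply: cvgB; apply: within_c => //; exact: twoc.
have Fd z : xs < z -> is_derive z (1 : R) F (expR (- th * z) * expR (- th * z) * (p y1 - p z)).
  move=> z0.
  have := is_deriveM (is_deriveB (is_derive_two_exp r A' B' z) (gd (ltW z0)))
    (is_derive_expRM (- th) z).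
  rewrite /GRing.scale/= => h; apply: (is_derive_eq h).
  rewrite -[(two_exp r A' B' - g) z]/(two_exp r A' B' z - g z) /two_exp /A' /B'.
  rewrite [p z]/p -/th expNK; have := expR_gt0 (th * z).
  by move: (expR _) (p y1) (q y1) => E p1 q1 E0; field; rewrite thN0 gt_eqF.
have [c /andP[c1' c2]] := mean Fc Fd (ltW y1x) x1.
rewrite F1 subr0 => ->; rewrite mulr_ge0 ?subr_ge0 ?(ltW x1)//.
by rewrite !mulr_ge0 ?expR_ge0// subr_ge0 ltW// p_decr// ltW.
Qed.

(** Mirror argument: [(H - g) exp(th .)] vanishes at [y2], and its derivative has the sign of
    [q y2 - q z]. *)
Let above_right x : 0 <= x -> x <= y2 -> g x <= H x.
Proof.
move=> x0 x1; rewrite H_ge0//; set A' := _ / _; set B' := _ / _.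
pose F y := (two_exp r A' B' y - g y) * expR (th * y).
have F1 : F y2 = 0 by rewrite /F fit_value subrr mul0r.
suff : 0 <= F x by rewrite /F pmulr_lge0 ?expR_gt0// subr_ge0.
move: x1; rewrite le_eqVlt => /predU1P[->|x1]; first by rewrite F1.
have Fc z : xs <= z -> F @ within A (nbhs z) --> F z.
  move=> z0; apply: cvgM; last exact: (@within_c (fun y => expR (th * y))).
  by apply: cvgB; apply: within_c => //; exact: twoc.
have Fd z : xs < z -> is_derive z (1 : R) F (expR (th * z) * expR (th * z) * (q y2 - q z)).
  move=> z0.
  have := is_deriveM (is_deriveB (is_derive_two_exp r A' B' z) (gd (ltW z0)))
    (is_derive_expRM th z).
  rewrite /GRing.scale/= => h; apply: (is_derive_eq h).
  rewrite -[(two_exp r A' B' - g) z]/(two_exp r A' B' z - g z) /two_exp /A' /B'.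
  rewrite [q z]/q -/th expNK; have := expR_gt0 (th * z).
  by move: (expR _) (p y2) (q y2) => E p1 q1 E0; field; rewrite thN0 gt_eqF.
have xx : xs <= x by rewrite (le_trans (ltW hxs)).
have [c /andP[c1' c2]] := mean Fc Fd xx x1.
rewrite F1 sub0r => E; rewrite -oppr_le0 E mulr_le0_ge0 ?subr_ge0 ?(ltW x1)//.
rewrite mulr_ge0_le0 ?mulr_ge0 ?expR_ge0// subr_le0 ltW// q_decr//.
by rewrite (le_trans xx (ltW c1')).
Qed.

Lemma candidate_ge x : g x <= v x.
Proof.
have [x1|/ltW x1] := leP x xs; first by rewrite candidate1// /c1 g_left// (le_lt_trans x1).
have [x2|/ltW x2] := leP x y1; first by rewrite candidate2.
have [x3|/ltW x3] := leP x y2; last by rewrite candidate4.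
rewrite candidate3//; have [x4|/ltW x4] := leP x 0; first exact: above_left.
exact: above_right.
Qed.

Lemma candidate1_psi x : x < xs -> v x = g xs * (psi beta r x / psi beta r xs).
Proof.
move=> x1; rewrite candidate1 ?(ltW x1)// psixs /c1 -expRN mulNr.
rewrite (_ : psi beta r x = expR (th * x)); last by rewrite /psi leNgt (lt_trans x1 hxs).
by ring.
Qed.

End candidate.

Lemma candidate_exists : exists (y1 y2 Del a b : R) (v dv : R -> R), [/\
  unique (fun y : R * R => [/\ xs < y.1 < 0, 0 < y.2,
    L_psi beta r g y.1 = L_psi beta r g y.2 &
    L_phi beta r g y.1 = L_phi beta r g y.2]) (y1, y2),
  supersolution r Del v dv /\ (2 * beta - 1) * dv 0 + Del / 2 = 0,
  forall x, g x <= v x,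
  (forall x, xs <= x <= y1 \/ y2 <= x -> v x = g x) /\
  (forall x, x < xs -> v x = g xs * (psi beta r x / psi beta r xs)) &
  forall x, y1 <= x <= y2 -> v x = lin beta r a b x].
Proof.
have [y1 [y2 fit]] := fits_exists.
exists y1, y2, (lin_kink beta r (beta * q y2 / th) (- ((1 - beta) * p y1) / th)).
exists (beta * q y2 / th), (- ((1 - beta) * p y1) / th).
exists (candidate y1 y2), (candidate_deriv y1 y2); split.
- split=> [|[y1' y2'] /fitsE fit']; first by apply/fitsE.
  by have [-> ->] := fits_unique fit fit'.
- by split; [exact: supersolution_candidate|exact: candidate_jump].
- exact: candidate_ge.
- split=> [x [/andP[x1 x2]|x1]|x x1].
  + exact: candidate2.
  + exact: candidate4.
  + exact: candidate1_psi.
- by move=> x /andP[x1 x2]; rewrite candidate3.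
Qed.

End reward.

(** * Verification *)

Section paths.
Context {R : realType}.
Implicit Types (f k : R -> R) (c s t : R).

Lemma stays_below f c s : continuous f -> f 0 <= c ->
  (forall u, 0 <= u -> u < s -> f u <> c) -> forall t, 0 <= t -> t <= s -> f t <= c.
Proof.
move=> fc f0 fn t t0 ts; rewrite leNgt; apply/negP => ft.
have [|u] := @IVT R f 0 t c t0 (continuous_subspaceT fc).
  by rewrite ge_min f0/= le_max (ltW ft) orbT.
rewrite in_itv/= => /andP[u0 ut] fu; apply: (fn u u0) => //.
rewrite (lt_le_trans _ ts)// lt_neqAle ut andbT; apply/eqP => E.
by move: ft; rewrite -E fu ltxx.
Qed.

Lemma stays_above f c s : continuous f -> c <= f 0 ->
  (forall u, 0 <= u -> u < s -> f u <> c) -> forall t, 0 <= t -> t <= s -> c <= f t.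
Proof.
move=> fc f0 fn t t0 ts; rewrite -lerN2.
apply: (@stays_below (fun t => - f t) (- c) s) => //.
- by move=> u; apply: cvgN; exact: fc.
- by rewrite lerN2.
- by move=> u u0 us /oppr_inj; exact: fn.
Qed.

End paths.

(** * Hitting times of closed sets *)

Section hitting.
Context {R : realType} {d} {T : measurableType d}.
Variables (X : R -> T -> R) (A : set R) (k : R -> R).
Hypotheses (Xc : continuous_paths X) (kc : continuous k) (Ak : forall x, A x <-> k x <= 0).

Let X'c w : continuous ((extend_left X)^~ w).
Proof. exact: (continuous_extend_left (@Xc w)). Qed.

Let kXc w : continuous (fun t : R => k (extend_left X t w)).
Proof. by move=> t; apply: continuous_comp; [exact: X'c|exact: kc]. Qed.

Lemma hitting_timeE w :
  hitting_time X A w = first_time (fun t => k (extend_left X t w) <= 0).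
Proof.
congr (ereal_inf (_ @` _)); apply/seteqP; split => t [t0 h]; split=> //.
  by rewrite extend_left_ge0//; apply/Ak.
by apply/Ak; rewrite -(extend_left_ge0 X w t0).
Qed.

Lemma hitting_time_attained w s : hitting_time X A w = s%:E ->
  0 <= s /\ A (extend_left X s w).
Proof.
by rewrite hitting_timeE => /(first_time_attained (@kXc w))[s0 ks]; split=> //; exact/Ak.
Qed.

Lemma hitting_time_before w s u : (s%:E <= hitting_time X A w)%E -> 0 <= u -> u < s ->
  ~ A (extend_left X u w).
Proof.
rewrite hitting_timeE => H u0 us Au; apply: (first_time_before H u0 us).
exact/Ak.
Qed.

(** Near hits at rational times describe the event countably, inside the unaugmented filtration. *)
Lemma hitting_time_stopping : stopping_time X (hitting_time X A).
Proof.
split=> [w|t t0]; first by rewrite hitting_timeE first_time_ge0.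
pose S n (q : rat) : set T := if 0 <= (ratr q : R) <= t then
  [set w | k (X (ratr q) w) < n.+1%:R^-1] else set0.
rewrite (_ : [set w | _] = \bigcap_n \bigcup_q S n q).
  rewrite -[natural_filtration X t]/(@measurable _ (g_sigma_algebraType (past_events X t))).
  apply: bigcapT_measurable => n; apply: bigcupT_measurable_rat => q.
  rewrite /S; case: ifP => // qt; apply: sub_sigma_algebra; exists (ratr q) => /=.
    by rewrite in_itv.
  exists (k @^-1` `]-oo, n.+1%:R^-1[%classic).
    rewrite -[X in measurable X]setTI.
    exact: (continuous_measurable_fun kc).
  by rewrite setTI; apply/seteqP; split => w /=; rewrite in_itv.
apply/seteqP; split => w /=; rewrite hitting_timeE.
  move=> /(first_time_leE (@kXc w) t0) H n _; have [q [qt kq]] := H n.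
  exists q => //; rewrite /S qt/=; move: kq; rewrite extend_left_ge0//.
  by case/andP: qt.
move=> H; apply/(first_time_leE (@kXc w) t0) => n; have [q _] := H n I.
rewrite /S; case: ifP => //= qt kq; exists q; split=> //.
by rewrite extend_left_ge0//; case/andP: qt.
Qed.

End hitting.

(** The grid sums need [s <= tau] rather than [tau <= s]. Its complement is exhausted by the times
    [s - s / (n + 1)], strictly below [s] unless [s = 0], where the event is everything. *)
Lemma stopping_time_adapted {R : realType} {d} {T : measurableType d}
  (X : R -> T -> R) (G : R -> set_system T) (tau : T -> \bar R) :
  (forall s : R, 0 <= s -> sigma_algebra setT (G s)) ->
  (forall s t : R, 0 <= s -> s <= t -> G s `<=` G t) ->
  (forall t A, 0 <= t -> natural_filtration X t A -> G t A) ->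
  stopping_time X tau -> forall s : R, 0 <= s -> G s [set w | (s%:E <= tau w)%E].
Proof.
move=> sG Gle XG [tau0 tauX] s s0; have [G0 GC GU] := sG s s0.
move: s0; rewrite le_eqVlt => /predU1P[s0|s0].
  rewrite (_ : [set w | _] = setT `\` set0); first exact: GC.
  by rewrite setD0; apply/seteqP; split => // w _ /=; rewrite -s0.
pose u n : R := s - s / n.+1%:R.
have u0 n : 0 <= u n.
  by rewrite subr_ge0 ler_pdivrMr// ler_peMr ?(ltW s0)// ler1n.
have us n : u n <= s by rewrite gerBl divr_ge0// ltW.
rewrite (_ : [set w | _] = setT `\` \bigcup_n [set w | (tau w <= (u n)%:E)%E]).
  apply: GC; apply: GU => n; apply: (Gle (u n) s (u0 n) (us n)).
  exact: XG (tauX _ (u0 n)).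
rewrite setTD; apply/seteqP; split => w /=.
  move=> sw [n _ /= un]; have := le_trans sw un; rewrite lee_fin /u => H.
  have : 0 < s / n.+1%:R by rewrite divr_gt0.
  by move: H; move: (s / _) => *; lra.
move=> H; rewrite leNgt; apply/negP => ts; apply: H.
case E : (tau w) ts => [t| |]//; last by have := tau0 w; rewrite E.
rewrite lte_fin => ts; have ds : 0 < s - t by rewrite subr_gt0.
have [n _ /(_ n (leqnn n))] := @grid_small R s _ ds.
rewrite ger0_norm ?divr_ge0 ?(ltW s0)// => un; exists n => //=.
by rewrite E lee_fin /u; move: un; move: (s / _) => *; lra.
Qed.

(** * Payoffs under each starting law *)

Section verification.
Context {R : realType} {d} {T : measurableType d}.
Variables (P : R -> probability T R) (X : R -> T -> R) (beta r : R) (g : R -> R).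
Hypotheses (hbeta : 1 / 2 < beta < 1) (hr : 0 < r).
Hypothesis hX : forall x, skew_brownian_motion beta x (P x) X.
Hypotheses (g_mono : {homo g : x y / x <= y}) (g_ge0 : forall x, 0 <= g x).
Hypothesis g_pinfty : g x / psi beta r x @[x --> +oo] --> (0 : R).

Let hb1 : 1 / 2 < beta. Proof. by case/andP: hbeta. Qed.
Notation X' := (extend_left X).

Let sys x : exists W L G,
  sbm_system (P x) X' W L G x (2 * beta - 1) /\
  (forall t A, 0 <= t -> natural_filtration X t A -> G t A).
Proof. exact: skew_brownian_motion_system hb1 (hX x). Qed.

(** The limit of [g / psi] applies right of [M + 1]; left of it monotonicity supplies the constant
    [g (M + 1)]. *)
Let growth (del : R) : 0 < del -> exists C, forall x, g x <= del * psi beta r x + C.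
Proof.
move=> del0; have /cvgrPdist_le/(_ _ del0)[M [_ HM]] := g_pinfty.
exists (g (M + 1)) => x; have psi0 := psi_gt0 r hbeta x.
have [xM|Mx] := leP x (M + 1).
  by rewrite (le_trans (g_mono xM))// lerDr mulr_ge0// ltW.
have := HM x; rewrite /= sub0r normrN => /(_ _) h.
have {}h : `|g x / psi beta r x| <= del by apply: h; rewrite (lt_trans _ Mx)// ltrDl.
have := le_trans (ler_norm _) h; rewrite ler_pdivrMr// => {}h.
by rewrite (le_trans h)// lerDl.
Qed.

Let psiS : supersolution r (lin_kink beta r 1 0) (psi beta r) (lin_deriv beta r 1 0).
Proof. by rewrite psiE; exact: supersolution_lin. Qed.

Lemma discounted_payoff_ge0 (tau : T -> \bar R) w : (0 <= discounted_payoff r g X tau w)%E.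
Proof.
have lim0 : (0 <= limf_esup (fun t => (expR (- r * t) * g (X t w))%:E) (pinfty_nbhs R))%E.
  apply: limf_esup_ge0 => [|t]; first exact: filter_not_empty.
  by rewrite lee_fin mulr_ge0// expR_ge0.
rewrite /discounted_payoff; case: (tau w) => [t| |]//.
by rewrite lee_fin mulr_ge0// expR_ge0.
Qed.

(** The limsup prescribed for [tau = +oo] is almost surely 0, which is the convention of
    [stopped_value]. *)
Lemma discounted_payoff_ae x (tau : T -> \bar R) : (forall w, 0 <= tau w)%E ->
  {ae P x, forall w, discounted_payoff r g X tau w = (stopped_value X' r g tau w)%:E}.
Proof.
move=> tau0; have [W [L [G [sbm _]]]] := sys x.
have := discounted_limsup sbm hr psiS (lin_jump r hbeta 1 0)
  (fun x => ltW (psi_gt0 r hbeta x)) (fun t w t0 => esym (extend_left_ge0 X w t0)) g_ge0 growth.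
apply: filterS => w lim0; rewrite /discounted_payoff /stopped_value.
have := tau0 w; case: (tau w) => [t| |]//.
by rewrite lee_fin => t0; rewrite /disc extend_left_ge0.
Qed.

Lemma payoff_le_supersolution Del (v dv : R -> R) x tau :
  supersolution r Del v dv -> (2 * beta - 1) * dv 0 + Del / 2 = 0 ->
  (forall x, g x <= v x) -> stopping_time X tau ->
  (\int[P x]_w discounted_payoff r g X tau w <= (v x)%:E)%E.
Proof.
move=> vS vD gv tauX; have [W [L [G [sbm XG]]]] := sys x.
have tauG := stopping_time_adapted (sbm_sigma sbm) (sbm_mono sbm) XG tauX.
have v0 y : 0 <= v y by exact: le_trans (gv y).
apply: le_trans (supersolution_stopped sbm hr tauG tauX.1 vS vD v0).
apply: ge0_le_integral_ae.
- by move=> w; exact: discounted_payoff_ge0.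
- by move=> w; exact: stopped_value_EFin_ge0.
apply: filterS (discounted_payoff_ae x tauX.1) => w ->.
rewrite lee_fin /stopped_value; case: (tau w) => // s.
by rewrite /disc ler_wpM2l// expR_ge0.
Qed.

(** [- lin a b = lin (- a) (- b)] is again a supersolution, so the inequality holds in both
    directions. *)
Lemma stopped_lin (a b B x : R) (f tau : T -> \bar R) :
  stopping_time X tau ->
  {ae P x, forall w, X' 0 w = x -> forall s : R, 0 <= s -> (s%:E <= tau w)%E ->
     `|lin beta r a b (X' s w)| <= B} ->
  (forall w, 0 <= f w)%E ->
  {ae P x, forall w, X' 0 w = x -> f w = (stopped_value X' r (lin beta r a b) tau w)%:E} ->
  (\int[P x]_w f w = (lin beta r a b x)%:E)%E.
Proof.
move=> tauX bB f0 fv; have [W [L [G [sbm XG]]]] := sys x.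
have tauG := stopping_time_adapted (sbm_sigma sbm) (sbm_mono sbm) XG tauX.
have SN : supersolution r (lin_kink beta r (- a) (- b)) (fun y => - lin beta r a b y)
    (lin_deriv beta r (- a) (- b)).
  have := supersolution_lin hbeta hr (- a) (- b).
  rewrite (_ : lin beta r (- a) (- b) = fun y => - lin beta r a b y)//.
  by apply/funext => y; rewrite /lin; ring.
apply: (stopped_equality sbm hr tauG tauX.1 (supersolution_lin hbeta hr a b)
  (lin_jump r hbeta a b) SN (lin_jump r hbeta (- a) (- b)) (B := B)) => //.
  by apply: filterS2 bB (sbm_regular sbm) => w h [X0 _ _ _ _]; exact: h.
by apply: filterS2 fv (sbm_regular sbm) => w h [X0 _ _ _ _]; exact: h.
Qed.

Lemma starts_at x : {ae P x, forall w, X' 0 w = x}.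
Proof.
have [W [L [G [sbm XG]]]] := sys x.
by apply: filterS (sbm_regular sbm) => w [].
Qed.

Let Xc : continuous_paths X. Proof. by have [] := hX 0. Qed.
Let X'c w : continuous (X'^~ w). Proof. exact: (continuous_extend_left (@Xc w)). Qed.

Section two_sided.
Variables (xs y1 y2 : R).
Hypotheses (xs1 : xs < y1) (y12 : y1 < y2).

Definition stop_region : set R := `[xs, y1] `|` `[y2, +oo[.
Notation A := stop_region.

(** The region is [xs <= x] combined with [x <= y1] or [y2 <= x]; a maximum encodes the conjunction,
    a minimum the disjunction. *)
Let k (x : R) : R := Num.max (xs - x) (Num.min (x - y1) (y2 - x)).

Let kc : continuous k.
Proof.
have c1 : continuous (fun x : R => xs - x) by move=> x; apply: cvgB; [exact: cvg_cst|exact: cvg_id].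
have c2 : continuous (fun x : R => x - y1) by move=> x; apply: cvgB; [exact: cvg_id|exact: cvg_cst].
have c3 : continuous (fun x : R => y2 - x) by move=> x; apply: cvgB; [exact: cvg_cst|exact: cvg_id].
move=> x; exact: (@continuous_max R R _ _ x (c1 x) (@continuous_min R R _ _ x (c2 x) (c3 x))).
Qed.

Let Ak x : A x <-> k x <= 0.
Proof.
rewrite /A /= !in_itv/= andbT /k ge_max ge_min !subr_le0; split.
  by case=> [/andP[-> ->]//|h]; rewrite h orbT andbT (le_trans (ltW (lt_trans xs1 y12))).
by move=> /andP[-> /orP[->|->]]; [left|right].
Qed.

Notation tau := (hitting_time X A).

Lemma region_stopping : stopping_time X tau.
Proof. exact: hitting_time_stopping Xc kc Ak. Qed.

Let tau_before w s u : (s%:E <= tau w)%E -> 0 <= u -> u < s -> ~ A (X' u w).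
Proof. exact: (hitting_time_before Ak). Qed.

Let A1 : A xs. Proof. by left; rewrite /= in_itv/= lexx ltW. Qed.
Let A2 : A y1. Proof. by left; rewrite /= in_itv/= lexx ltW. Qed.
Let A3 : A y2. Proof. by right; rewrite /= in_itv/= lexx. Qed.

Lemma region_below w s : X' 0 w <= xs -> (s%:E <= tau w)%E -> 0 <= s -> X' s w <= xs.
Proof.
move=> X0 st s0; apply: (stays_below (@X'c w) X0 _ s0 (lexx s)) => u u0 us E.
by apply: (tau_before st u0 us); rewrite E.
Qed.

Lemma region_between w s : y1 <= X' 0 w <= y2 -> (s%:E <= tau w)%E -> 0 <= s ->
  y1 <= X' s w <= y2.
Proof.
move=> /andP[X1 X2] st s0; apply/andP; split.
  apply: (stays_above (@X'c w) X1 _ s0 (lexx s)) => u u0 us E.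
  by apply: (tau_before st u0 us); rewrite E.
apply: (stays_below (@X'c w) X2 _ s0 (lexx s)) => u u0 us E.
by apply: (tau_before st u0 us); rewrite E.
Qed.

Lemma region_exit_below w s : X' 0 w <= xs -> tau w = s%:E -> X' s w = xs.
Proof.
move=> X0 st; have [s0 As] := hitting_time_attained Xc kc Ak st.
have := region_below X0 _ s0; rewrite st => /(_ (lexx _)) h.
apply/eqP; rewrite eq_le h/=; case: As; rewrite /= in_itv/=; first by case/andP.
by rewrite andbT; apply: le_trans; rewrite (le_trans (ltW xs1) (ltW y12)).
Qed.

Lemma region_exit_between w s : y1 <= X' 0 w <= y2 -> tau w = s%:E ->
  X' s w = y1 \/ X' s w = y2.
Proof.
move=> X0 st; have [s0 As] := hitting_time_attained Xc kc Ak st.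
have := region_between X0 _ s0; rewrite st => /(_ (lexx _)) /andP[h1 h2].
case: As; rewrite /= in_itv/=.
  by move=> /andP[_ h]; left; apply/eqP; rewrite eq_le h h1.
by rewrite andbT => h; right; apply/eqP; rewrite eq_le h h2.
Qed.

Lemma region_inside w : A (X' 0 w) -> tau w = 0%E.
Proof.
move=> A0; apply/eqP; rewrite eq_le (region_stopping.1 w) andbT.
rewrite (hitting_timeE X Ak); apply: first_time_le => //; exact/Ak.
Qed.

Lemma payoff_inside x : A x -> (\int[P x]_w discounted_payoff r g X tau w = (g x)%:E)%E.
Proof.
move=> Ax; transitivity (\int[P x]_w (g x)%:E)%E.
  apply: ge0_integral_ae => [w|w|]; [exact: discounted_payoff_ge0|by rewrite lee_fin|].
  apply: filterS (starts_at x) => w X0; rewrite /discounted_payoff.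
  rewrite (_ : tau w = (0 : R)%:E); last by apply: region_inside; rewrite X0.
  by rewrite mulr0 expR0 mul1r -X0 extend_left_ge0.
by rewrite integral_cst//= probability_setT mule1.
Qed.

(** The payoff is that of the multiple of [psi] equal to [g xs] at [xs]. It is bounded before the
    hit since [psi] increases there, and a path that never hits contributes 0 on both sides. *)
Lemma payoff_below x : xs < 0 -> x < xs ->
  (\int[P x]_w discounted_payoff r g X tau w = (g xs * (psi beta r x / psi beta r xs))%:E)%E.
Proof.
move=> xs0 x0; have psi0 y := psi_gt0 r hbeta y.
have linc y : lin beta r (g xs / psi beta r xs) 0 y = g xs * (psi beta r y / psi beta r xs).
  by rewrite /lin mul0r addr0 mulrAC mulrA.
have mono y : y <= xs -> psi beta r y <= psi beta r xs.
  have psiE' z : z <= xs -> psi beta r z = expR (Num.sqrt (2 * r) * z).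
    by move=> zx; rewrite /psi ifN// -ltNge (le_lt_trans zx).
  by move=> yx; rewrite !psiE'// ler_expR ler_wpM2l// sqrtr_ge0.
rewrite -linc; apply: (@stopped_lin _ _ (g xs) _ _ _ region_stopping).
- apply: aeW => w X0 s s0 st; have h := @region_below w s _ st s0.
  rewrite linc ger0_norm; last by rewrite mulr_ge0// divr_ge0// ltW.
  by rewrite ler_piMr// ler_pdivrMr// mul1r mono// h// X0 ltW.
- by move=> w; exact: discounted_payoff_ge0.
apply: filterS (discounted_payoff_ae x region_stopping.1) => w -> X0.
congr EFin; rewrite /stopped_value; case E : (tau w) => [s| |]//.
by rewrite /disc (region_exit_below _ E) ?X0 ?(ltW x0)// linc divff ?mulr1// gt_eqF.
Qed.

Lemma stopped_lin_between (a b x : R) (f : T -> \bar R) : y1 < x < y2 ->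
  (forall w, 0 <= f w)%E ->
  {ae P x, forall w, X' 0 w = x -> f w = (stopped_value X' r (lin beta r a b) tau w)%:E} ->
  (\int[P x]_w f w = (lin beta r a b x)%:E)%E.
Proof.
move=> /andP[x1 x2] f0 fv; pose N := Num.max `|y1| `|y2|.
have N0 : 0 <= N by rewrite le_max normr_ge0.
have [B B0 HB] := supersolution_bounded N0 (supersolution_lin hbeta hr a b).
apply: (@stopped_lin a b B x f _ region_stopping) => //.
apply: aeW => w X0 s s0 st; apply: HB.
have /andP[h1 h2] : y1 <= X' s w <= y2 by apply: region_between; rewrite ?X0 ?(ltW x1) ?(ltW x2).
have n1 : `|y1| <= N by rewrite le_max lexx.
have n2 : `|y2| <= N by rewrite le_max lexx orbT.
move: n1 n2; rewrite !ler_norml => /andP[? ?] /andP[? ?]; apply/andP; split; lra.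
Qed.

Lemma payoff_between a b x : y1 < x < y2 -> lin beta r a b y1 = g y1 ->
  lin beta r a b y2 = g y2 ->
  (\int[P x]_w discounted_payoff r g X tau w = (lin beta r a b x)%:E)%E.
Proof.
move=> x12 E1 E2; apply: stopped_lin_between => //.
  by move=> w; exact: discounted_payoff_ge0.
apply: filterS (discounted_payoff_ae x region_stopping.1) => w -> X0.
congr EFin; rewrite /stopped_value; case E : (tau w) => [s| |]//.
have X0' : y1 <= X' 0 w <= y2 by rewrite X0; case/andP: x12 => /ltW -> /ltW ->.
by rewrite /disc; case: (region_exit_between X0' E) => ->; rewrite ?E1 ?E2.
Qed.

Let kpt (y x : R) : R := `|x - y|.

Let kptc y : continuous (kpt y).
Proof.
move=> x; apply: (@continuous_comp _ _ _ (fun x : R => x - y) (@Num.norm _ _)).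
  by apply: cvgB; [exact: cvg_id|exact: cvg_cst].
exact: norm_continuous.
Qed.

Let kptE y x : [set y] x <-> kpt y x <= 0.
Proof.
rewrite /kpt normr_le0 subr_eq0; split=> [->|/eqP ->]//.
Qed.

Let point_ge w y : A y -> (tau w <= hitting_time X [set y] w)%E.
Proof.
move=> Ay; rewrite (hitting_timeE X Ak) (hitting_timeE X (kptE y)).
apply/first_time_ge => t t0 /kptE Xy; apply: first_time_le => //.
by apply/Ak; rewrite Xy.
Qed.

Let point_at w y s : tau w = s%:E -> X' s w = y -> hitting_time X [set y] w = s%:E.
Proof.
move=> ts Xs; have [s0 As] := hitting_time_attained Xc kc Ak ts.
apply/eqP; rewrite eq_le -{2}ts point_ge ?andbT; last by rewrite -Xs.
by rewrite (hitting_timeE X (kptE y)); apply: first_time_le => //; apply/kptE.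
Qed.

(** Between [y1] and [y2] the region is entered at one of the two points, so the event of reaching
    [ya] first becomes the boundary values 1 at [ya] and 0 at [yb]. *)
Lemma hit_before_between (a b ya yb x : R) : y1 < x < y2 ->
  (ya = y1 /\ yb = y2) \/ (ya = y2 /\ yb = y1) ->
  lin beta r a b ya = 1 -> lin beta r a b yb = 0 ->
  discounted_hit_before P r X ya yb x = (lin beta r a b x)%:E.
Proof.
move=> x12 yab Ea Eb; rewrite /discounted_hit_before integral_mkcond.
have Aab : A ya /\ A yb by case: yab => -[-> ->].
have nab : ya <> yb.
  by case: yab => -[-> ->] E; move: y12; rewrite E ltxx.
apply: stopped_lin_between => //.
  by move=> w; rewrite patchE; case: ifP => // _; exact: expeR_ge0.
apply: aeW => w X0; have X0' : y1 <= X' 0 w <= y2.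
  by rewrite X0; case/andP: x12 => /ltW -> /ltW ->.
have hit y s : A y -> hitting_time X [set y] w = s%:E -> X' s w = y.
  by move=> Ay /(hitting_time_attained Xc (@kptc y) (kptE y))[].
rewrite patchE /stopped_value; have t0 := region_stopping.1 w.
case E : (tau w) t0 => [s| |]// s0; last first.
  (* If [tau] is infinite so is the hitting time of [ya], which is then not strictly smaller than
     that of [yb]. *)
  rewrite memNset//= => h; have := point_ge w Aab.1; rewrite E leye_eq => /eqP h1.
  by move: h; rewrite h1 ltNge leey.
have Xs : X' s w = ya \/ X' s w = yb.
  by case: (region_exit_between X0' E) => ->; case: yab => -[-> ->]; [left|right|right|left].
case: Xs => Xs.
  have hs := point_at E Xs.
  rewrite mem_set /=; last first.
    rewrite hs lt_neqAle -{2}E point_ge ?andbT; last exact: Aab.2.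
    apply/eqP => /esym /(hit _ _ Aab.2); rewrite Xs; exact: nab.
  by rewrite hs /disc Xs Ea mulr1 -EFinM mulNr.
have hs := point_at E Xs.
rewrite memNset/=; first by rewrite /disc Xs Eb mulr0.
rewrite hs => h; have := point_ge w Aab.1; rewrite E => h'.
by have := lt_le_trans h h'; rewrite ltxx.
Qed.

End two_sided.

End verification.

Theorem proposition4p6
  (R : realType) (d : measure_display) (T : measurableType d)
  (P : R -> probability T R) (X : R -> T -> R)
  (beta r : R) (g : R -> R) (xs : R)
  (hbeta : 1 / 2 < beta < 1) (hr : 0 < r)
  (hX : forall x, skew_brownian_motion beta x (P x) X)
  (g_cont : continuous g)
  (g_mono : {homo g : x y / x <= y})
  (g_ge0 : forall x, 0 <= g x)
  (g_deriv : has_one_sided_derivatives g)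
  (g_pinfty : g x / psi beta r x @[x --> +oo] --> (0 : R))
  (g_ninfty : g x / psi beta r x @[x --> -oo] --> (0 : R))
  (hM : argmax (fun x => g x / psi beta r x) = [set xs])
  (hxs : xs < 0)
  (g_C2 : C2_from xs g)
  (g_slope : 0 < beta * derive1 g 0
             < (1 - beta) * Num.sqrt (2 * r)
               * expR (- Num.sqrt (2 * r) * xs) * g xs)
  (g_super : exists2 eps : R, 0 < eps &
     forall x, xs <= x -> second_derivative_from xs g x - 2 * r * g x < - eps) :
  exists y1 y2 : R,
    let psi := psi beta r in
    let phi := phi beta r in
    let V := value P r g X in
    let A := `[xs, y1] `|` `[y2, +oo[ in
    let E1 := discounted_hit_before P r X y1 y2 in
    let E2 := discounted_hit_before P r X y2 y1 in
    let D := psi y2 * phi y1 - phi y2 * psi y1 in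
    [/\ unique (fun y : R * R =>
          [/\ xs < y.1 < 0, 0 < y.2,
              L_psi beta r g y.1 = L_psi beta r g y.2 &
              L_phi beta r g y.1 = L_phi beta r g y.2]) (y1, y2),
        optimal_stopping_time P r g X (hitting_time X A),
        [/\ forall x, A x -> V x = (g x)%:E,
            forall x, x < xs -> V x = (g xs * (psi x / psi xs))%:E &
            forall x, y1 < x < y2 ->
              V x = ((g y1)%:E * E1 x + (g y2)%:E * E2 x)%E] &
        forall x, y1 < x < y2 ->
          E1 x = ((phi x * psi y2 - psi x * phi y2) / D)%:E /\
          E2 x = ((psi x * phi y1 - phi x * psi y1) / D)%:E].
Proof.
have [eps eps0 g_sup] := g_super.
have g_max y : g y / psi beta r y <= g xs / psi beta r xs.
  by have : argmax (fun x => g x / psi beta r x) xs by rewrite hM.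
have [y1 [y2 [Del [a [b [v [dv [uni [vS vD] gv [vA vxs] vH]]]]]]]] :=
  candidate_exists hbeta hr g_cont g_mono g_ge0 g_max hxs g_C2 g_slope eps0 g_sup.
have [[/= /andP[xs1 y10] y20 _ _] _] := uni.
have y12 := lt_trans y10 y20.
exists y1, y2 => /=.
set A := `[xs, y1] `|` `[y2, +oo[.
have tauX : stopping_time X (hitting_time X A) by exact: (region_stopping hX xs1 y12).
have H1 : lin beta r a b y1 = g y1.
  by rewrite -vH ?lexx ?(ltW y12)// vA//; left; rewrite lexx ltW.
have H2 : lin beta r a b y2 = g y2.
  by rewrite -vH ?lexx ?(ltW y12)// vA//; right.
have AE x : A x <-> xs <= x <= y1 \/ y2 <= x.
  by rewrite /A /= !in_itv/= andbT.
have attained x : (\int[P x]_w discounted_payoff r g X (hitting_time X A) w = (v x)%:E)%E.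
  have [x0|x0] := ltP x xs.
    by rewrite vxs// (payoff_below hbeta hr hX g_mono g_ge0 g_pinfty xs1 y12 hxs x0).
  have [x1|x1] := leP x y1.
    rewrite vA; last by left; rewrite x0.
    apply: (payoff_inside r hbeta hX g_ge0 xs1 y12).
    by apply/AE; left; rewrite x0.
  have [x2|x2] := leP y2 x.
    rewrite vA; last by right.
    apply: (payoff_inside r hbeta hX g_ge0 xs1 y12).
    by apply/AE; right.
  rewrite vH ?(ltW x1) ?(ltW x2)//.
  by apply: (payoff_between hbeta hr hX g_mono g_ge0 g_pinfty xs1 y12) => //; rewrite x1.
(* The candidate dominates the payoff of every stopping time and is attained by the hitting time of
   [A]. *)
have VE x : value P r g X x = (v x)%:E.
  apply/eqP; rewrite eq_le; apply/andP; split.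
    apply: ge_ereal_sup => _ [tau tauS <-].
    exact: (payoff_le_supersolution hbeta hr hX g_mono g_ge0 g_pinfty x vS vD gv tauS).
  by rewrite -attained; apply: ereal_sup_ubound; exists (hitting_time X A).
set D := _ - _ * psi beta r y1.
have D0 : D != 0 by rewrite gt_eqF// wronskian_gt0.
have E12 x : y1 < x < y2 ->
    discounted_hit_before P r X y1 y2 x =
      ((phi beta r x * psi beta r y2 - psi beta r x * phi beta r y2) / D)%:E /\
    discounted_hit_before P r X y2 y1 x =
      ((psi beta r x * phi beta r y1 - phi beta r x * psi beta r y1) / D)%:E.
  move=> x12; split.
    (* Cramer's rule for the combination of [psi] and [phi] equal to 1 at one end and 0 at the
       other. *)
    have -> : (phi beta r x * psi beta r y2 - psi beta r x * phi beta r y2) / D =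
        lin beta r (- (phi beta r y2) / D) (psi beta r y2 / D) x.
      by rewrite /lin; ring.
    apply: (hit_before_between hbeta hr hX xs1 y12 x12); first by left.
      by rewrite /lin; move: D0; rewrite /D => D0; field.
    by rewrite /lin; ring.
  have -> : (psi beta r x * phi beta r y1 - phi beta r x * psi beta r y1) / D =
      lin beta r (phi beta r y1 / D) (- (psi beta r y1) / D) x.
    by rewrite /lin; ring.
  apply: (hit_before_between hbeta hr hX xs1 y12 x12); first by right.
    by rewrite /lin; move: D0; rewrite /D => D0; field.
  by rewrite /lin; ring.
split=> //.
- by split=> // x; rewrite VE attained.
- split=> [x /AE Ax|x x0|x x12]; first by rewrite VE vA.
    by rewrite VE vxs.
  have [-> ->] := E12 x x12; rewrite VE -!EFinM -EFinD; congr EFin.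
  rewrite vH; last by case/andP: x12 => /ltW -> /ltW ->.
  by rewrite -H1 -H2 /lin; move: D0; rewrite /D => D0; field.
Qed.
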